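(* Let $(Z_n)_{n\ge 0}$ be a supercritical branching process with immigration in an i.i.d. random environment (as described in the context), with $0<m_1<\infty$ a.s., $\mu:=\mathbb{E}\log m_1\in(0,\infty)$ and $\mathbb{P}(h(\{0\})<1)>0$. Assume that $\log m_1$ is nonlattice and that (A) $\mathbb{P}\big(h(\{0\})>0,\ f(\{0\})>0,\ f(\{1\})>0\big)>0$; (B) there exists $\delta\in(0,1)$ such that $f(\{0\})<\delta$ a.s.; (C) there are $q>1$ and $p\in(1,2]$ such that $$\mathbb{E}\Big[(1+|\log m_1|^q)\Big(\Big(\frac{N_{1,1}}{m_1}\Big)^p+1\Big)\Big]<\infty\quad\text{and}\quad \mathbb{E}[Y_1^p]<\infty .$$ Then for all integers $k\ge1$ and all $0\le B<C<\infty$, $$\lim_{y\to\infty}\mathbb{E}_k\big(\sharp\{n:\log Z_n\in y+[B,C]\}\big)=\lim_{y\to\infty}\mathbb{E}_k\big(\sharp\{n: e^{B}y\le Z_n\le e^{C}y\}\big)=\frac1\mu (C-B).$$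
   Context: $\mathbb{N}=\{0,1,2,\dots\}$. Let $\Delta$ be the space of pairs of probability measures on $\mathbb{N}$, with the component-wise total variation metric. Let $\mathbf Q=(f,h)$ be a random element of $\Delta$ and let $\mathbf Q_n=(f_n,h_n)$, $n\ge1$, be independent copies of $\mathbf Q$ (independence of $f_n$ and $h_n$ for fixed $n$ is not assumed). The sequence $\xi=(\mathbf Q_1,\mathbf Q_2,\dots)$ is the random environment. The branching process with immigration in the random environment $\xi$ is the $\mathbb{N}$-valued process $(Z_n)$ with $Z_0=k\in\mathbb{N}\setminus\{0\}$ which, given $\xi$, is a Markov chain satisfying $Z_n=\sum_{i=1}^{Z_{n-1}}N_{n,i}+Y_n$ for $n\ge1$, where given $\xi$ all the variables $N_{n,i},Y_n$ are independent (and independent of the past), the $N_{n,i}$, $i\ge1$, have law $f_n$ (offspring) and $Y_n$ has law $h_n$ (immigrants). $\mathbb{P}$ is the annealed probability (averaged over $\xi$), $\mathbb{E}$ its expectation; $\mathbb{P}_k(\cdot)=\mathbb{P}(\cdot\mid Z_0=k)$ with expectation $\mathbb{E}_k$. $m_n=\sum_{j\ge0} j f_n(\{j\})$ is the mean of $f_n$. $\sharp$ denotes cardinality, and $\log 0=-\infty$. Nonlattice means: there are no $a\in\mathbb{R}$, $d>0$ with $\mathbb{P}(\log m_1\in a+d\mathbb{Z})=1$. *)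

(* Defs.v *)
From HB Require Import structures.
From mathcomp Require Import all_boot all_order all_algebra.
From mathcomp Require Import all_classical all_reals all_analysis.

Set Implicit Arguments.
Unset Strict Implicit.
Unset Printing Implicit Defensive.

Import Order.TTheory GRing.Theory Num.Theory.
Import numFieldNormedType.Exports.

Local Open Scope classical_set_scope.
Local Open Scope ring_scope.

Section environment_space.
Variable R : realType.

Definition tv_dist (f g : pprobability nat R) : R :=
  sup [set `|fine (f A) - fine (g A)| | A in [set: set nat]].

(* Open sets of the component-wise total variation metric on pairs (f, h). *)
Definition tv_open : set (set (pprobability nat R * pprobability nat R)) :=
  [set U | forall q, U q -> exists2 e : R, 0 < e &
    forall q', tv_dist q.1 q'.1 < e -> tv_dist q.2 q'.2 < e -> U q'].

(* Pairs (offspring law, immigration law), with the Borel sigma-algebra of the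
   total variation metric rather than the library's product sigma-algebra. *)
Definition environment : measurableType tv_open.-sigma :=
  g_sigma_algebraType tv_open.

Definition offspring_law (q : environment) : pprobability nat R := q.1.
Definition immigration_law (q : environment) : pprobability nat R := q.2.

Definition offspring_mean (q : environment) : \bar R :=
  (\sum_(0 <= j <oo) j%:R%:E * offspring_law q [set j])%E.

End environment_space.

Section probability_notions.
Context d (T : measurableType d) (R : realType) (P : probability T R).

Definition iid d' (U : measurableType d') (X : nat -> {mfun T >-> U}) : Prop :=
  (forall n B, measurable B -> P (X n @^-1` B) = P (X 0%N @^-1` B)) /\
  (forall (s : seq nat) (B : nat -> set U), uniq s ->
    (forall j, measurable (B j)) ->
    P (\bigcap_(j in [set` s]) X j @^-1` B j) =
    \big[*%E/1%E]_(j <- s) P (X j @^-1` B j)).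

Definition nonlattice (X : T -> R) : Prop :=
  ~ exists (a h : R),
      0 < h /\ P [set w | exists z : int, X w = a + h * z%:~R] = 1%E.

End probability_notions.

(* Time is shifted by one: Q n, N n i, Y n stand for Q_{n+1}, N_{n+1,i+1},
   Y_{n+1}, so that they produce generation n.+1 from generation n. *)
Section branching.
Context d (T : measurableType d) (R : realType) (P : probability T R).
Variable Q : nat -> {mfun T >-> environment R}.
Variables (N : nat -> nat -> {mfun T >-> nat}) (Y : nat -> {mfun T >-> nat}).

Definition environment_events : set (set T) :=
  <<s [set E | exists n (B : set (environment R)),
               measurable B /\ E = Q n @^-1` B] >>.

(* The index (n, Some i) designates N n i, and (n, None) designates Y n. *)
Definition reproduction_var (j : nat * option nat) : {mfun T >-> nat} :=
  if j.2 is Some i then N j.1 i else Y j.1.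

Definition reproduction_law (j : nat * option nat) (w : T) :
    pprobability nat R :=
  if j.2 is Some _ then offspring_law (Q j.1 w) else immigration_law (Q j.1 w).

(* Conditionally on sigma(Q_1, Q_2, ...), the variables N_{n,i} and Y_n are
   independent with respective laws f_n and h_n: the product below is a version
   of the conditional probability of the finite intersection. *)
Definition quenched_independent : Prop :=
  forall (s : seq (nat * option nat)) (B : nat * option nat -> set nat)
    (A : set T), uniq s -> environment_events A ->
  P (A `&` \bigcap_(j in [set` s]) reproduction_var j @^-1` B j) =
  (\int[P]_(w in A) \big[*%E/1]_(j <- s) reproduction_law j w (B j))%E.

Fixpoint bpire (k n : nat) (w : T) : nat :=
  if n is n'.+1 then (\sum_(i < bpire k n' w) N n' i w + Y n' w)%N else k.

End branching.

(* Main.v *)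
(* Let S be the random walk whose steps, distributed as X = ln m, have positive
   mean and are bounded below, as m >= 1 - f{0} > 1 - delta.  Its renewal
   function M, smoothed by a ramp, is Lipschitz and satisfies Blackwell's theorem
   M(y + a) - M(y) -> a / mu: increments of M are bounded and harmonic far out, so
   by the Choquet-Deny extremal argument they are asymptotically invariant under
   the closed group generated by the differences of support points, which is the
   whole line in the nonlattice case.

   The process ln Z is a perturbation of S: a truncated second-moment estimate,
   uniform in z, bounds the mean of |Z_1 / (z m) - 1| from Z_0 = z by a negative
   power of z.  A Lyapunov function yields that the sum over n of E[Z_n^(-s)] is
   finite for small s > 0.  Applying the increments of M to y - ln Z_n and
   telescoping, the expected smoothed number of visits of ln Z to y + [0, a] equals
   M(y + a - ln k) - M(y - ln k) up to an error which is dominated by that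
   convergent sum and vanishes termwise as y -> +oo.  Hence ln Z and S have the
   same limit a / mu, and windows are sandwiched between ramps. *)

Require Import Defs.
From HB Require Import structures.
From mathcomp Require Import all_boot all_order all_algebra.
From mathcomp Require Import all_classical all_reals all_analysis.
From mathcomp Require Import measurable_realfun ring lra.

Set Implicit Arguments.
Unset Strict Implicit.
Unset Printing Implicit Defensive.

Import Order.TTheory GRing.Theory Num.Theory.
Import numFieldNormedType.Exports.

Local Open Scope classical_set_scope.
Local Open Scope ring_scope.

(** A single exponent [s] carries the proof. Since [X] is bounded below with positive mean,
    E[e^(-sX)] is finite for [s > 0] and less than 1 for small [s]; call it [rho]. One step of the
    walk then multiplies [expR (s * y)] by [rho], so the renewal series converges, with M(y) <=
    e^(sy) / (1 - rho). For the process, z^(-s) decreases on average when z is large. Finally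
    [s <= (p - 1) / 8] makes the one-step error a constant times z^(-2s); the spare factor z^(-s) is
    what the drift estimate absorbs.

    Walk and process are compared one step at a time inside the same environment, so no almost sure
    limit of Z_n e^(-S_n) is used. M itself is unbounded; its increments are bounded and Lipschitz,
    so a small one-step error in ln Z has a proportional cost. This is why the ramp replaces an
    indicator.

    The obstacle is the behaviour near 0, where ln Z says nothing about the walk and the process may
    return again and again. There the error is merely bounded; the Lyapunov function shows that the
    expected number of such returns is finite. *)

Section expectation.
Context d (T : measurableType d) (R : realType) (P : probability T R).
Implicit Types f g : T -> R.

Lemma integrable_bounded f (K : R) : measurable_fun setT f ->
  (forall w, `|f w| <= K) -> P.-integrable setT (EFin \o f).
Proof.
move=> mf fK; apply: measurable_bounded_integrable => //=; first by rewrite -ge0_fin_numE ?fin_num_measure.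
exists K; split; [exact: num_real|].
by move=> x Kx w _; apply: le_trans (fK w) (ltW Kx).
Qed.

Lemma Rintegral_probability_cst (r : R) : \int[P]_w r = r.
Proof. by rewrite Rintegral_cst// [X in fine X](probability_setT P) mulr1. Qed.

Lemma Rintegral_le f g : P.-integrable setT (EFin \o f) ->
  P.-integrable setT (EFin \o g) -> (forall w, f w <= g w) ->
  \int[P]_w f w <= \int[P]_w g w.
Proof. by move=> *; apply: le_Rintegral. Qed.

Lemma EFin_Rintegral f : P.-integrable setT (EFin \o f) ->
  (\int[P]_w f w)%:E = (\int[P]_w (f w)%:E)%E.
Proof. by move=> fi; rewrite /Rintegral fineK//; exact: integrable_fin_num. Qed.

Lemma Rintegral_dominated_cvg (F : nat -> T -> R) f g :
  (forall n, measurable_fun setT (F n)) ->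
  P.-integrable setT (EFin \o g) -> (forall n w, `|F n w| <= g w) ->
  (forall w, F n w @[n --> \oo] --> f w) ->
  \int[P]_w F n w @[n --> \oo] --> \int[P]_w f w.
Proof.
move=> mF ig Fg Ff.
have mf : measurable_fun setT f by apply: (measurable_fun_cvg mF) => w _; exact: Ff.
have [] := @dominated_convergence _ _ _ P setT measurableT
  (fun n w => (F n w)%:E) (EFin \o f) (EFin \o g).
- by move=> n; exact/measurable_EFinP.
- exact/measurable_EFinP.
- by apply: aeW => w _; apply/cvg_EFin; [exact: nearW|exact: Ff].
- exact: ig.
- by apply: aeW => w n _ /=; rewrite lee_fin.
move=> fi _ cv; apply: fine_cvg; rewrite fineK//; exact: integrable_fin_num.
Qed.

Lemma Rintegral_dominated_cvg_pinfty (F : R -> T -> R) f g :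
  (forall y, measurable_fun setT (F y)) ->
  P.-integrable setT (EFin \o g) -> (forall y w, `|F y w| <= g w) ->
  (forall w, F y w @[y --> +oo] --> f w) ->
  \int[P]_w F y w @[y --> +oo] --> \int[P]_w f w.
Proof.
move=> mF ig Fg Ff; apply/cvg_pinftyP => u uoo.
apply: (@Rintegral_dominated_cvg (fun n => F (u n)) f g) => // w.
exact: (cvg_pinftyP _ _).1 (Ff w) u uoo.
Qed.

End expectation.

(** * Blackwell's theorem for random walks bounded below *)

Section negative_exponential_moment.
Context d (T : measurableType d) (R : realType) (P : probability T R).
Variables (X : T -> R) (b : R).
Hypotheses (mX : measurable_fun setT X) (iX : P.-integrable setT (EFin \o X)).
Hypotheses (b0 : 0 <= b) (Xb : forall w, - b <= X w).

Let minr_cvg (x : R) : Num.min x n%:R @[n --> \oo] --> x.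
Proof.
apply: (@cvg_near_cst _ _ x); near=> n; apply/min_idPl.
near: n; exact: nbhs_infty_ger.
Unshelve. all: by end_near. Qed.

(** Bound [expR (- x)] by [1 / (1 + x)]; the right-hand side times [1 + x] is [1 + x ^ 2 (1 + 2 x)],
    which is at least 1 as long as [x >= - 1 / 2]. *)
Lemma expRN_le_quad (x : R) : `|x| <= 2^-1 -> expR (- x) <= 1 - x + 2 * x ^+ 2.
Proof.
rewrite ler_norml => /andP[x1 x2]; rewrite expRN.
have h := expR_ge1Dx x; have x0 : 0 < 1 + x by lra.
apply: (@le_trans _ _ (1 + x)^-1); first by rewrite lef_pV2// posrE expR_gt0.
rewrite -div1r ler_pdivrMr//.
have -> : (1 - x + 2 * x ^+ 2) * (1 + x) = 1 + x ^+ 2 * (1 + 2 * x) by ring.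
rewrite lerDl mulr_ge0 ?sqr_ge0//; lra.
Qed.

Lemma measurable_expRM (s : R) : measurable_fun setT (fun w => expR (s * X w)).
Proof. by apply: measurableT_comp => //; exact: measurable_funM. Qed.

Lemma expRM_bounded (s : R) w : 0 <= s -> `|expR (- s * X w)| <= expR (s * b).
Proof.
move=> s0; rewrite ger0_norm ?expR_ge0// ler_expR.
by have ? := Xb w; nra.
Qed.

(** [X] may lack a second moment, so it is replaced by [Y = min(X, n)], which is bounded, has mean
    at least [mu / 2] for large [n], and can only increase [expR (- s X)]. A second-order expansion
    then gives the bound [1 - s mu / 2 + O(s ^ 2)]. *)
Lemma negative_exponential_moment_lt1 : 0 < \int[P]_w X w ->
  exists2 s0 : R, 0 < s0 &
    forall s, 0 < s <= s0 -> \int[P]_w expR (- s * X w) < 1.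
Proof.
set mu := \int[P]_w X w => mu0; have b0' := b0.
have mm n : measurable_fun setT (fun w => Num.min (X w) n%:R).
  exact: measurable_minr.
have cv : \int[P]_w Num.min (X w) n%:R @[n --> \oo] --> mu.
  apply: (@Rintegral_dominated_cvg _ _ _ _ _ _ (fun w => `|X w|)) => //.
  - exact: integrable_norm.
  - move=> n w; case: (leP (X w) n%:R) => // h.
    by rewrite ger0_norm// (le_trans (ltW h))// ler_norm.
have [n hn] : exists n, mu / 2 <= \int[P]_w Num.min (X w) n%:R.
  have h2 : 0 < mu / 2 by rewrite divr_gt0.
  have /cvgrPdist_lt/(_ _ h2)[n _ /(_ n (leqnn n))] := cv.
  rewrite ltr_norml => /andP[_ h]; exists n; move: h => /=.
  lra.
have [K K1 KE] : exists2 K, 1 <= K & K = b + n%:R + 1.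
  by exists (b + n%:R + 1) => //; rewrite lerDr addr_ge0.
pose Y w := Num.min (X w) n%:R.
have YK w : `|Y w| <= K.
  rewrite ler_norml KE /Y; have := Xb w; have := ler0n R n.
  case: (leP (X w) n%:R) => ? ? ?; apply/andP; split; lra.
have iY : P.-integrable setT (EFin \o Y) by exact: integrable_bounded (mm n) YK.
(* The first entry gives [|s Y| <= 1 / 2], the range of the quadratic bound; the second makes the
   quadratic term [2 (s K) ^ 2] at most [s mu / 4], half of the linear gain. *)
exists (Num.min (2 * K)^-1 (mu / (8 * K ^+ 2))).
  rewrite lt_min; apply/andP; split; first by rewrite invr_gt0; lra.
  by apply: divr_gt0 => //; nra.
move=> s /andP[s0]; rewrite le_min => /andP[s1 s2].
have sK : s * K <= 2^-1.
  have := ler_wpM2r (_ : 0 <= K) s1; rewrite invfM -mulrA mulVf; first by lra.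
  by rewrite gt_eqF//; lra.
have sK2 : s * (8 * K ^+ 2) <= mu by rewrite -ler_pdivlMr//; nra.
apply: (@le_lt_trans _ _ (\int[P]_w (- s * Y w + (1 + 2 * (s * K) ^+ 2)))).
  apply: Rintegral_le.
  - apply: (@integrable_bounded _ _ _ _ _ (expR (s * b))); first exact: measurable_expRM.
    by move=> w; apply: expRM_bounded; exact: ltW.
  - apply: (@integrable_bounded _ _ _ _ _ (s * K + (1 + 2 * (s * K) ^+ 2))).
      by apply: measurable_funD => //; apply: measurable_funM => //; exact: mm.
    move=> w; rewrite (le_trans (ler_normD _ _))//; apply: lerD.
      by rewrite normrM normrN (gtr0_norm s0); exact: ler_wpM2l (ltW s0) _ _ (YK w).
    by rewrite ger0_norm// addr_ge0// mulr_ge0// sqr_ge0.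
  - move=> w; apply: (@le_trans _ _ (expR (- (s * Y w)))).
      by rewrite ler_expR mulNr lerN2 ler_pM2l// /Y ge_min lexx.
    have h : `|s * Y w| <= s * K by rewrite normrM (gtr0_norm s0); exact: ler_wpM2l (ltW s0) _ _ (YK w).
    apply: le_trans (expRN_le_quad (le_trans h sK)) _.
    have q : (s * Y w) ^+ 2 <= (s * K) ^+ 2.
      by rewrite -(ger0_norm (sqr_ge0 _)) normrX lerXn2r// nnegrE; nra.
    by rewrite mulNr; lra.
rewrite RintegralD//; first last.
- by apply: (@integrable_bounded _ _ _ _ _ (`|1 + 2 * (s * K) ^+ 2|)) => //.
- by have := integrableZl measurableT (- s) iY.
rewrite RintegralZl// Rintegral_probability_cst.
have e2 : (s * K) ^+ 2 = (s * (8 * K ^+ 2)) * s / 8.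
  by rewrite exprMn; field.
rewrite e2.
have h : s * (mu / 2) <= s * \int[P]_w Y w := ler_wpM2l (ltW s0) hn.
have h2 : (s * (8 * K ^+ 2)) * s <= mu * s by rewrite ler_wpM2r// ltW.
have h3 : 0 < mu * s by rewrite mulr_gt0.
by move: h h2 h3; rewrite mulNr [_ * (mu / 2)]mulrA [s * mu]mulrC; lra.
Qed.

End negative_exponential_moment.

Section ramp.
Context {R : realType}.
Variable eps : R.
Hypothesis eps0 : 0 < eps.

Definition ramp (y : R) : R := Num.min 1 (Num.max 0 (y / eps)).

Lemma ramp_ge0 y : 0 <= ramp y.
Proof. by rewrite /ramp le_min ler01 le_max lexx. Qed.

Lemma ramp_le1 y : ramp y <= 1.
Proof. by rewrite /ramp ge_min lexx. Qed.

Lemma ramp_nondecreasing : nondecreasing_fun ramp.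
Proof.
by move=> x y xy; rewrite /ramp le_min2// le_max2// ler_pM2r// invr_gt0.
Qed.

Lemma ramp_eq0 y : y <= 0 -> ramp y = 0.
Proof.
move=> y0; rewrite /ramp; have -> : Num.max 0 (y / eps) = 0.
  by apply/max_idPl; rewrite pmulr_lle0 ?invr_gt0.
by apply/min_idPr.
Qed.

Lemma ramp_eq1 y : eps <= y -> ramp y = 1.
Proof.
by move=> ey; apply/min_idPl; rewrite le_max ler_pdivlMr// mul1r ey orbT.
Qed.

Lemma ramp_lipschitz y a : 0 <= a -> ramp (y + a) - ramp y <= a / eps.
Proof.
move=> a0; rewrite /ramp mulrDl; have : 0 <= a / eps by rewrite divr_ge0// ltW.
move: (a / eps) (y / eps) => z t z0.
by case: (leP 0 t) => ?; case: (leP 0 (t + z)) => ?;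
  rewrite /Order.min; do 2 ?case: ifPn => ?; lra.
Qed.

End ramp.

(** * The smoothed renewal function and its Lipschitz bound *)

Section renewal_function.
Context d (T : measurableType d) (R : realType) (P : probability T R).
Variables (X : T -> R) (b s eps : R).
Hypotheses (mX : measurable_fun setT X) (Xb : forall w, - b <= X w).
Let rho := \int[P]_w expR (- s * X w).
Hypotheses (s0 : 0 < s) (rho1 : rho < 1) (eps0 : 0 < eps).

(* The sum over [i < n] of E[ramp eps (y - S_i)], S being the random walk with
   steps distributed as [X]. *)
Fixpoint partial_renewal (n : nat) (y : R) : R :=
  if n is m.+1 then ramp eps y + \int[P]_w partial_renewal m (y - X w) else 0.

Lemma measurable_nondecreasing_shift (f : R -> R) y : nondecreasing_fun f ->
  measurable_fun setT (fun w => f (y - X w)).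
Proof.
move=> fnd; apply: measurableT_comp; first exact: nondecreasing_measurable.
by apply: measurable_funB.
Qed.

Lemma expR_shift_le y w : expR (s * (y - X w)) <= expR (s * (y + b)).
Proof. by rewrite ler_expR ler_pM2l// lerD2l lerNl. Qed.

Lemma Rintegral_expR_shift y :
  \int[P]_w expR (s * (y - X w)) = rho * expR (s * y).
Proof.
rewrite mulrC -RintegralZl//.
  by apply: eq_Rintegral => w _; rewrite -expRD mulrBr mulNr.
apply: (@integrable_bounded _ _ _ _ _ (expR (s * b))).
  exact: measurable_expRM.
by move=> w; apply: expRM_bounded => //; exact: ltW.
Qed.

Lemma integrable_shift (f : R -> R) y (K : R) : nondecreasing_fun f ->
  (forall x, 0 <= f x <= K * expR (s * x)) ->
  P.-integrable setT (EFin \o (fun w => f (y - X w))).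
Proof.
move=> fnd fK; have K0 : 0 <= K.
  by have /andP[/le_trans h /h] := fK 0; rewrite mulr0 expR0 mulr1.
apply: (@integrable_bounded _ _ _ _ _ (K * expR (s * (y + b)))).
  exact: measurable_nondecreasing_shift.
move=> w; have /andP[f0 fle] := fK (y - X w).
by rewrite ger0_norm// (le_trans fle)// ler_wpM2l// expR_shift_le.
Qed.

Let rhoN0 : 0 < 1 - rho. Proof. by rewrite subr_gt0. Qed.

Lemma ramp_le_expR y : ramp eps y <= expR (s * y).
Proof.
have [y0|y0] := leP y 0; first by rewrite ramp_eq0// expR_ge0.
by rewrite (le_trans (ramp_le1 _ _))// -expR0 ler_expR mulr_ge0// ltW.
Qed.

(** [expR (s * y)] dominates the ramp and is multiplied by [rho] under one step, whence a geometric
    series. Monotonicity belongs to the same induction because it supplies the measurability on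
    which integrability rests. *)
Lemma partial_renewal_bounds n : nondecreasing_fun (partial_renewal n) /\
  forall y, 0 <= partial_renewal n y <= (1 - rho)^-1 * expR (s * y).
Proof.
elim: n => [|n [nd bd]] /=.
  by split=> // y; rewrite lexx mulr_ge0 ?expR_ge0// invr_ge0 ltW.
split=> [x y xy|y].
  apply: lerD; first exact: ramp_nondecreasing.
  apply: Rintegral_le => [||w]; [exact: integrable_shift bd|exact: integrable_shift bd|].
  by apply: nd; rewrite lerD2r.
apply/andP; split.
  rewrite addr_ge0 ?ramp_ge0// Rintegral_ge0// => w _.
  by have /andP[] := bd (y - X w).
have -> : (1 - rho)^-1 * expR (s * y) =
    expR (s * y) + (1 - rho)^-1 * (rho * expR (s * y)).
  by field; rewrite gt_eqF.
apply: lerD; first exact: ramp_le_expR.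
have iE : P.-integrable setT (EFin \o (fun w => expR (s * (y - X w)))).
  apply: (@integrable_shift (fun x => expR (s * x)) y 1).
    by move=> u v uv; rewrite ler_expR ler_pM2l.
  by move=> x; rewrite mul1r expR_ge0 lexx.
rewrite -Rintegral_expR_shift -RintegralZl//.
apply: Rintegral_le => [||w].
- exact: integrable_shift bd.
- exact: (integrableZl measurableT _ iE).
- by have /andP[] := bd (y - X w).
Qed.

Let integrable_partial n y :
  P.-integrable setT (EFin \o (fun w => partial_renewal n (y - X w))).
Proof. by have [nd bd] := partial_renewal_bounds n; exact: integrable_shift bd. Qed.

Lemma partial_renewal_nd_seq y : nondecreasing_seq (partial_renewal ^~ y).
Proof.
apply/nondecreasing_seqP => n; elim: n y => [|n IH] y /=.
  by rewrite addr_ge0 ?ramp_ge0// Rintegral_ge0.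
rewrite lerD2l; apply: Rintegral_le; first exact: integrable_partial.
  exact: (integrable_partial n.+1).
by move=> w; exact: IH.
Qed.

Definition renewal_function (y : R) : R := limn (partial_renewal ^~ y).

Lemma partial_renewal_cvg y :
  partial_renewal n y @[n --> \oo] --> renewal_function y.
Proof.
apply: nondecreasing_is_cvgn; first exact: partial_renewal_nd_seq.
exists ((1 - rho)^-1 * expR (s * y)) => _ [n _ <-].
by have [_ /(_ y)/andP[]] := partial_renewal_bounds n.
Qed.

Lemma renewal_function_bounds y :
  0 <= renewal_function y <= (1 - rho)^-1 * expR (s * y).
Proof.
apply/andP; split.
  apply: limr_ge; first exact: partial_renewal_cvg.
  by apply: nearW => n; have [_ /(_ y)/andP[]] := partial_renewal_bounds n.
apply: limr_le; first exact: partial_renewal_cvg.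
by apply: nearW => n; have [_ /(_ y)/andP[]] := partial_renewal_bounds n.
Qed.

Lemma renewal_function_nondecreasing : nondecreasing_fun renewal_function.
Proof.
move=> x y xy; apply: ler_lim.
- exact: partial_renewal_cvg.
- exact: partial_renewal_cvg.
- by apply: nearW => n; have [nd _] := partial_renewal_bounds n; exact: nd.
Qed.

Lemma renewal_equation y :
  renewal_function y = ramp eps y + \int[P]_w renewal_function (y - X w).
Proof.
have := @partial_renewal_cvg y; rewrite -cvg_shiftS => /cvg_lim <-//.
apply/cvg_lim => //=; apply: cvgD; first exact: cvg_cst.
apply: (@Rintegral_dominated_cvg _ _ _ _ _ _
    (fun w => (1 - rho)^-1 * expR (s * (y + b)))).
- by move=> n; exact/measurable_EFinP/(measurable_int _ (integrable_partial n y)).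
- apply: (@integrable_bounded _ _ _ _ _ `|(1 - rho)^-1 * expR (s * (y + b))|) => //.
- move=> n w; have [_ /(_ (y - X w))/andP[p0 p1]] := partial_renewal_bounds n.
  rewrite ger0_norm// (le_trans p1)// ler_wpM2l ?expR_shift_le//.
  by rewrite invr_ge0 ltW.
- by move=> w; exact: partial_renewal_cvg.
Qed.

(* [v] is excessive for the walk, and its defect [v - E v(. - X)] is bounded below
   on a neighbourhood of the origin: it dominates the increments of the ramp,
   which makes the renewal function Lipschitz. *)
Let v (y : R) : R := Num.min 1 (expR (s * y)).

Let v_nd : nondecreasing_fun v.
Proof. by move=> x y xy; rewrite le_min2// ler_expR ler_pM2l. Qed.

Let v_bd y : 0 <= v y <= 1 * expR (s * y).
Proof. by rewrite mul1r /v le_min ler01 expR_ge0 ge_min lexx orbT. Qed.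

(** Constants are preserved by a step and [expR (s * y)] shrinks by [rho < 1]; a minimum of two
    excessive functions is excessive. *)
Let Av_le y : \int[P]_w v (y - X w) <= v y.
Proof.
rewrite {2}/v le_min; apply/andP; split.
  rewrite -[leRHS](Rintegral_probability_cst P).
  apply: Rintegral_le => [||w]; [exact: integrable_shift v_bd| |].
    by apply: (@integrable_bounded _ _ _ _ _ 1) => // w; rewrite normr1.
  by rewrite /v ge_min lexx.
apply: (@le_trans _ _ (rho * expR (s * y))); last first.
  by rewrite ler_piMl ?expR_ge0// ltW.
rewrite -Rintegral_expR_shift; apply: Rintegral_le => [||w].
- exact: integrable_shift v_bd.
- apply: (@integrable_shift (fun x => expR (s * x)) y 1).
    by move=> u u' uv; rewrite ler_expR ler_pM2l.
  by move=> x; rewrite mul1r expR_ge0 lexx.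
- by rewrite /v ge_min lexx orbT.
Qed.

Let vAv_ge y : y <= 0 -> (1 - rho) * expR (s * y) <= v y - \int[P]_w v (y - X w).
Proof.
move=> y0; have -> : v y = expR (s * y).
  by apply/min_idPr; rewrite expR_le1 pmulr_rle0.
rewrite mulrBl mul1r lerD2l lerN2 -Rintegral_expR_shift.
apply: Rintegral_le => [||w].
- exact: integrable_shift v_bd.
- apply: (@integrable_shift (fun x => expR (s * x)) y 1).
    by move=> u u' uv; rewrite ler_expR ler_pM2l.
  by move=> x; rewrite mul1r expR_ge0 lexx.
- by rewrite /v ge_min lexx orbT.
Qed.

(** The ramp has slope at most [1 / eps], and for [a <= 1] its increment vanishes unless
    [-1 < y < eps]. There [y - eps] lies between [- (1 + eps)] and 0, where the defect of [v] is at
    least [(1 - rho) * expR (- (s * (1 + eps)))]. *)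
Definition renewal_lipschitz : R :=
  eps^-1 * ((1 - rho) * expR (- (s * (1 + eps))))^-1.

Lemma renewal_lipschitz_gt0 : 0 < renewal_lipschitz.
Proof. by rewrite mulr_gt0 ?invr_gt0// mulr_gt0// expR_gt0. Qed.

Let ramp_increment y a : 0 <= a <= 1 ->
  ramp eps (y + a) - ramp eps y <=
  renewal_lipschitz * a * (v (y - eps) - \int[P]_w v (y - eps - X w)).
Proof.
have e0 := eps0; have s0' := s0.
move=> /andP[a0 a1].
have rhs0 : 0 <= renewal_lipschitz * a * (v (y - eps) - \int[P]_w v (y - eps - X w)).
  by rewrite mulr_ge0 ?subr_ge0 ?Av_le// mulr_ge0// ltW// renewal_lipschitz_gt0.
have [y1|y1] := leP y (-1); first by rewrite !ramp_eq0 ?subrr//; lra.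
have [y2|y2] := leP eps y; first by rewrite !ramp_eq1 ?subrr//; lra.
apply: le_trans (ramp_lipschitz eps0 _ a0) _.
apply: (@le_trans _ _ (renewal_lipschitz * a * ((1 - rho) * expR (- (s * (1 + eps)))))).
  rewrite /renewal_lipschitz; have : 0 < (1 - rho) * expR (- (s * (1 + eps))).
    by rewrite mulr_gt0// expR_gt0.
  move: (_ * expR _) => c c0; rewrite le_eqVlt; apply/orP; left; apply/eqP.
  by field; rewrite !gt_eqF.
apply: ler_wpM2l; first by rewrite mulr_ge0// ltW// renewal_lipschitz_gt0.
apply: le_trans (vAv_ge _); last by lra.
by rewrite ler_pM2l// ler_expR; nra.
Qed.

(** [v] splits into its defect, which pays for the increment of the ramp, and its mean after one
    step, which feeds the induction hypothesis: the defects summed along the walk never exceed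
    [v]. *)
Let partial_increment n y a : 0 <= a <= 1 ->
  partial_renewal n (y + a) - partial_renewal n y <= renewal_lipschitz * a * v (y - eps).
Proof.
move=> a01; have /andP[a0 a1] := a01; elim: n y => [|n IH] y /=.
  rewrite subrr mulr_ge0//; last by have /andP[] := v_bd (y - eps).
  by rewrite mulr_ge0// ltW// renewal_lipschitz_gt0.
rewrite opprD addrACA -RintegralB//.
have -> : renewal_lipschitz * a * v (y - eps) =
  renewal_lipschitz * a * (v (y - eps) - \int[P]_w v (y - eps - X w)) +
  \int[P]_w (renewal_lipschitz * a * v (y - eps - X w)).
  by rewrite RintegralZl//; [ring|exact: integrable_shift v_bd].
apply: lerD; first exact: ramp_increment.
apply: Rintegral_le => [||w].
- by have := integrableB measurableT (integrable_partial n (y + a)) (integrable_partial n y).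
- exact: (integrableZl measurableT (renewal_lipschitz * a)
    (integrable_shift (y - eps) v_nd v_bd)).
- by rewrite (addrAC y a) (addrAC y (- eps)) IH.
Qed.

Lemma renewal_increment y a : 0 <= a ->
  renewal_function (y + a) - renewal_function y <= renewal_lipschitz * a.
Proof.
have small z t : 0 <= t <= 1 ->
    renewal_function (z + t) - renewal_function z <= renewal_lipschitz * t.
  move=> t01; have cv : partial_renewal n (z + t) - partial_renewal n z @[n --> \oo] -->
    renewal_function (z + t) - renewal_function z.
    by apply: cvgB; exact: partial_renewal_cvg.
  rewrite -(cvg_lim _ cv)//; apply: limr_le; first by apply/cvg_ex; eexists; exact: cv.
  apply: nearW => n; apply: le_trans (partial_increment _ _ t01) _.
  have /andP[t0 _] := t01.
  rewrite ler_piMr//; last by rewrite /v ge_min lexx.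
  by rewrite mulr_ge0// ltW// renewal_lipschitz_gt0.
(* A longer increment is cut into [n] pieces of length [a / n <= 1]. *)
move=> a0; pose n := (Num.truncn a).+1.
have an : 0 <= a / n%:R <= 1.
  rewrite divr_ge0//= ler_pdivrMr ?ltr0n// mul1r.
  by rewrite ltW// /n -truncn_lt_nat.
have step k : renewal_function (y + (a / n%:R) * k%:R) - renewal_function y
    <= renewal_lipschitz * ((a / n%:R) * k%:R).
  elim: k => [|k IH]; first by rewrite !mulr0 addr0 subrr.
  rewrite -addn1 natrD [a / _ * (_ + _)]mulrDr mulr1 addrA.
  rewrite [leRHS]mulrDr; have := small (y + a / n%:R * k%:R) _ an; move: IH; lra.
by have := step n; rewrite divfK// pnatr_eq0.
Qed.

End renewal_function.

(** * The support of the step law *)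

Section support.
Context d (T : measurableType d) (R : realType) (P : probability T R).
Variable X : T -> R.
Hypothesis mX : measurable_fun setT X.

Definition in_support (c : R) :=
  forall r : R, 0 < r -> (0 < P [set w | c - r < X w < c + r]%R)%E.

Lemma measurable_open_interval_preimage (a b : R) :
  measurable [set w | a < X w < b].
Proof.
rewrite (_ : [set w | _] = X @^-1` `]a, b[%classic); last first.
  by apply/seteqP; split=> w /=; rewrite in_itv.
by rewrite -[X in measurable X]setTI; exact: mX.
Qed.

(** A point outside the support has a null neighbourhood, which shrinks to a null interval with
    rational endpoints; [F] enumerates these countably many intervals. *)
Lemma negligible_notin_support : P.-negligible [set w | ~ in_support (X w)].
Proof.
pose F (n : nat) : set T := if unpickle n is Some (q1, q2) then
  if `[<P [set w | ratr q1 < X w < ratr q2] = 0%E>]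
  then [set w | ratr q1 < X w < ratr q2] else set0 else set0.
apply: (@negligibleS _ _ _ _ (\bigcup_n F n)); last first.
  apply: negligible_bigcup => n; rewrite /F.
  case: (unpickle n) => [[q1 q2]|]; last exact: negligible_set0.
  case: asboolP => [h|_]; last exact: negligible_set0.
  exists [set w | ratr q1 < X w < ratr q2]; split => //.
  exact: measurable_open_interval_preimage.
move=> w /= /existsNP[r] /not_implyP[r0] /negP; rewrite -leNgt => Pr.
have [q1] : exists q, ratr q \in `]X w - r, X w[ by apply: rat_in_itvoo; lra.
have [q2] : exists q, ratr q \in `]X w, X w + r[ by apply: rat_in_itvoo; lra.
rewrite !in_itv /= => /andP[q21 q22] /andP[q11 q12].
exists (pickle (q1, q2)); first by [].
have -> : F (pickle (q1, q2)) = if `[<P [set w | ratr q1 < X w < ratr q2] = 0%E>]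
  then [set w | ratr q1 < X w < ratr q2] else set0 by rewrite /F pickleK.
rewrite asboolT; first by rewrite /= q12 q21.
apply/eqP; rewrite eq_le measure_ge0 andbT; apply: le_trans Pr.
apply: le_measure; rewrite ?inE; try exact: measurable_open_interval_preimage.
by move=> x /= /andP[? ?]; apply/andP; split; lra.
Qed.

Lemma exists_in_support : exists c, in_support c.
Proof.
apply: contrapT => /forallNP h.
have := negligible_notin_support.
rewrite (_ : [set w | _] = setT); last by apply/seteqP; split => // w _ /=; exact: h.
rewrite negligibleP// => /eqP.
by rewrite [X in X == _](probability_setT P) onee_eq0.
Qed.

End support.

(** * Subgroups of the real line *)

Section real_subgroup.
Variables (R : realType) (H : R -> Prop).
Hypotheses (H0 : H 0) (HN : forall x, H x -> H (- x)).
Hypothesis (HD : forall x y, H x -> H y -> H (x + y)).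

Let HB x y : H x -> H y -> H (x - y).
Proof. by move=> hx hy; apply: HD => //; exact: HN. Qed.

Let Hn x (n : nat) : H x -> H (x * n%:R).
Proof.
move=> hx; elim: n => [|n IH]; first by rewrite mulr0.
by rewrite -natr1 mulrDr mulr1; exact: HD.
Qed.

Let Hz x (z : int) : H x -> H (x * z%:~R).
Proof.
move=> hx; case: (intP z) => [|n|n]; first by rewrite mulr0.
  exact: Hn.
by rewrite mulrNz mulrN; apply: HN; exact: Hn.
Qed.

Lemma subgroup_dense_or_cyclic :
  (forall x r, 0 < r -> exists2 x', H x' & `|x - x'| < r) \/
  (exists2 h, 0 < h & forall x, H x -> exists z : int, x = h * z%:~R).
Proof.
have remainder (a x : R) : 0 < a -> 0 <= x - a * (Num.floor (x / a))%:~R < a.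
  move=> a0; have /andP[f1 f2] := Num.Theory.floor_itv (x / a).
  rewrite ler_pdivlMr// in f1; rewrite ltr_pdivrMr// intrD in f2.
  by apply/andP; split; lra.
have [dense|] := pselect (forall r, 0 < r -> exists2 a, H a & 0 < a < r).
  left => x r /dense[a Ha /andP[a0 ar]].
  exists (a * (Num.floor (x / a))%:~R); first exact: Hz.
  have /andP[f1 f2] := remainder _ x a0.
  by rewrite ger0_norm// (lt_trans f2).
move=> /existsNP[r0] /not_implyP[r00] gap; right.
have gapP a : H a -> 0 < a -> r0 <= a.
  by move=> Ha a0; rewrite leNgt; apply/negP => ar; apply: gap; exists a => //; apply/andP.
(* The trivial group falls in the cyclic case, with generator 1 and multiplier 0. *)
have [[a1 Ha1 a10]|noP] := pselect (exists2 a, H a & 0 < a); last first.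
  exists 1 => // x Hx; exists 0; rewrite mulr0; apply/eqP; apply/negP => /negP x0.
  apply: noP; have [x1|x1] := ltP 0 x; first by exists x.
  by exists (- x); [exact: HN|rewrite oppr_gt0 lt_neqAle x0].
pose S : set R := [set a | H a /\ 0 < a].
have lbS : has_lbound S by exists r0 => a [Ha a0]; exact: gapP.
have infS : has_inf S by split=> //; exists a1.
have [g [Hg g0] gr] := inf_adherent r00 infS.
(* [g] lies within [r0] of the infimum, so a positive element [a < g] would make [g - a] a positive
   element below the gap [r0]. Hence [g] is the least positive element, and remainders modulo [g]
   vanish. *)
have minS a : H a -> 0 < a -> g <= a.
  move=> Ha a0; rewrite leNgt; apply/negP => ag.
  have ia : inf S <= a by apply: ge_inf.
  have : r0 <= g - a by apply: gapP; [exact: HB|rewrite subr_gt0].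
  by lra.
exists g => // x Hx; exists (Num.floor (x / g)).
have /andP[f1 f2] := remainder _ x g0.
apply/eqP; rewrite -subr_eq0 eq_le f1 andbT leNgt; apply/negP => f3.
have := minS _ (HB Hx (Hz (Num.floor (x / g)) Hg)) f3.
by rewrite leNgt f2.
Qed.

End real_subgroup.

(** * Asymptotic periods of functions harmonic far out *)

Section asymptotic_translation_invariance.
Context d (T : measurableType d) (R : realType) (P : probability T R).
Variable X : T -> R.
Hypothesis mX : measurable_fun setT X.

Lemma tail_probability_small (e : R) : 0 < e ->
  exists M : R, \int[P]_w \1_[set w | M < X w] w <= e.
Proof.
move=> e0.
have mI (M : R) : measurable [set w | M < X w].
  rewrite (_ : [set w | _] = X @^-1` `]M, +oo[%classic); last first.
    by apply/seteqP; split=> w /=; rewrite in_itv /= andbT.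
  by rewrite -[X in measurable X]setTI; exact: mX.
have : \int[P]_w \1_[set w | n%:R < X w] w @[n --> \oo] --> \int[P]_w (0 : R).
  apply: (@Rintegral_dominated_cvg _ _ _ _ _ _ (fun w => 1)).
  - by move=> n; exact: measurable_indic.
  - by apply: (@integrable_bounded _ _ _ _ _ 1) => // w; rewrite normr1.
  - by move=> n w; rewrite indicE; case: (_ \in _); rewrite ?normr1 ?normr0.
  move=> w; apply: cvg_near_cst; near=> n.
  rewrite indicE memNset//= => /ltW; apply/negP; rewrite -ltNge.
  near: n; exact: nbhs_infty_gtr.
rewrite Rintegral_probability_cst => /cvgrPdist_le/(_ _ e0)[n _ /(_ n (leqnn n))].
rewrite /= sub0r normrN => h; exists n%:R; exact: le_trans (ler_norm _) h.
Unshelve. all: by end_near. Qed.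

Section extremal.
Variables (g : R -> R) (B L y0 l : R).
Hypotheses (mg : measurable_fun setT g) (gB : forall y, `|g y| <= B).
Hypothesis gL : forall x y, `|g x - g y| <= L * `|x - y|.
Hypothesis gharm : forall y, y0 <= y -> g y = \int[P]_w g (y - X w).
Hypothesis gl : forall e, 0 < e -> exists Y, forall y, Y <= y -> g y <= l + e.

(* Choquet-Deny argument: where the harmonic function [g] nearly attains its upper
   limit [l], it also nearly attains it after a shift by a point of the support. *)
Lemma extremal_step (c : R) : in_support P X c -> forall k, 0 < k ->
  exists e Y : R, 0 < e /\
    forall y, Y <= y -> l - e < g y -> l - k < g (y - c).
Proof.
move=> sc k k0.
have L0 : 0 <= L by have := gL 1 0; rewrite subr0 normr1 mulr1; exact: le_trans.
have B0 : 0 <= B by exact: le_trans (gB 0).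
(* If [g (y - c) <= l - k], the Lipschitz bound keeps [g (y - X)] at most [l - k / 2] whenever [X]
   is within [r] of [c]. *)
pose r := k / (2 * (L + 1)).
have r0 : 0 < r by rewrite /r divr_gt0// mulr_gt0// ltr_wpDl.
have Lr : L * r <= k / 2.
  have -> : k / 2 = (L + 1) * r by rewrite /r; field; rewrite gt_eqF//; lra.
  by rewrite ler_wpM2r ?(ltW r0)//; lra.
pose A := [set w | c - r < X w < c + r].
have mA : measurable A by exact: measurable_open_interval_preimage.
pose p := \int[P]_w \1_A w.
have pE : p%:E = P A.
  rewrite /p EFin_Rintegral; last first.
    apply: (@integrable_bounded _ _ _ _ _ 1); first exact: measurable_indic.
    by move=> w; rewrite indicE; case: (_ \in _); rewrite ?normr1 ?normr0.
  by rewrite integral_indic// setIT.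
have p0 : 0 < p by rewrite -lte_fin pE; exact: sc.
(* In the harmonic average the part [X > M] costs at most [e], while the window around [c] gains
   [p * (k / 2) = 4 * e]: the contradiction is [g y <= l + e - 4 * e + e]. *)
pose e := p * k / 8; have e0 : 0 < e by rewrite /e !mulr_gt0// invr_gt0.
have [Y1 hY1] := gl e0.
pose K := B + `|l| + 1; have K0 : 0 < K by rewrite /K ltr_wpDl// addr_ge0.
have [M hM] : exists M, \int[P]_w \1_[set w | M < X w] w <= e / K.
  by apply: tail_probability_small; rewrite divr_gt0.
exists e, (Num.max y0 (Y1 + M)); split => // y.
rewrite ge_max => /andP[yy0 yY] gy; rewrite ltNge; apply/negP => gyc.
pose I := [set w | M < X w].
have mI : measurable I.
  rewrite (_ : I = X @^-1` `]M, +oo[%classic); last first.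
    by apply/seteqP; split=> w /=; rewrite in_itv /= andbT.
  by rewrite -[X in measurable X]setTI; exact: mX.
have iind (J : set T) (a : R) : measurable J -> P.-integrable setT (EFin \o (fun w => a * \1_J w)).
  move=> mJ; apply: (@integrable_bounded _ _ _ _ _ `|a|).
    by apply: measurable_funM => //; exact: measurable_indic.
  by move=> w; rewrite indicE; case: (_ \in _); rewrite ?mulr1 ?mulr0 ?normr0.
have icst (a : R) : P.-integrable setT (EFin \o (fun w => a)).
  by apply: (@integrable_bounded _ _ _ _ _ `|a|).
have bound w : g (y - X w) <= (l + e) + (- (k / 2) * \1_A w + K * \1_I w).
  have k0' := k0.
  have gB' x : - B <= g x <= B by rewrite -ler_norml gB.
  have ll : - `|l| <= l by rewrite lerNl -normrN ler_norm.
  have Kpos : 0 <= K * \1_I w :> R by rewrite mulr_ge0 ?indicE ?(ltW K0).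
  rewrite [\1_A w]indicE; have [wA|wA] := boolP (w \in A); last first.
    rewrite mulr0 add0r; have [XM|XM] := leP (X w) M.
      by apply: (@le_trans _ _ (l + e)); [apply: hY1; lra|lra].
    rewrite indicE mem_set//= mulr1; have /andP[_] := gB' (y - X w).
    by rewrite /K; lra.
  move: wA; rewrite inE /A /= => /andP[w1 w2].
  have h := gL (y - X w) (y - c).
  have : `|y - X w - (y - c)| <= r by rewrite ler_norml; apply/andP; split; lra.
  move=> /(ler_wpM2l L0) h2; move: h; rewrite ler_norml => /andP[_ h].
  by rewrite mulr1; lra.
have := gharm yy0; move: gy => /[swap] ->; apply/negP; rewrite -leNgt.
apply: le_trans (Rintegral_le _ _ bound) _.
- apply: (@integrable_bounded _ _ _ _ _ B) => //.
  by apply: measurableT_comp => //; exact: measurable_funB.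
- have i1 := integrableD measurableT (iind A (- (k / 2)) mA) (iind I K mI).
  exact: (integrableD measurableT (icst (l + e)) i1).
- rewrite RintegralD//; last exact: (integrableD measurableT (iind A (- (k / 2)) mA) (iind I K mI)).
  rewrite Rintegral_probability_cst RintegralD//; [|exact: iind|exact: iind].
  have ind1 (J : set T) : measurable J -> P.-integrable setT (EFin \o (\1_J : T -> R)).
    move=> mJ; apply: (@integrable_bounded _ _ _ _ _ 1); first exact: measurable_indic.
    by move=> w; rewrite indicE; case: (_ \in _); rewrite ?normr1 ?normr0.
  rewrite !RintegralZl; try by [|exact: ind1].
  have : K * \int[P]_w \1_I w <= e by rewrite mulrC -ler_pdivlMr.
  have -> : - (k / 2) * \int[P]_w \1_A w = - (4 * e) by rewrite -/p /e; field.
  by lra.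
Qed.

(** [J] steps, [j] of them equal to [c] and the others to [c0], lead from [y] to
    [y - J c0 - j (c - c0)]. So one nearly extremal point far out produces [J + 1] of them in
    arithmetic progression, with difference [c - c0]. *)
Lemma extremal_steps (c0 c : R) : in_support P X c0 -> in_support P X c ->
  forall (J : nat) k, 0 < k -> exists e Y : R, 0 < e /\
    forall y, Y <= y -> l - e < g y -> forall j, (j <= J)%N ->
      l - k < g (y - J%:R * c0 - j%:R * (c - c0)).
Proof.
move=> s0 sc; elim=> [|J IH] k k0.
  exists k, 0; split => // y _ h j; rewrite leqn0 => /eqP ->.
  by rewrite !mul0r !subr0.
have [e1 [Y1 [e10 h1]]] := extremal_step sc k0.
have [e2 [Y2 [e20 h2]]] := extremal_step s0 k0.
have [|e [Y [e0 h]]] := IH (Num.min e1 e2); first by rewrite lt_min e10.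
(* For [y >= Z] the points reached after [J] steps still lie past both thresholds [Y1] and [Y2]. *)
pose Z := `|Y1| + `|Y2| + J%:R * `|c0| + J%:R * `|c - c0|.
exists e, (Num.max Y Z); split => // y; rewrite ge_max => /andP[yY yZ] gy j jJ.
have far i : (i <= J)%N -> Num.max Y1 Y2 <= y - J%:R * c0 - i%:R * (c - c0).
  move=> iJ; have a1 : J%:R * c0 <= J%:R * `|c0| by rewrite ler_wpM2l ?ler_norm.
  have a2 : i%:R * (c - c0) <= J%:R * `|c - c0|.
    by rewrite (le_trans (ler_norm _))// normrM normr_nat ler_wpM2r// ler_nat.
  have := ler_norm Y1; have := ler_norm Y2; have := normr_ge0 Y1; have := normr_ge0 Y2.
  by move: yZ; rewrite /Z ge_max => *; apply/andP; split; lra.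
have near i : (i <= J)%N -> l - e1 < g (y - J%:R * c0 - i%:R * (c - c0)) /\
    l - e2 < g (y - J%:R * c0 - i%:R * (c - c0)).
  move=> iJ; have := h y yY gy i iJ => hh; split; apply: le_lt_trans hh;
  by rewrite lerD2l lerN2 ge_min lexx ?orbT.
move: jJ; rewrite leq_eqVlt => /predU1P[->|jJ].
  have -> : y - J.+1%:R * c0 - J.+1%:R * (c - c0) =
    y - J%:R * c0 - J%:R * (c - c0) - c by rewrite -!natr1; ring.
  have [n1 _] := near J (leqnn J); apply: h1 n1.
  by apply: le_trans (far J (leqnn J)); rewrite le_max lexx.
have -> : y - J.+1%:R * c0 - j%:R * (c - c0) =
  y - J%:R * c0 - j%:R * (c - c0) - c0 by rewrite -!natr1; ring.
have [_ n2] := near j jJ; apply: h2 n2.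
by apply: le_trans (far j jJ); rewrite le_max lexx orbT.
Qed.

End extremal.

Variables (u : R -> R) (B L y0 : R).
Hypotheses (mu : measurable_fun setT u) (uB : forall y, `|u y| <= B).
Hypothesis uL : forall x y, `|u x - u y| <= L * `|x - y|.
Hypothesis uharm : forall y, y0 <= y -> u y = \int[P]_w u (y - X w).

Let iu y : P.-integrable setT (EFin \o (fun w => u (y - X w))).
Proof.
apply: (@integrable_bounded _ _ _ _ _ B) => //.
by apply: measurableT_comp => //; exact: measurable_funB.
Qed.

(* If g(y) = u(y) - u(y + c - c0) had a positive upper limit [l], then [g] would
   exceed l/2 at [J] consecutive points of a progression of step c - c0, and the
   telescoping sum of these values would exceed the bound on [u]. *)
Lemma support_difference_limsup (c0 c : R) : in_support P X c0 -> in_support P X c ->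
  forall e, 0 < e -> exists Y, forall y, Y <= y -> u y - u (y + (c - c0)) <= e.
Proof.
move=> s0 sc e0 e00; apply: contrapT => /forallNP freq.
pose D := c - c0; pose g y := u y - u (y + D).
pose S : set R := [set l | forall Y, exists2 y, Y <= y & l < g y].
have gB y : `|g y| <= 2 * B.
  rewrite (le_trans (ler_normB _ _))// mulr_natl mulr2n; exact: lerD.
have gL x y : `|g x - g y| <= (2 * L) * `|x - y|.
  have -> : g x - g y = (u x - u y) - (u (x + D) - u (y + D)) by rewrite /g; ring.
  rewrite (le_trans (ler_normB _ _))// -mulrA mulr_natl mulr2n; apply: lerD => //.
  by apply: le_trans (uL _ _) _; rewrite opprD addrACA subrr addr0.
have gharm y : y0 + `|D| <= y -> g y = \int[P]_w g (y - X w).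
  move=> hy; have h1 := normr_ge0 D; have h2 : - D <= `|D| by rewrite -normrN ler_norm.
  rewrite /g uharm; last by lra.
  rewrite (uharm (y := y + D)); last by lra.
  rewrite -RintegralB//; apply: eq_Rintegral => w _; congr (_ - u _); ring.
have mg : measurable_fun setT g.
  by apply: measurable_funB => //; apply: measurableT_comp => //; exact: measurable_funD.
have Se0 : S e0.
  move=> Y; have /existsNP[y /not_implyP[yY /negP]] := freq Y.
  by rewrite -ltNge => h; exists y.
have supS : has_sup S.
  split; first by exists e0.
  exists (2 * B) => l /(_ 0)[y _ /ltW/le_trans]; apply.
  exact: le_trans (ler_norm _) (gB y).
have l0 : e0 <= sup S by exact: sup_upper_bound.
set l := sup S in l0 *.
have gl e : 0 < e -> exists Y, forall y, Y <= y -> g y <= l + e.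
  move=> e1; have : ~ S (l + e).
    by move=> /(sup_upper_bound supS); rewrite -/l gerDl leNgt e1.
  move=> /existsNP[Y hY]; exists Y => y yY; rewrite leNgt; apply/negP => h.
  by apply: hY; exists y.
have gfreq e : 0 < e -> forall Y, exists2 y, Y <= y & l - e < g y.
  move=> e1 Y; have [l' Sl' ll'] := sup_adherent e1 supS.
  by have [y yY /(lt_trans ll')] := Sl' Y; exists y.
have B0 : 0 <= B by exact: le_trans (uB 0).
have lpos : 0 < l by exact: lt_le_trans l0.
(* [J] values above [l / 2] add up to more than [2 * B], the largest possible difference of two
   values of [u]. *)
pose J := (Num.truncn (4 * B / l)).+1.
have hJ : 4 * B < J%:R * l.
  by rewrite -ltr_pdivrMr// /J -truncn_lt_nat// divr_ge0 ?mulr_ge0// ltW.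
have l20 : 0 < l / 2 by rewrite divr_gt0.
have [e [Y [e1 h]]] := extremal_steps mg gB gL gharm gl s0 sc J l20.
have [y yY gy] := gfreq e e1 Y.
pose x j := y - J%:R * c0 - j%:R * D.
have tele : \sum_(0 <= j < J) g (x j.+1) = u (x J) - u (x 0).
  rewrite -(@telescope_sumr _ 0 J (fun j => u (x j)))//.
  apply: eq_bigr => j _; rewrite /g; congr (_ - u _); rewrite /x -natr1; ring.
have low : \sum_(0 <= j < J) (l / 2) <= \sum_(0 <= j < J) g (x j.+1).
  rewrite big_seq [leRHS]big_seq; apply: ler_sum => j; rewrite mem_index_iota => /andP[_ jJ].
  by have := h y yY gy j.+1 jJ; rewrite -/D -/(x j.+1); lra.
move: low; rewrite tele sumr_const_nat subn0 -mulr_natl => low.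
have := uB (x J); have := uB (x 0); rewrite !ler_norml => /andP[b1 b2] /andP[b3 b4].
by move: hJ low; lra.
Qed.

Definition asymptotic_period (a : R) :=
  forall e, 0 < e -> exists Y, forall y, Y <= y -> `|u (y + a) - u y| <= e.

(* The asymptotic periods form a closed subgroup containing all differences of
   support points. *)
Lemma asymptotic_period_all : nonlattice P X -> forall a, asymptotic_period a.
Proof.
move=> hlat.
have H0 : asymptotic_period 0.
  by move=> e e0; exists 0 => y _; rewrite addr0 subrr normr0 ltW.
have HN a : asymptotic_period a -> asymptotic_period (- a).
  move=> Ha e e0; have [Y hY] := Ha e e0; exists (Y + a) => y yY.
  have := hY (y - a); rewrite subrK distrC; apply; lra.
have HD a a' : asymptotic_period a -> asymptotic_period a' -> asymptotic_period (a + a').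
  move=> Ha Ha' e e0; have e2 : 0 < e / 2 by rewrite divr_gt0.
  have [Y hY] := Ha _ e2; have [Y' hY'] := Ha' _ e2.
  exists (Num.max Y (Y' - a)) => y; rewrite ge_max => /andP[y1 y2].
  have h1 := hY y y1; have h2 := hY' (y + a).
  have {h2}h2 : `|u (y + a + a') - u (y + a)| <= e / 2 by apply: h2; lra.
  rewrite addrA -(subrKA (u (y + a))) (le_trans (ler_normD _ _))//; lra.
have Hsupp c0 c : in_support P X c0 -> in_support P X c -> asymptotic_period (c - c0).
  move=> s0 sc e e0.
  have [Y hY] := support_difference_limsup s0 sc e0.
  have [Y' hY'] := support_difference_limsup sc s0 e0.
  exists (Num.max Y (Y' - (c - c0))) => y; rewrite ge_max => /andP[y1 y2].
  rewrite ler_norml; apply/andP; split; first by have := hY y y1; lra.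
  have := hY' (y + (c - c0)); rewrite -addrA -[c0 - c]opprB subrr addr0; apply; lra.
have L0 : 0 <= L by have := uL 1 0; rewrite subr0 normr1 mulr1; exact: le_trans.
(* Dense case: the Lipschitz bound transfers the property from a nearby period [a'] to [a]; this is
   the closedness of the group. *)
have [dense|[h h0 Hh]] := subgroup_dense_or_cyclic H0 HN HD.
  move=> a e e0; pose r := e / (2 * (L + 1)).
  have r0 : 0 < r by rewrite /r divr_gt0// mulr_gt0// ltr_wpDl.
  have Lr : L * r <= e / 2.
    have -> : e / 2 = (L + 1) * r by rewrite /r; field; rewrite gt_eqF//; lra.
    by rewrite ler_wpM2r ?(ltW r0)//; lra.
  have [a' Ha' aa'] := dense a r r0.
  have [|Y hY] := Ha' (e / 2); first by rewrite divr_gt0.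
  exists Y => y /hY h1; rewrite -(subrKA (u (y + a'))) (le_trans (ler_normD _ _))//.
  have h2 : `|u (y + a) - u (y + a')| <= L * r.
    apply: le_trans (uL _ _) _; rewrite ler_wpM2l//.
    by rewrite opprD addrACA subrr add0r ltW.
  by lra.
(* Cyclic case: support points differ from [c0] by multiples of [h], and [X] lies in the support
   almost surely, so its law would be lattice. *)
exfalso; apply: hlat; have [c0 sc0] := exists_in_support P mX; exists c0, h; split => //.
set A := [set w | _].
have mA : measurable A.
  have -> : A = \bigcup_(z in [set: int]) X @^-1` [set c0 + h * z%:~R].
    by apply/seteqP; split => w /= [z]; [exists z|move=> _; exists z].
  apply: countable_bigcupT_measurable => [|z]; first exact: countableP.
  by rewrite -[X in measurable X]setTI; exact: mX.
have : P.-negligible (~` A).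
  apply: negligibleS (negligible_notin_support P mX) => w /= wA supp; apply: wA.
  have [z hz] := Hh _ (Hsupp _ _ sc0 supp); exists z; rewrite -hz; ring.
rewrite negligibleP; last exact: measurableC.
move=> h1; have := etrans (esym h1) (probability_setC P mA).
have := fin_num_measure P A mA; case: (P A) => // r _ [r1].
by congr (_%:E); lra.
Qed.

End asymptotic_translation_invariance.

(** * Blackwell's theorem for the smoothed renewal function *)

Section renewal_theorem.
Context d (T : measurableType d) (R : realType) (P : probability T R).
Variables (X : T -> R) (b s eps : R).
Hypotheses (mX : measurable_fun setT X) (iX : P.-integrable setT (EFin \o X)).
Hypothesis Xb : forall w, - b <= X w.
Let rho := \int[P]_w expR (- s * X w).
Hypotheses (s0 : 0 < s) (rho1 : rho < 1) (eps0 : 0 < eps).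
Hypotheses (mean_gt0 : 0 < \int[P]_w X w) (hlat : nonlattice P X).

Let M := renewal_function P X eps.
Let K := renewal_lipschitz P X s eps.
Let K0 : 0 < K. Proof. exact: renewal_lipschitz_gt0. Qed.

Lemma renewal_function_lipschitz x y : `|M x - M y| <= K * `|x - y|.
Proof.
wlog xy : x y / x <= y => [h|].
  have [/h //|/ltW/h] := leP x y.
  by rewrite distrC [in leRHS]distrC.
rewrite distrC [in leRHS]distrC (@ger0_norm _ (y - x)) ?subr_ge0//.
rewrite ger0_norm ?subr_ge0; last first.
  exact: (renewal_function_nondecreasing mX Xb s0 rho1 eps0 xy).
have := renewal_increment mX Xb s0 rho1 eps0 x (a := y - x).
by rewrite (addrC x) subrK subr_ge0; apply.
Qed.

Let iM y : P.-integrable setT (EFin \o (fun w => M (y - X w))).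
Proof.
apply: (@integrable_shift _ _ _ _ _ _ _ mX Xb s0 M y (1 - rho)^-1).
  exact: (renewal_function_nondecreasing mX Xb s0 rho1 eps0).
exact: (renewal_function_bounds mX Xb s0 rho1 eps0).
Qed.

Let M_far y : eps <= y -> M y = 1 + \int[P]_w M (y - X w).
Proof.
move=> ey; rewrite /M (renewal_equation mX Xb s0 rho1 eps0) ramp_eq1//.
Qed.

Let u (a y : R) := M (y + a) - M y.

Let u_le a y : `|u a y| <= K * `|a|.
Proof.
by apply: le_trans (renewal_function_lipschitz _ _) _; rewrite addrAC subrr add0r.
Qed.

(** For [y >= eps] the ramps in the renewal equations of [M (y + e)] and [M y] both equal 1 and
    cancel, so [u e] is harmonic there. It is also bounded and Lipschitz, hence every real number is
    an asymptotic period. *)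
Let u_shift e a : 0 <= e -> u e (y + a) - u e y @[y --> +oo] --> 0.
Proof.
move=> e0; have mM : measurable_fun setT M.
  apply: nondecreasing_measurable => //.
  apply: (renewal_function_nondecreasing mX Xb s0 rho1 eps0).
have mu : measurable_fun setT (u e).
  by apply: measurable_funB => //; apply: measurableT_comp => //; exact: measurable_funD.
have uL x y : `|u e x - u e y| <= 2 * K * `|x - y|.
  have -> : u e x - u e y = (M (x + e) - M (y + e)) - (M x - M y) by rewrite /u; ring.
  rewrite (le_trans (ler_normB _ _))// -mulrA mulr_natl mulr2n.
  apply: lerD; last exact: renewal_function_lipschitz.
  apply: le_trans (renewal_function_lipschitz _ _) _.
  by rewrite opprD addrACA subrr addr0.
have uh y : eps <= y -> u e y = \int[P]_w u e (y - X w).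
  move=> ey; rewrite /u M_far; last by have e0' := e0; lra.
  rewrite (M_far ey) opprD addrACA subrr add0r -RintegralB//.
  by apply: eq_Rintegral => w _; rewrite addrAC.
have per := asymptotic_period_all mX mu (u_le e) uL uh hlat a.
apply/cvgr0Pnorm_le => t /per[Y hY].
by apply: filterS (nbhs_pinfty_ge (num_real Y)) => y; exact: hY.
Qed.

Let u_muln h (n : nat) : 0 <= h ->
  u (n%:R * h) y - n%:R * u h y @[y --> +oo] --> 0.
Proof.
move=> h0; elim: n => [|n IH].
  apply: cvg_near_cst; apply: nearW => y.
  by rewrite !mul0r /u addr0 subrr subrr.
have -> : (fun y => u (n.+1%:R * h) y - n.+1%:R * u h y) =
    (fun y => (u (n%:R * h) y - n%:R * u h y) + (u h (y + n%:R * h) - u h y)).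
  apply/funext => y; rewrite -natr1 !mulrDl !mul1r /u addrA; ring.
by rewrite -[0](addr0 0); apply: cvgD => //; exact: u_shift.
Qed.

(** Some [j / N] lies within [1 / N] of [a], at a Lipschitz cost of at most [K / N]; and [u (j / N)]
    and [u 1] are asymptotically [j] and [N] times the same quantity [u (1 / N)]. *)
Let u_linear_pos a : 0 <= a -> u a y - a * u 1 y @[y --> +oo] --> 0.
Proof.
move=> a0; apply/cvgr0Pnorm_le => e e0.
have K0' := K0.
pose N := (Num.truncn (4 * K / e)).+1.
have N0 : 0 < N%:R :> R by rewrite ltr0n.
have hN : 4 * K < N%:R * e.
  rewrite -ltr_pdivrMr// /N -truncn_lt_nat//.
  by apply: divr_ge0; [apply: mulr_ge0 => //; exact: ltW K0|exact: ltW].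
have KN : K / N%:R <= e / 4 by rewrite ler_pdivrMr//; lra.
pose j := Num.truncn (a * N%:R).
have /andP[j1 j2] : j%:R <= a * N%:R < j.+1%:R.
  by apply: truncn_itv; rewrite mulr_ge0// ltW.
rewrite -natr1 in j2.
have aj : `|a - j%:R / N%:R| <= N%:R^-1.
  have -> : a - j%:R / N%:R = (a * N%:R - j%:R) / N%:R by field; rewrite gt_eqF.
  rewrite ger0_norm; last by rewrite divr_ge0 ?subr_ge0// ltW.
  by rewrite -[leRHS]mul1r ler_pM2r ?invr_gt0//; lra.
have e4 : 0 < e / 4 by rewrite divr_gt0.
have h0 : 0 <= N%:R^-1 :> R by rewrite invr_ge0 ltW.
have /cvgr0Pnorm_le/(_ _ e4) c1 := u_muln j h0.
have c2 : (j%:R / N%:R) * (u (N%:R * N%:R^-1) y - N%:R * u N%:R^-1 y) @[y --> +oo] --> 0.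
  by rewrite -[0](mulr0 (j%:R / N%:R)); apply: cvgM; [exact: cvg_cst|exact: u_muln].
have /cvgr0Pnorm_le/(_ _ e4) {}c2 := c2.
near=> y.
have h1 : `|u (j%:R * N%:R^-1) y - j%:R * u N%:R^-1 y| <= e / 4 by near: y; exact: c1.
have h2 : `|(j%:R / N%:R) * (u (N%:R * N%:R^-1) y - N%:R * u N%:R^-1 y)| <= e / 4.
  by near: y; exact: c2.
have h3 : `|u a y - u (j%:R / N%:R) y| <= e / 4.
  have -> : u a y - u (j%:R / N%:R) y = M (y + a) - M (y + j%:R / N%:R) by rewrite /u; ring.
  apply: le_trans (renewal_function_lipschitz _ _) _.
  rewrite opprD addrACA subrr add0r (le_trans _ KN)//.
  by rewrite ler_wpM2l// ltW.
have h4 : `|(j%:R / N%:R - a) * u 1 y| <= e / 4.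
  rewrite normrM distrC (le_trans _ KN)// mulrC; apply: ler_pM => //.
  by have := u_le 1 y; rewrite normr1 mulr1.
have NN : N%:R * N%:R^-1 = 1 :> R by rewrite divff// gt_eqF.
rewrite NN in h2.
have -> : u a y - a * u 1 y = (u a y - u (j%:R / N%:R) y) +
  (u (j%:R * N%:R^-1) y - j%:R * u N%:R^-1 y) -
  ((j%:R / N%:R) * (u 1 y - N%:R * u N%:R^-1 y)) + (j%:R / N%:R - a) * u 1 y.
  have -> : (j%:R / N%:R) * (u 1 y - N%:R * u N%:R^-1 y) =
    (j%:R / N%:R) * u 1 y - j%:R * u N%:R^-1 y.
    by rewrite mulrBr; congr (_ - _); rewrite mulrA divfK// gt_eqF.
  by ring.
rewrite (le_trans (ler_normD _ _))//.
move: h1 h2 h3 h4 => h1 h2 h3 h4.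
apply: (@le_trans _ _ (e / 4 + e / 4 + e / 4 + e / 4)); last lra.
apply: lerD => //; rewrite (le_trans (ler_normB _ _))//; apply: lerD => //.
by rewrite (le_trans (ler_normD _ _))//; apply: lerD.
Unshelve. all: by end_near. Qed.

Let u_linear a : u a y - a * u 1 y @[y --> +oo] --> 0.
Proof.
have [a0|a0] := leP 0 a; first exact: u_linear_pos.
have na : 0 <= - a by rewrite oppr_ge0 ltW.
have -> : (fun y => u a y - a * u 1 y) = (fun y =>
   - (u (- a) (y + a) - u (- a) y) - (u (- a) y - (- a) * u 1 y)).
  by apply/funext => y; rewrite /u addrK; ring.
rewrite -[0](subr0 0) -[X in X - _]oppr0; apply: cvgB; last exact: u_linear_pos.
by apply: cvgN; exact: u_shift.
Qed.

(* Asymptotic additivity gives M(y) - M(y - X) = X (M(y + 1) - M(y)) + o(1), and the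
   renewal equation says that the left-hand side has mean 1. *)
Lemma renewal_theorem a :
  M (y + a) - M y @[y --> +oo] --> a / \int[P]_w X w.
Proof.
set m := \int[P]_w X w.
have m0 : m != 0 by rewrite gt_eqF.
pose F y w := M y - M (y - X w) - X w * u 1 y.
have mMX y : measurable_fun setT (fun w => M (y - X w)).
  by have /measurable_int/measurable_EFinP := iM y.
have cF : \int[P]_w F y w @[y --> +oo] --> \int[P]_w (0 : R).
  apply: (@Rintegral_dominated_cvg_pinfty _ _ _ _ _ _ (fun w => 2 * K * `|X w|)).
  - move=> y; apply: measurable_funB; first exact: measurable_funB.
    exact: measurable_funM.
  - exact: (integrableZl measurableT (2 * K) (integrable_norm iX)).
  - move=> y w; rewrite (le_trans (ler_normB _ _))// -mulrA mulr_natl mulr2n.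
    apply: lerD.
      by apply: le_trans (renewal_function_lipschitz _ _) _; rewrite subKr.
    rewrite normrM mulrC ler_wpM2r//.
    by have := u_le 1 y; rewrite normr1 mulr1.
  - move=> w; have -> : F ^~ w = (fun y => - (u (- X w) y - (- X w) * u 1 y)).
      by apply/funext => y; rewrite /F /u; ring.
    by rewrite -oppr0; apply: cvgN; exact: u_linear.
have cu : 1 - m * u 1 y @[y --> +oo] --> 0.
  rewrite Rintegral_probability_cst in cF; apply: cvg_trans cF.
  apply: near_eq_cvg; near=> y.
  have ey : eps <= y by near: y; exact: nbhs_pinfty_ge (num_real _).
  have iMM : P.-integrable setT (EFin \o (fun w => M y - M (y - X w))).
    have ic : P.-integrable setT (EFin \o (fun w => M y)).
      by apply: (@integrable_bounded _ _ _ _ _ `|M y|).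
    exact: (integrableB measurableT ic (iM y)).
  rewrite /F RintegralB//; last exact: (integrableZr measurableT (u 1 y) iX).
  rewrite RintegralZr// RintegralB//; last first.
    by apply: (@integrable_bounded _ _ _ _ _ `|M y|).
  rewrite Rintegral_probability_cst; congr (_ - _).
  by rewrite {1}(M_far ey) addrK.
have {}cu : u 1 y @[y --> +oo] --> m^-1.
  have -> : u 1 = (fun y => m^-1 * (1 - (1 - m * u 1 y))).
    by apply/funext => y; field.
  rewrite -[m^-1 in X in _ --> X]mulr1 -[1 in X in _ --> X]subr0.
  apply: cvgM; first exact: cvg_cst.
  by apply: cvgB => //; exact: cvg_cst.
have -> : (fun y => M (y + a) - M y) = (fun y => (u a y - a * u 1 y) + a * u 1 y).
  by apply/funext => y; rewrite subrK.
rewrite -[X in _ --> X]add0r; apply: cvgD; first exact: u_linear.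
by apply: cvgM => //; exact: cvg_cst.
Unshelve. all: by end_near. Qed.

End renewal_theorem.

(** * Measurability and the Markov property *)

Section weighted_integral.
Local Open Scope ereal_scope.
Context d (T : measurableType d) d' (U : measurableType d') (R : realType).
Variables (P : {measure set T -> \bar R}) (q : T -> U).
Hypothesis mq : measurable_fun setT q.
Import HBNNSimple.

Let integral_nnsfun_comp (f : {nnsfun U >-> R}) (a : T -> \bar R) :
  measurable_fun setT a -> (forall w, 0 <= a w) ->
  \int[P]_w ((f (q w))%:E * a w) =
  \sum_(r \in range f) r%:E * \int[P]_(w in q @^-1` (f @^-1` [set r])) a w.
Proof.
move=> ma a0.
have mS r : measurable (q @^-1` (f @^-1` [set r])).
  by rewrite -[X in measurable X]setTI; apply: mq => //; exact: measurable_sfunP.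
have mI r : measurable_fun setT
    (fun w => (\1_(f @^-1` [set r]) (q w))%:E * a w).
  apply: emeasurable_funM => //; apply/measurable_EFinP; apply: measurableT_comp => //.
have I0 r w : 0 <= (\1_(f @^-1` [set r]) (q w))%:E * a w.
  by rewrite mule_ge0// lee_fin.
under eq_integral.
  move=> w _; rewrite fimfunE -fsumEFin// ge0_mule_fsuml; last first.
    by move=> r; rewrite EFinM nnfun_muleindic_ge0.
  over.
rewrite ge0_integral_fsum//; last 2 first.
- move=> r; apply: emeasurable_funM => //; apply/measurable_EFinP.
  by apply: measurable_funM => //; apply: measurableT_comp.
- by move=> r w _; rewrite mule_ge0// EFinM nnfun_muleindic_ge0.
apply: eq_fsbigr => r; rewrite inE => -[x _ fxr].
have r0 : (0 <= r)%R by rewrite -fxr.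
under eq_integral do rewrite EFinM -muleA.
rewrite ge0_integralZl_EFin//; congr (_ * _).
rewrite [RHS]integral_mkcond; apply: eq_integral => w _.
rewrite /patch indicE; have -> : (q w \in f @^-1` [set r]) =
  (w \in q @^-1` (f @^-1` [set r])) by apply/idP/idP; rewrite !inE.
by case: ifPn => _; rewrite ?mul1e ?mul0e.
Qed.

(** Equal integrals over the events of [q] mean that [a] and [c] have the same conditional
    expectation given [q]. This survives multiplication by a function of [q], first for simple
    functions, then by monotone convergence. Conditioning on the environment always goes through
    this exchange, with no conditional expectation as an object. *)
Lemma ge0_eq_integral_comp_mul (a c : T -> R) :
  measurable_fun setT a -> measurable_fun setT c ->
  (forall w, (0 <= a w)%R) -> (forall w, (0 <= c w)%R) ->
  (forall B, measurable B ->
    \int[P]_(w in q @^-1` B) (a w)%:E = \int[P]_(w in q @^-1` B) (c w)%:E) ->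
  forall g : U -> \bar R, measurable_fun setT g -> (forall x, 0 <= g x) ->
  \int[P]_w (g (q w) * (a w)%:E) = \int[P]_w (g (q w) * (c w)%:E).
Proof.
move=> ma mc a0 c0 ac g mg g0.
pose h n := nnsfun_approx measurableT mg n.
have h0 n x : (0 <= h n x)%R by [].
have mq' n : measurable_fun setT (fun w => (h n (q w))%:E).
  by apply/measurable_EFinP; apply: measurableT_comp.
have cvh (e : T -> R) : measurable_fun setT e -> (forall w, (0 <= e w)%R) ->
    \int[P]_w ((h n (q w))%:E * (e w)%:E) @[n --> \oo] -->
    \int[P]_w (g (q w) * (e w)%:E).
  move=> me e0.
  have -> : \int[P]_w (g (q w) * (e w)%:E) =
      \int[P]_w limn (fun n => (h n (q w))%:E * (e w)%:E).
    apply: eq_integral => w _; apply/esym/cvg_lim => //; apply: cvgeZr => //.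
    exact: (cvg_nnsfun_approx measurableT mg (fun x _ => g0 x)).
  apply: cvg_monotone_convergence => //.
  - by move=> n; apply: emeasurable_funM => //; exact/measurable_EFinP.
  - by move=> n w _; rewrite mule_ge0// lee_fin.
  - move=> w _ m n mn; apply: lee_wpmul2r; rewrite lee_fin//.
    by have /lefP := nd_nnsfun_approx measurableT mg mn; exact.
have eqh n : \int[P]_w ((h n (q w))%:E * (a w)%:E) =
    \int[P]_w ((h n (q w))%:E * (c w)%:E).
  rewrite !integral_nnsfun_comp//; try exact/measurable_EFinP.
  by apply: eq_fsbigr => r _; congr (_ * _); apply: ac; exact: measurable_sfunP.
have := cvh c mc c0; under eq_fun do rewrite -eqh; move=> /cvg_lim <- //.
by apply/esym/cvg_lim => //; exact: cvh.
Qed.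

End weighted_integral.

(** * Measurability for the total variation sigma-algebra *)

Section environment_measurability.
Variable R : realType.

Lemma tv_dist_ge (f g : pprobability nat R) (A : set nat) :
  `|fine (f A) - fine (g A)| <= tv_dist f g.
Proof.
apply: ub_le_sup; last by exists A.
exists 1 => _ [B _ <-].
have le1 (p : pprobability nat R) : 0 <= fine (p B) <= 1.
  have p1 : (p B <= 1)%E by exact: probability_le1.
  have p0 : (0 <= p B)%E by [].
  have pf : p B \is a fin_num by exact: fin_num_measure.
  by rewrite -!lee_fin fineK// p0 p1.
have /andP[? ?] := le1 f; have /andP[? ?] := le1 g.
by rewrite ler_norml; apply/andP; split; lra.
Qed.

(** The hypothesis says that superlevel sets are open for the total variation metric, so they belong
    to the family generating the sigma-algebra. *)
Let measurable_of_open (g : environment R -> R) :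
  (forall r q, r < g q -> exists2 e, 0 < e & forall q' : environment R,
    tv_dist q.1 q'.1 < e -> tv_dist q.2 q'.2 < e -> r < g q') ->
  measurable_fun setT g.
Proof.
move=> op; apply: (measurability (@RGenOInfty.G R)).
  exact: RGenOInfty.measurableE.
move=> /= _ [_ [r ->] <-]; rewrite setTI; apply: sub_sigma_algebra => q /=.
rewrite in_itv/= andbT => /op[e e0 h]; exists e => // q' h1 h2.
by rewrite /= in_itv/= andbT; exact: h.
Qed.

Lemma measurable_offspring_law (A : set nat) :
  measurable_fun setT (fun q : environment R => fine (offspring_law q A)).
Proof.
apply: measurable_of_open => r q rq; exists (fine (offspring_law q A) - r).
  by rewrite subr_gt0.
move=> q' h _; have := le_lt_trans (tv_dist_ge _ _ A) h.
by rewrite ltr_norml => /andP[_]; rewrite /offspring_law; lra.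
Qed.

Lemma measurable_immigration_law (A : set nat) :
  measurable_fun setT (fun q : environment R => fine (immigration_law q A)).
Proof.
apply: measurable_of_open => r q rq; exists (fine (immigration_law q A) - r).
  by rewrite subr_gt0.
move=> q' _ h; have := le_lt_trans (tv_dist_ge _ _ A) h.
by rewrite ltr_norml => /andP[_]; rewrite /immigration_law; lra.
Qed.

Lemma offspring_law_fin (q : environment R) A : offspring_law q A \is a fin_num.
Proof. exact: fin_num_measure. Qed.

Lemma immigration_law_fin (q : environment R) A : immigration_law q A \is a fin_num.
Proof. exact: fin_num_measure. Qed.

Lemma fine_offspring_law_bounds (q : environment R) A :
  0 <= fine (offspring_law q A) <= 1.
Proof.
by rewrite -!lee_fin fineK ?offspring_law_fin// measure_ge0 probability_le1.
Qed.

Lemma fine_immigration_law_bounds (q : environment R) A :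
  0 <= fine (immigration_law q A) <= 1.
Proof.
by rewrite -!lee_fin fineK ?immigration_law_fin// measure_ge0 probability_le1.
Qed.

Lemma measurable_offspring_mean : measurable_fun setT (@offspring_mean R).
Proof.
apply: ge0_emeasurable_sum => [j q _ _|j _]; first by rewrite mule_ge0.
apply: emeasurable_funM => //.
rewrite (_ : (fun q => _) = EFin \o (fun q : environment R => fine (offspring_law q [set j]))).
  by apply/measurable_EFinP; exact: measurable_offspring_law.
by apply/funext => q /=; rewrite fineK ?offspring_law_fin.
Qed.

(* The probability, in the environment [q], that the offspring of [z] parents and
   the immigrants add up to [x]; the recursion splits off one parent. *)
Fixpoint quenched_step (q : environment R) (z x : nat) : R :=
  if z is z'.+1 then
    \sum_(c < x.+1) fine (offspring_law q [set (c : nat)]) * quenched_step q z' (x - c)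
  else fine (immigration_law q [set x]).

Lemma measurable_quenched_step z x :
  measurable_fun setT (fun q => quenched_step q z x).
Proof.
elim: z x => [|z IH] x /=; first exact: measurable_immigration_law.
apply: measurable_sum => c; apply: measurable_funM; last exact: IH.
exact: measurable_offspring_law.
Qed.

Lemma quenched_step_ge0 q z x : 0 <= quenched_step q z x.
Proof.
elim: z x => [|z IH] x /=; first by have /andP[] := fine_immigration_law_bounds q [set x].
by apply: sumr_ge0 => c _; rewrite mulr_ge0//; have /andP[] := fine_offspring_law_bounds q [set (c:nat)].
Qed.

Lemma sum_offspring_law_le1 (q : environment R) n :
  \sum_(c < n) fine (offspring_law q [set (c : nat)]) <= 1.
Proof.
rewrite -lee_fin -sumEFin.
under eq_bigr do rewrite fineK ?offspring_law_fin//.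
pose F (c : 'I_n) : set nat := [set (c : nat)].
have tF : trivIset setT F by move=> i j _ _ [k [/= -> /val_inj ->]].
have := @measure_bigsetU_ord _ _ _ (offspring_law q) n xpredT F (fun=> I) tF.
by move=> <-; exact: probability_le1.
Qed.

Lemma quenched_step_le1 q z x : quenched_step q z x <= 1.
Proof.
elim: z x => [|z IH] x /=; first by have /andP[] := fine_immigration_law_bounds q [set x].
apply: le_trans (sum_offspring_law_le1 q x.+1); apply: ler_sum => c _.
by rewrite ler_piMr//; have /andP[] := fine_offspring_law_bounds q [set (c:nat)].
Qed.

End environment_measurability.

(** * Expectations of products over independent environments *)

Section iid_products.
Context d (T : measurableType d) d' (U : measurableType d') (R : realType).
Variables (P : probability T R) (Q : nat -> {mfun T >-> U}).
Hypothesis hQ : iid P Q.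

Lemma iid_ge0_integral (g : U -> \bar R) n : measurable_fun setT g ->
  (forall x, 0 <= g x)%E -> (\int[P]_w g (Q n w) = \int[P]_w g (Q 0%N w))%E.
Proof.
move=> mg g0; have [law _] := hQ.
have E m : (\int[P]_w g (Q m w) = \int[pushforward P (Q m)]_x g x)%E.
  by rewrite (ge0_integral_pushforward (measurable_funPT (Q m)))//.
by rewrite !E; apply: eq_measure_integral => A mA _; exact: law.
Qed.

(** The events on [s1] are what makes the induction on [s2] work: to split off the factor depending
    on one [Q j], the other factors need only be tested against events of [Q j], and such an event
    joins [s1]. *)
Lemma iid_integral_prod (I : eqType) (idx : I -> nat) (G : I -> U -> R)
    (s1 : seq nat) (B : nat -> set U) (s2 : seq I) :
  (forall i, measurable_fun setT (G i)) -> (forall i x, 0 <= G i x <= 1) ->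
  (forall j, measurable (B j)) -> uniq (s1 ++ map idx s2) ->
  (\int[P]_(w in \bigcap_(j in [set` s1]) Q j @^-1` B j)
     (\prod_(i <- s2) G i (Q (idx i) w))%:E =
   ((\prod_(j <- s1) fine (P (Q j @^-1` B j))) *
    \prod_(i <- s2) \int[P]_w G i (Q 0%N w))%:E)%E.
Proof.
move=> mG G01 mB; have [law ind] := hQ.
have mQB n (C : set U) : measurable C -> measurable (Q n @^-1` C).
  by move=> mC; rewrite -[X in measurable X]setTI; exact: measurable_funPT.
have mprod s : measurable_fun setT (fun w => \prod_(i <- s) G i (Q (idx i) w)).
  by apply: measurable_prod => i _; apply: measurableT_comp.
have prod0 s w : 0 <= \prod_(i <- s) G i (Q (idx i) w).
  by apply: prodr_ge0 => i _; have /andP[] := G01 i (Q (idx i) w).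
elim: s2 s1 B mB => [|i s2 IH] s1 B mB us.
  under eq_integral do rewrite big_nil.
  rewrite integral_cst; last first.
    by apply: bigcap_measurableType => j _; exact: mQB.
  rewrite cats0 in us; rewrite mul1e big_nil mulr1; apply: etrans (ind _ _ us mB) _.
  elim: s1 {us} => [|j s1 IH]; first by rewrite !big_nil.
  by rewrite !big_cons IH EFinM fineK// fin_num_measure//; exact: mQB.
have us2 : uniq ((idx i :: s1) ++ map idx s2) by rewrite -[_ ++ _]/([:: idx i] ++ s1 ++ map idx s2) uniq_catCA.
have ni : idx i \notin s1 by move: us2; rewrite cat_cons /= mem_cat negb_or => /andP[/andP[]].
pose A := \bigcap_(j in [set` s1]) Q j @^-1` B j.
have mA : measurable A.
  by apply: bigcap_measurableType => j _; exact: mQB.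
pose C := (\prod_(j <- s1) fine (P (Q j @^-1` B j))) * \prod_(i <- s2) \int[P]_w G i (Q 0%N w).
have C0 : 0 <= C.
  apply: mulr_ge0; first by apply: prodr_ge0 => j _; rewrite fine_ge0.
  apply: prodr_ge0 => j _; apply: Rintegral_ge0 => w _.
  by have /andP[] := G01 j (Q 0%N w).
transitivity (\int[P]_w ((G i (Q (idx i) w))%:E *
    (\1_A w * \prod_(j <- s2) G j (Q (idx j) w))%:E))%E.
  rewrite integral_mkcond; apply: eq_integral => w _; rewrite /patch indicE big_cons.
  by case: ifPn => _; rewrite ?mul1r// mul0r mule0.
transitivity (\int[P]_w ((G i (Q (idx i) w))%:E * C%:E))%E; last first.
  rewrite ge0_integralZr//; last 2 first.
  - by apply/measurable_EFinP; apply: measurableT_comp.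
  - by move=> w _; rewrite lee_fin; have /andP[] := G01 i (Q (idx i) w).
  rewrite (@iid_ge0_integral (EFin \o G i)); last 2 first.
  - exact/measurable_EFinP.
  - by move=> x; rewrite lee_fin; have /andP[] := G01 i x.
  rewrite big_cons -EFin_Rintegral; last first.
    apply: (@integrable_bounded _ _ _ _ _ 1); first exact: measurableT_comp.
    by move=> w; have /andP[g0 g1] := G01 i (Q 0%N w); rewrite ger0_norm.
  by rewrite -EFinM [in RHS]mulrCA.
apply: (@ge0_eq_integral_comp_mul _ _ _ _ _ P (Q (idx i)) _ _ (fun=> C) _ _ _ _ _ (EFin \o G i)) => //.
- by apply: measurable_funM => //; exact: measurable_indic.
- by move=> w; rewrite mulr_ge0// indicE.
- move=> D mD; rewrite integral_cst; last exact: mQB.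
  have := IH (idx i :: s1) (fun j => if j == idx i then D else B j) _ us2.
  have -> : \bigcap_(j in [set` idx i :: s1]) Q j @^-1` (if j == idx i then D else B j) =
      Q (idx i) @^-1` D `&` A.
    apply/seteqP; split => w /=.
      move=> h; split; first by have := h (idx i); rewrite /= inE eqxx; apply.
      move=> j /= js; have := h j; rewrite /= inE js orbT => /(_ isT).
      by case: eqP => // ji; move: ni; rewrite -ji js.
    move=> [h1 h2] j /=; rewrite inE; case: eqP => [->//|_ /=]; exact: h2.
  rewrite big_cons eqxx (@eq_big_seq _ _ _ _ s1 _ (fun j => fine (P (Q j @^-1` B j)))); last first.
    by move=> j js /=; case: eqP => // ji; move: ni; rewrite -ji js.
  move=> IH'; transitivity (\int[P]_(w in Q (idx i) @^-1` D `&` A)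
       (\prod_(j <- s2) G j (Q (idx j) w))%:E)%E.
    rewrite integral_mkcondr; apply: eq_integral => w _; rewrite /patch indicE.
    by case: ifPn => _; rewrite ?mul1r// mul0r.
  rewrite IH'; last by move=> j; case: eqP.
  by rewrite -mulrA -/C EFinM fineK ?fin_num_measure//; [rewrite muleC|exact: mQB].
- exact/measurable_EFinP.
- by move=> x; rewrite lee_fin; have /andP[] := G01 i x.
Qed.

End iid_products.

(** * The annealed Markov property *)

Section markov_property.
Context d (T : measurableType d) (R : realType) (P : probability T R).
Variable Q : nat -> {mfun T >-> environment R}.
Variables (N : nat -> nat -> {mfun T >-> nat}) (Y : nat -> {mfun T >-> nat}).
Hypotheses (hQ : iid P Q) (hNY : quenched_independent P Q N Y).

Definition step_event (n z x : nat) : set T :=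
  [set w | (\sum_(i < z) N n i w + Y n w)%N = x].

Lemma measurable_nat_fiber (V : {mfun T >-> nat}) (B : set nat) :
  measurable (V @^-1` B).
Proof. by rewrite -[X in measurable X]setTI; exact: measurable_funPT. Qed.

Lemma step_event0 n x : step_event n 0 x = Y n @^-1` [set x].
Proof. by apply/seteqP; split => w /=; rewrite /step_event /= big_ord0. Qed.

Lemma step_eventS n z x : step_event n z.+1 x =
  \bigcup_(c < x.+1) (N n z @^-1` [set c] `&` step_event n z (x - c)).
Proof.
apply/seteqP; split => w /=; rewrite /step_event /= big_ord_recr /=.
  move=> <-; exists (N n z w); first by rewrite /= ltnS -addnA addnCA leq_addr.
  by split => //=; rewrite -addnA addnCA addKn.
by move=> [c /=]; rewrite ltnS => cx [-> h]; rewrite -addnA addnCA h subnKC.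
Qed.

Lemma measurable_step_event n z x : measurable (step_event n z x).
Proof.
elim: z x => [|z IH] x; first by rewrite step_event0; exact: measurable_nat_fiber.
rewrite step_eventS; apply: bigcup_measurable => c _.
by apply: measurableI => //; exact: measurable_nat_fiber.
Qed.

Lemma measurable_environment_events A : environment_events Q A -> measurable A.
Proof.
apply: smallest_sub; first exact: sigma_algebra_measurable.
move=> _ [n [B [mB ->]]].
by rewrite -[X in measurable X]setTI; exact: measurable_funPT.
Qed.

Let rv := reproduction_var N Y.
Let law := reproduction_law Q.

Let measurable_law j B : measurable_fun setT (fun w => fine (law j w B)).
Proof.
rewrite /law /reproduction_law; case: j => n [i|] /=.
  exact: (measurableT_comp (measurable_offspring_law B)).
exact: (measurableT_comp (measurable_immigration_law B)).
Qed.

Let law_fin j w B : law j w B \is a fin_num.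
Proof. exact: fin_num_measure. Qed.

Let law_ge0 j w B : 0 <= fine (law j w B).
Proof. by rewrite fine_ge0. Qed.

(* Besides generation steps, a cylinder constrains single reproduction variables:
   the induction on the number of parents moves one parent at a time from a step
   to these variables. *)
Let cylinder A (l : seq (nat * nat * nat)) (s : seq (nat * option nat)) B : set T :=
  A `&` \bigcap_(t in [set` l]) step_event t.1.1 t.1.2 t.2 `&`
  \bigcap_(j in [set` s]) rv j @^-1` B j.

Let measurable_cylinder A l s B : measurable A -> measurable (cylinder A l s B).
Proof.
move=> mA; apply: measurableI; [apply: measurableI => //|].
  by apply: fin_bigcap_measurable => // t _; exact: measurable_step_event.
by apply: fin_bigcap_measurable => // j _; exact: measurable_nat_fiber.
Qed.

(** A version of the conditional probability of [cylinder] given the environment. *)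
Let density (l : seq (nat * nat * nat)) (s : seq (nat * option nat)) B w : R :=
  (\prod_(t <- l) quenched_step (Q t.1.1 w) t.1.2 t.2) *
  \prod_(j <- s) fine (law j w (B j)).

Let measurable_density l s B : measurable_fun setT (density l s B).
Proof.
apply: measurable_funM; apply: measurable_prod => j _; last exact: measurable_law.
exact: (measurableT_comp (@measurable_quenched_step R _ _)).
Qed.

Let density_ge0 l s B w : 0 <= density l s B w.
Proof.
apply: mulr_ge0; apply: prodr_ge0 => t _; last exact: law_ge0.
exact: quenched_step_ge0.
Qed.

Let upd (B : nat * option nat -> set nat) j C j' := if j' == j then C else B j'.

Let density_upd l s B j C w : j \notin s ->
  density l (j :: s) (upd B j C) w = fine (law j w C) * density l s B w.
Proof.
move=> js; rewrite /density big_cons {1}/upd eqxx mulrCA; congr (_ * (_ * _)).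
apply: eq_big_seq => i is_; rewrite /upd; case: eqP => // ij.
by move: js; rewrite -ij is_.
Qed.

Let cylinder_upd A l s B j C : j \notin s ->
  cylinder A l (j :: s) (upd B j C) = cylinder A l s B `&` rv j @^-1` C.
Proof.
move=> js; apply/seteqP; split => w.
  move=> [hA h]; split; last by have := h j; rewrite /= /upd inE eqxx /=; exact.
  split=> // i /= is_; have := h i; rewrite /= inE is_ orbT /upd => /(_ isT).
  by case: eqP => // ij; move: js; rewrite -ij is_.
move=> [[hA h] hj]; split=> // i /=; rewrite inE /upd.
by case: eqP => [-> //|_ /= is_]; exact: h.
Qed.

(** Outer induction on the list of steps, inner induction on the number of parents: without parents
    a step only constrains the immigrants, otherwise it splits according to the offspring [c] of its
    last parent. The last hypothesis keeps the variables inside the steps apart from those of [s],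
    so that each parent moved to [s] is a new variable. *)
Lemma quenched_cylinder l s B A :
  uniq [seq t.1.1 | t <- l] -> uniq s -> environment_events Q A ->
  (forall t, t \in l -> (t.1.1, None) \notin s /\
     forall i, (i < t.1.2)%N -> (t.1.1, Some i) \notin s) ->
  P (cylinder A l s B) = (\int[P]_(w in A) (density l s B w)%:E)%E.
Proof.
move=> + + eA; have mA := measurable_environment_events eA.
elim: l s B => [|[[n z] x] l IH] s B ul us hs.
  have -> : cylinder A [::] s B = A `&` \bigcap_(j in [set` s]) rv j @^-1` B j.
    by apply/seteqP; split => w; [move=> [[]]|move=> [wA h]; split].
  rewrite hNY//; apply: eq_integral => w _; rewrite /density big_nil mul1r.
  elim: s {us hs} => [|j s IH]; first by rewrite !big_nil.
  by rewrite !big_cons IH EFinM fineK.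
have {}IH s' B' : uniq s' -> (forall t, t \in l -> (t.1.1, None) \notin s' /\
     forall i, (i < t.1.2)%N -> (t.1.1, Some i) \notin s') ->
    P (cylinder A l s' B') = (\int[P]_(w in A) (density l s' B' w)%:E)%E.
  by move=> ? ?; apply: IH => //; move: ul => /= /andP[].
have nl t : t \in l -> t.1.1 != n.
  by move=> tl; apply/eqP => tn; move: ul => /= /andP[/mapP[]]; exists t.
elim: z x s B us hs {ul} => [|z IHz] x s B us hs.
  have [ns _] := hs (n, 0%N, x) (mem_head _ _).
  have -> : cylinder A ((n, 0%N, x) :: l) s B =
      cylinder A l ((n, None) :: s) (upd B (n, None) [set x]).
    rewrite cylinder_upd//; apply/seteqP; split => w.
      move=> [[wA h] h2]; split; last first.
        by have := h (n, 0%N, x) (mem_head _ _); rewrite step_event0.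
      by split => //; split => // t tl; apply: h; rewrite /= inE tl orbT.
    move=> [[[wA h] h2] h3]; split => //; split => // t /=.
    by rewrite inE => /predU1P[->|/h//]; rewrite step_event0.
  rewrite IH; last 2 first.
  - by rewrite /= ns us.
  - move=> t tl; have [|h1 h2] := hs t; first by rewrite inE tl orbT.
    rewrite !inE !negb_or h1 andbT; split; last by move=> i it; rewrite inE negb_or h2// andbT; apply/eqP.
    by rewrite /= andbT; exact: nl.
  apply: eq_integral => w _; rewrite density_upd//; congr (_%:E).
  by rewrite /density big_cons -mulrA.
have [ns nsi] := hs (n, z.+1, x) (mem_head _ _).
have {nsi}nsz : (n, Some z) \notin s /\ forall i, (i < z)%N -> (n, Some i) \notin s.
  by split; [exact: nsi|move=> i iz; apply: nsi; rewrite /= ltnS ltnW].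
have [nz nsi] := nsz.
pose F (c : 'I_x.+1) := cylinder A ((n, z, (x - c)%N) :: l) ((n, Some z) :: s)
   (upd B (n, Some z) [set (c : nat)]).
have FE (c : 'I_x.+1) : F c =
    cylinder A ((n, z, (x - c)%N) :: l) s B `&` (N n z) @^-1` [set (c : nat)].
  by rewrite /F cylinder_upd.
have -> : cylinder A ((n, z.+1, x) :: l) s B = \big[setU/set0]_(c < x.+1) F c.
  rewrite -(bigcup_mkord_ord F); apply/seteqP; split => w.
    move=> [[wA h] h2]; have := h (n, z.+1, x) (mem_head _ _).
    rewrite /= step_eventS => -[c /= cx [hc hs']]; exists c => //.
    rewrite FE; split; last by rewrite /= inordK.
    split => //; split => // t /=; rewrite inE inordK// => /predU1P[->//|tl].
    by apply: h; rewrite /= inE tl orbT.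
  move=> [c cx]; rewrite FE inordK// => -[[[wA h] h2] h3]; split => //; split => // t /=.
  rewrite inE => /predU1P[->/=|tl]; last by apply: h; rewrite /= inE tl orbT.
  rewrite step_eventS; exists c => //; split => //.
  by have := h (n, z, (x - c)%N) (mem_head _ _).
have mF c : measurable (F c) by exact: measurable_cylinder.
have tF : trivIset setT F.
  move=> c c' _ _ [w []]; rewrite !FE => -[_ /= h1] [_ /= h2].
  by apply/val_inj; rewrite /= -h1.
apply: etrans (@measure_bigsetU_ord _ _ _ P x.+1 xpredT F mF tF) _.
rewrite (eq_bigr (fun c : 'I_x.+1 => \int[P]_(w in A)
   (density ((n, z, (x - c)%N) :: l) ((n, Some z) :: s)
      (upd B (n, Some z) [set (c : nat)]) w)%:E)%E); last first.
  move=> c _; apply: IHz; first by rewrite /= nz us.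
  move=> t; rewrite inE => /predU1P[->|tl] /=.
    rewrite inE negb_or ns andbT; split; first by apply/eqP.
    move=> i iz; rewrite inE negb_or nsi// andbT; apply/eqP => -[] ii.
    by move: iz; rewrite ii ltnn.
  have [|h1 h2] := hs t; first by rewrite inE tl orbT.
  rewrite inE negb_or h1 andbT; split; first by apply/eqP.
  move=> i it; rewrite inE negb_or h2// andbT; apply/eqP => -[tn].
  by move: (nl t tl); rewrite tn eqxx.
rewrite -ge0_integral_sum//; last 2 first.
- by move=> c; apply/measurable_EFinP; apply: measurable_funTS; exact: measurable_density.
- by move=> c w _; rewrite lee_fin density_ge0.
apply: eq_integral => w _; rewrite sumEFin; congr (_%:E).
under eq_bigr do rewrite density_upd//.
rewrite /density [in RHS]big_cons /= [RHS]mulrC mulr_suml mulr_sumr.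
by apply: eq_bigr => c _; rewrite big_cons /=; ring.
Qed.

Definition step_proba (z x : nat) : R := \int[P]_w quenched_step (Q 0%N w) z x.

Lemma step_proba_ge0 z x : 0 <= step_proba z x.
Proof. by apply: Rintegral_ge0 => w _; exact: quenched_step_ge0. Qed.

(** Different generations see different, hence independent, environments, so the quenched product
    factorises when it is integrated over the environment. *)
Lemma steps_independent (l : seq (nat * nat * nat)) : uniq [seq t.1.1 | t <- l] ->
  P (\bigcap_(t in [set` l]) step_event t.1.1 t.1.2 t.2) =
  (\prod_(t <- l) step_proba t.1.2 t.2)%:E.
Proof.
move=> ul.
have -> : \bigcap_(t in [set` l]) step_event t.1.1 t.1.2 t.2 =
    cylinder setT l [::] (fun=> setT).
  by apply/seteqP; split => w; [move=> h; split|move=> [[]]].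
rewrite quenched_cylinder//; last first.
  have -> : [set: T] = Q 0%N @^-1` setT by [].
  by apply: sub_sigma_algebra; exists 0%N, setT.
rewrite (_ : setT = \bigcap_(j in [set` ([::] : seq nat)]) Q j @^-1` setT); last first.
  by apply/seteqP; split.
rewrite /density; under eq_integral do rewrite big_nil mulr1.
rewrite (@iid_integral_prod _ _ _ _ _ P Q hQ _ (fun t => t.1.1)
  (fun t q => quenched_step q t.1.2 t.2) [::] (fun=> setT))//.
- by rewrite big_nil mul1r.
- by move=> t; exact: measurable_quenched_step.
- by move=> t q; rewrite quenched_step_ge0 quenched_step_le1.
Qed.

Lemma step_probaE n z x : P (step_event n z x) = (step_proba z x)%:E.
Proof.
have := @steps_independent [:: (n, z, x)] isT; rewrite big_seq1.
rewrite (_ : [set` _] = [set (n, z, x)]) ?bigcap_set1//.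
by apply/seteqP; split => t /=; rewrite inE => /eqP.
Qed.

Lemma probability_bigcup (F : nat -> set T) : (forall i, measurable (F i)) ->
  trivIset setT F -> (P (\bigcup_i F i) = \sum_(i <oo) P (F i))%E.
Proof. by move=> mF tF; apply: measure_semi_bigcup => //; exact: bigcupT_measurable. Qed.

Variable k : nat.
Let Z := bpire N Y k.

Lemma bpire_eventS n x :
  Z n.+1 @^-1` [set x] = \bigcup_z (Z n @^-1` [set z] `&` step_event n z x).
Proof.
apply/seteqP; split => w; first by move=> h; exists (Z n w).
by move=> [z _ [/= zz h]]; rewrite /Z /= -/(Z n w) zz.
Qed.

Lemma measurable_bpire_fiber n x : measurable (Z n @^-1` [set x]).
Proof.
elim: n x => [|n IH] x.
  have [<-|kx] := eqVneq k x.
    by rewrite (_ : _ @^-1` _ = setT)//; apply/seteqP; split.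
  by rewrite (_ : _ @^-1` _ = set0)//; apply/seteqP; split => // w /= h; move: kx; rewrite -h eqxx.
rewrite bpire_eventS; apply: bigcupT_measurable => z.
by apply: measurableI => //; exact: measurable_step_event.
Qed.

Let future (l : seq (nat * nat * nat)) : set T :=
  \bigcap_(t in [set` l]) step_event t.1.1 t.1.2 t.2.

Let measurable_future l : measurable (future l).
Proof.
by apply: fin_bigcap_measurable => // t _; exact: measurable_step_event.
Qed.

(** A whole list of later steps is allowed so that the induction on [n] closes: splitting [Z n.+1]
    by the value [z] of [Z n] turns the last transition into one more step [(n, z, x)] of the
    list. *)
Let bpire_future n x (l : seq (nat * nat * nat)) : uniq [seq t.1.1 | t <- l] ->
  (forall t, t \in l -> n <= t.1.1)%N ->
  (P (Z n @^-1` [set x] `&` future l) =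
   P (Z n @^-1` [set x]) * (\prod_(t <- l) step_proba t.1.2 t.2)%:E)%E.
Proof.
have prod0 (s : seq (nat * nat * nat)) : (0 <= \prod_(t <- s) step_proba t.1.2 t.2).
  by apply: prodr_ge0 => t _; exact: step_proba_ge0.
elim: n x l => [|n IH] x l ul nl.
  have [<-|kx] := eqVneq k x.
    rewrite (_ : _ @^-1` _ = setT); last by apply/seteqP; split.
    by rewrite setTI probability_setT mul1e -steps_independent.
  rewrite (_ : _ @^-1` _ = set0); last first.
    by apply/seteqP; split => // w /= h; move: kx; rewrite -h eqxx.
  by rewrite set0I measure0 mul0e.
have step l' : uniq [seq t.1.1 | t <- l'] -> (forall t, t \in l' -> n < t.1.1)%N ->
    (P (Z n.+1 @^-1` [set x] `&` future l') =
    (\sum_(z <oo) P (Z n @^-1` [set z]) * (step_proba z x)%:E) *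
      (\prod_(t <- l') step_proba t.1.2 t.2)%:E)%E.
  move=> ul' nl'; rewrite bpire_eventS setI_bigcupl.
  rewrite probability_bigcup; last 2 first.
  - move=> z; apply: measurableI => //; apply: measurableI.
      exact: measurable_bpire_fiber.
    exact: measurable_step_event.
  - by move=> z z' _ _ [w [[[/= <- _] _] [[/= <- _] _]]].
  rewrite muleC -nneseriesZl; last first.
    by move=> z _; rewrite mule_ge0// lee_fin step_proba_ge0.
  apply: eq_eseriesr => z _.
  rewrite -setIA (_ : _ `&` future l' = future ((n, z, x) :: l')); last first.
    apply/seteqP; split => w.
      by move=> [h1 h2] t /=; rewrite inE => /predU1P[->|/h2].
    move=> h; split; first by exact: (h _ (mem_head _ _)).
    by move=> t tl; apply: h; rewrite /= inE tl orbT.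
  rewrite IH/=; last 2 first.
  - by rewrite ul' andbT; apply/mapP => -[t /nl' + tn]; rewrite -tn ltnn.
  - by move=> t; rewrite inE => /predU1P[->//|/nl'/ltnW].
  by rewrite big_cons /= [(step_proba z x * _)%R]mulrC EFinM muleCA.
rewrite step//; congr (_ * _)%E.
have := step [::] isT; rewrite big_nil mule1 => <- //.
by rewrite (_ : future [::] = setT) ?setIT//; apply/seteqP; split.
Qed.

Lemma bpire_markov n x :
  P (Z n.+1 @^-1` [set x]) =
  (\sum_(z <oo) P (Z n @^-1` [set z]) * (step_proba z x)%:E)%E.
Proof.
rewrite bpire_eventS probability_bigcup; last 2 first.
- move=> y; apply: measurableI; first exact: measurable_bpire_fiber.
  exact: measurable_step_event.
- by move=> y y' _ _ [w [[/= <- _] [/= <- _]]].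
apply: eq_eseriesr => y _.
have := @bpire_future n y [:: (n, y, x)] isT; rewrite big_seq1/= => <-.
  congr (P (_ `&` _)); rewrite /future (_ : [set` _] = [set (n, y, x)]) ?bigcap_set1//.
  by apply/seteqP; split => t /=; rewrite inE => /eqP.
by move=> t; rewrite inE => /eqP ->.
Qed.

Lemma ge0_integral_nat (V : T -> nat) (g : nat -> \bar R) :
  (forall x, measurable (V @^-1` [set x])) -> (forall x, 0 <= g x)%E ->
  (\int[P]_w g (V w) = \sum_(x <oo) g x * P (V @^-1` [set x]))%E.
Proof.
move=> mV g0.
have cover : \bigcup_x V @^-1` [set x] = setT.
  by apply/seteqP; split => // w _; exists (V w).
have tV : trivIset setT (fun x => V @^-1` [set x]).
  by move=> i j _ _ [w [/= <- <-]].
have mg : measurable_fun setT (fun w => g (V w)).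
  rewrite -cover; apply/measurable_fun_bigcup => // x.
  apply: (eq_measurable_fun (cst (g x))) => //.
  by move=> w; rewrite inE /= => <-.
rewrite -cover ge0_integral_bigcup ?cover//.
apply: eq_eseriesr => x _.
rewrite -integral_cst//; apply: eq_integral => w; rewrite inE /= => <- //.
Qed.

Lemma measurable_nat_comp (V : T -> nat) (g : nat -> R) :
  (forall x, measurable (V @^-1` [set x])) -> measurable_fun setT (fun w => g (V w)).
Proof.
move=> mV _ B mB; rewrite setTI.
rewrite (_ : _ @^-1` _ = \bigcup_(x in [set x | B (g x)]) V @^-1` [set x]).
  exact: bigcup_measurable.
by apply/seteqP; split => w /=; [move=> h; exists (V w)|move=> [x /= h ->]].
Qed.

Definition step_operator (g : nat -> R) (z : nat) : R :=
  \int[P]_w g (\sum_(i < z) N 0%N i w + Y 0%N w)%N.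

(** Transition probabilities are the same in all generations, so the operator built from the
    variables of generation 0 serves for every [n]; what remains is an interchange of nonnegative
    series. *)
Lemma bpire_step_operator (g : nat -> R) (K : R) n : (forall x, 0 <= g x <= K) ->
  \int[P]_w g (Z n.+1 w) = \int[P]_w step_operator g (Z n w).
Proof.
move=> gK; have g0 x : 0 <= g x by have /andP[] := gK x.
have stepE z : (step_operator g z)%:E = (\sum_(x <oo) (g x)%:E * (step_proba z x)%:E)%E.
  rewrite /step_operator EFin_Rintegral; last first.
    apply: (@integrable_bounded _ _ _ _ _ K); last first.
      by move=> w; rewrite ger0_norm//; have /andP[] := gK (\sum_(i < z) N 0%N i w + Y 0%N w)%N.
    apply: (@measurable_nat_comp (fun w => (\sum_(i < z) N 0%N i w + Y 0%N w)%N)) => x.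
    exact: measurable_step_event.
  rewrite (@ge0_integral_nat (fun w => (\sum_(i < z) N 0%N i w + Y 0%N w)%N) (EFin \o g))//.
    by apply: eq_eseriesr => x _; rewrite -(step_probaE 0).
  by move=> x; exact: measurable_step_event.
congr fine.
rewrite (@ge0_integral_nat (Z n.+1) (EFin \o g))//; last first.
  by move=> x; exact: measurable_bpire_fiber.
rewrite (@ge0_integral_nat (Z n) (EFin \o step_operator g)); last 2 first.
- by move=> x; exact: measurable_bpire_fiber.
- by move=> x; rewrite lee_fin; apply: Rintegral_ge0.
transitivity (\sum_(x <oo) \sum_(z <oo)
   P (Z n @^-1` [set z]) * ((g x)%:E * (step_proba z x)%:E))%E.
  apply: eq_eseriesr => x _; rewrite bpire_markov -nneseriesZl.
    by apply: eq_eseriesr => z _; rewrite muleCA.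
  by move=> z _; rewrite mule_ge0// lee_fin step_proba_ge0.
rewrite nneseries_interchange; last first.
  by move=> x z; rewrite !mule_ge0// lee_fin ?step_proba_ge0.
apply: eq_eseriesr => z _.
have Pfin : P (Z n @^-1` [set z]) \is a fin_num.
  by apply: fin_num_measure; exact: measurable_bpire_fiber.
rewrite /= stepE -(fineK Pfin) nneseriesZl; last first.
  by move=> x _; rewrite mule_ge0// lee_fin ?step_proba_ge0.
by rewrite muleC.
Qed.

End markov_property.

(** * A one-step law of large numbers *)

Section conditioning_on_environment.
Context d (T : measurableType d) (R : realType) (P : probability T R).
Variable Q : nat -> {mfun T >-> environment R}.
Variables (N : nat -> nat -> {mfun T >-> nat}) (Y : nat -> {mfun T >-> nat}).
Hypothesis hNY : quenched_independent P Q N Y.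
Local Open Scope ereal_scope.

Let Q0 := Q 0%N.
Let f (w : T) := offspring_law (Q0 w).

Let mQ0 (B : set (environment R)) : measurable B -> measurable (Q0 @^-1` B).
Proof. by move=> mB; rewrite -[X in measurable X]setTI; exact: measurable_funPT. Qed.

Let mf j : measurable_fun setT (fun w => fine (f w [set j])).
Proof. exact: (measurableT_comp (measurable_offspring_law [set j])). Qed.

Lemma offspring_integral_series (q : environment R) (g : nat -> \bar R) :
  (forall j, 0 <= g j) ->
  \int[offspring_law q]_j g j =
  \sum_(j <oo) g j * (fine (offspring_law q [set j]))%:E.
Proof.
move=> g0; rewrite (@ge0_integral_nat _ _ _ (offspring_law q) id)//.
apply: eq_eseriesr => j _; rewrite fineK ?offspring_law_fin//.
Qed.

Lemma measurable_offspring_integral (H : environment R -> nat -> \bar R) :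
  (forall j, measurable_fun setT (H^~ j)) -> (forall q j, 0 <= H q j) ->
  measurable_fun setT (fun q => \int[offspring_law q]_j H q j).
Proof.
move=> mH H0; under eq_fun do rewrite offspring_integral_series//.
apply: ge0_emeasurable_sum => [j q _ _|j _].
  by rewrite mule_ge0// lee_fin; have /andP[] := fine_offspring_law_bounds q [set j].
apply: emeasurable_funM => //; apply/measurable_EFinP.
exact: measurable_offspring_law.
Qed.

Let integral_fibers (V : {mfun T >-> nat}) (g : T -> nat -> \bar R) :
  (forall j, measurable_fun setT (g^~ j)) -> (forall w j, 0 <= g w j) ->
  \int[P]_w g w (V w) = \sum_(j <oo) \int[P]_w (g w j * (\1_(V @^-1` [set j]) w)%:E).
Proof.
move=> mg g0.
have cover : \bigcup_x V @^-1` [set x] = setT.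
  by apply/seteqP; split => // w _; exists (V w).
have tV : trivIset setT (fun x => V @^-1` [set x]).
  by move=> i j _ _ [w [/= <- <-]].
have mV x : measurable (V @^-1` [set x]) by exact: measurable_nat_fiber.
have mgV : measurable_fun setT (fun w => g w (V w)).
  rewrite -cover; apply/measurable_fun_bigcup => // x.
  apply: (eq_measurable_fun (g^~ x)) => //.
    by move=> w; rewrite inE /= => ->.
  by apply: measurable_funTS; exact: mg.
rewrite -[in LHS]cover ge0_integral_bigcup ?cover//.
apply: eq_eseriesr => x _; rewrite integral_mkcond; apply: eq_integral => w _.
rewrite /patch indicE; case: ifPn; last by rewrite mule0.
by rewrite inE /= mule1 => ->.
Qed.

(** The weight lets one statement serve twice: [a = c = 1] for a single offspring variable, and for
    a pair [a] is the indicator of a value [l] of the second variable while [c] is the mass of [f]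
    at [l]. *)
Let weighted_conditioning i (a c : T -> R) (H : environment R -> nat -> \bar R) :
  measurable_fun setT a -> measurable_fun setT c ->
  (forall w, 0 <= a w)%R -> (forall w, 0 <= c w)%R ->
  (forall j B, measurable B ->
    \int[P]_(w in Q0 @^-1` B) (a w * \1_(N 0%N i @^-1` [set j]) w)%:E =
    \int[P]_(w in Q0 @^-1` B) (c w * fine (f w [set j]))%:E) ->
  (forall j, measurable_fun setT (H^~ j)) -> (forall q j, 0 <= H q j) ->
  \int[P]_w (H (Q0 w) (N 0%N i w) * (a w)%:E) =
  \int[P]_w ((\int[f w]_j H (Q0 w) j) * (c w)%:E).
Proof.
move=> ma mc a0 c0 ac mH H0.
have mHQ j : measurable_fun setT (fun w => H (Q0 w) j).
  exact: (measurableT_comp (mH j)).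
rewrite (integral_fibers (N 0%N i) (g := fun w j => H (Q0 w) j * (a w)%:E)); last 2 first.
- by move=> j; apply: emeasurable_funM => //; exact/measurable_EFinP.
- by move=> w j; rewrite mule_ge0// lee_fin.
transitivity (\sum_(j <oo) \int[P]_w (H (Q0 w) j * (c w * fine (f w [set j]))%:E)).
  apply: eq_eseriesr => j _.
  under eq_integral do rewrite -muleA -EFinM.
  apply: (@ge0_eq_integral_comp_mul _ _ _ _ _ P Q0 _ _ _ _ _ _ _ _ (H^~ j)) => //.
  - by apply: measurable_funM => //; exact/measurable_indic/measurable_nat_fiber.
  - exact: measurable_funM.
  - by move=> w; rewrite mulr_ge0// indicE.
  - by move=> w; rewrite mulr_ge0//; have /andP[] := fine_offspring_law_bounds (Q0 w) [set j].
  - exact: ac.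
rewrite -integral_nneseries//; last 2 first.
- move=> j; apply: emeasurable_funM => //; apply/measurable_EFinP.
  exact: measurable_funM.
- move=> j w _; rewrite mule_ge0// lee_fin mulr_ge0//.
  by have /andP[] := fine_offspring_law_bounds (Q0 w) [set j].
apply: eq_integral => w _.
rewrite offspring_integral_series// muleC -nneseriesZl; last first.
  move=> j _; rewrite mule_ge0// lee_fin.
  by have /andP[] := fine_offspring_law_bounds (Q0 w) [set j].
by apply: eq_eseriesr => j _; rewrite EFinM muleCA.
Qed.

Let environment_event0 B : measurable B -> environment_events Q (Q0 @^-1` B).
Proof. by move=> mB; apply: sub_sigma_algebra; exists 0%N, B. Qed.

Lemma conditional_offspring i (H : environment R -> nat -> \bar R) :
  (forall j, measurable_fun setT (H^~ j)) -> (forall q j, 0 <= H q j) ->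
  \int[P]_w H (Q0 w) (N 0%N i w) = \int[P]_w \int[f w]_j H (Q0 w) j.
Proof.
move=> mH H0.
transitivity (\int[P]_w (H (Q0 w) (N 0%N i w) * 1%:E)).
  by apply: eq_integral => w _; rewrite mule1.
transitivity (\int[P]_w ((\int[f w]_j H (Q0 w) j) * 1%:E)); last first.
  by apply: eq_integral => w _; rewrite mule1.
apply: (@weighted_conditioning i (fun=> 1%R) (fun=> 1%R) H) => // j B mB.
under eq_integral do rewrite mul1r.
under [RHS]eq_integral do rewrite mul1r.
rewrite integral_indic//; [|exact: mQ0|exact: measurable_nat_fiber].
have := @hNY [:: (0%N, Some i)] (fun=> [set j]) (Q0 @^-1` B) isT (environment_event0 mB).
rewrite (_ : [set` _] = [set (0%N, Some i)]); last first.
  by apply/seteqP; split => t /=; rewrite inE => /eqP.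
rewrite bigcap_set1 setIC => h; apply: etrans h _; apply: eq_integral => w _.
by rewrite big_seq1 /= fineK// offspring_law_fin.
Qed.

(** The second variable is frozen at a value [l], whose indicator becomes a weight; quenched
    independence of the two variables, for [i != k], replaces this weight by the mass of [f] at
    [l]. *)
Lemma conditional_offspring_pair i k (H : environment R -> nat -> nat -> \bar R) :
  i != k -> (forall j l, measurable_fun setT (fun q => H q j l)) ->
  (forall q j l, 0 <= H q j l) ->
  \int[P]_w H (Q0 w) (N 0%N i w) (N 0%N k w) =
  \int[P]_w \int[f w]_l \int[f w]_j H (Q0 w) j l.
Proof.
move=> ik mH H0.
have mV x : measurable (N 0%N i @^-1` [set x]) by exact: measurable_nat_fiber.
have mHQ l : measurable_fun setT (fun w => H (Q0 w) (N 0%N i w) l).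
  have cover : \bigcup_x (N 0%N i) @^-1` [set x] = setT.
    by apply/seteqP; split => // w _; exists (N 0%N i w).
  rewrite -cover; apply/measurable_fun_bigcup => // x.
  apply: (eq_measurable_fun (fun w => H (Q0 w) x l)) => //.
    by move=> w; rewrite inE /= => ->.
  by apply: measurable_funTS; exact: (measurableT_comp (mH x l)).
rewrite (integral_fibers (N 0%N k) (g := fun w l => H (Q0 w) (N 0%N i w) l))//.
transitivity (\sum_(l <oo) \int[P]_w ((\int[f w]_j H (Q0 w) j l) * (fine (f w [set l]))%:E)).
  apply: eq_eseriesr => l _.
  apply: (weighted_conditioning (H := fun q j => H q j l)) => //.
  - exact/measurable_indic/measurable_nat_fiber.
  - by move=> w; have /andP[] := fine_offspring_law_bounds (Q0 w) [set l].
  - move=> j B mB.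
    under eq_integral do rewrite mulrC -[(_ * _)%R]/((\1_(N 0%N i @^-1` [set j]) \* \1_(N 0%N k @^-1` [set l])) _)%R -indicI.
    rewrite integral_indic//; [|exact: mQ0|by apply: measurableI; exact: measurable_nat_fiber].
    have := @hNY [:: (0%N, Some i); (0%N, Some k)] (fun t => if t == (0%N, Some i) then [set j] else [set l]) (Q0 @^-1` B) _ (environment_event0 mB).
    rewrite (_ : \bigcap_(_ in _) _ = N 0%N i @^-1` [set j] `&` N 0%N k @^-1` [set l]); last first.
      apply/seteqP; split => w.
        move=> h; split; first by have := h (0%N, Some i); rewrite /= !inE eqxx; apply.
        have := h (0%N, Some k); rewrite /= !inE eqxx orbT (_ : (_ == _) = false); first by apply.
        by apply/eqP => -[] ki; move: ik; rewrite ki eqxx.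
      move=> [h1 h2] t /=; rewrite !inE => /orP[/eqP->|/eqP->]; first by rewrite eqxx.
      rewrite (_ : (_ == _) = false)//.
      by apply/eqP => -[] ki; move: ik; rewrite ki eqxx.
    rewrite setIC => h; apply: etrans (h _) _.
      by rewrite /= inE andbT; apply/eqP => -[] ki; move: ik; rewrite ki eqxx.
    apply: eq_integral => w _.
    rewrite big_cons big_seq1 /= eqxx (_ : (_ == _) = false); last first.
      by apply/eqP => -[] ki; move: ik; rewrite ki eqxx.
    by rewrite mulrC EFinM !fineK ?offspring_law_fin.
rewrite -integral_nneseries//; last 2 first.
- move=> l; apply: emeasurable_funM; last exact/measurable_EFinP.
  apply: (measurableT_comp (measurable_offspring_integral (H := fun q j => H q j l) _ _)) => //.
- move=> l w _; rewrite mule_ge0//; first exact: integral_ge0.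
  by rewrite lee_fin; have /andP[] := fine_offspring_law_bounds (Q0 w) [set l].
apply: eq_integral => w _; rewrite offspring_integral_series// => l.
exact: integral_ge0.
Qed.

End conditioning_on_environment.

(** * Truncated second moment estimate for one generation *)

Section one_step_law_of_large_numbers.
Context d (T : measurableType d) (R : realType) (P : probability T R).
Variable Q : nat -> {mfun T >-> environment R}.
Variables (N : nat -> nat -> {mfun T >-> nat}) (Y : nat -> {mfun T >-> nat}).
Hypothesis hNY : quenched_independent P Q N Y.
Variables (ell : environment R -> R) (b p : R).
Hypotheses (mell : measurable_fun setT ell) (ellb : forall q, - b <= ell q).
Hypothesis ell_mean : {ae P, forall w,
  (\int[offspring_law (Q 0%N w)]_j (j%:R * expR (- ell (Q 0%N w)))%:E = 1)%E}.
Hypothesis p12 : 1 < p <= 2.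

Let D i w : R := (N 0%N i w)%:R * expR (- ell (Q 0%N w)).
Let Y0 w : R := (Y 0%N w)%:R.
Hypothesis momD : (\int[P]_w (D 0 w `^ p)%:E < +oo)%E.
Hypothesis iY : P.-integrable setT (EFin \o Y0).

Let mellQ : measurable_fun setT (fun w => ell (Q 0%N w)).
Proof. exact: (measurableT_comp mell). Qed.

Let mexp : measurable_fun setT (fun w => expR (- ell (Q 0%N w))).
Proof. by apply: measurableT_comp => //; exact: measurable_funN. Qed.

Let mnat (V : {mfun T >-> nat}) : measurable_fun setT (fun w => (V w)%:R : R).
Proof.
by apply: (@measurable_nat_comp _ _ _ V (fun n => n%:R)) => x; exact: measurable_nat_fiber.
Qed.

Let mD i : measurable_fun setT (D i).
Proof. by apply: measurable_funM. Qed.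

Let D_ge0 i w : 0 <= D i w.
Proof. by rewrite mulr_ge0// expR_ge0. Qed.

Let intD i : (\int[P]_w (D i w)%:E = 1)%E.
Proof.
rewrite (conditional_offspring hNY i (H := fun q j => (j%:R * expR (- ell q))%:E)); last 2 first.
- move=> j; apply/measurable_EFinP; apply: measurable_funM => //.
  by apply: measurableT_comp => //; exact: measurable_funN.
- by move=> q j; rewrite lee_fin mulr_ge0// expR_ge0.
rewrite (ae_eq_integral (cst 1%E))//.
- by rewrite integral_cst// mul1e; exact: probability_setT.
- apply: (measurableT_comp (measurable_offspring_integral
    (H := fun q j => (j%:R * expR (- ell q))%:E) _ _)) => //.
    move=> j; apply/measurable_EFinP; apply: measurable_funM => //.
    by apply: measurableT_comp => //; exact: measurable_funN.
- by apply: filterS ell_mean => w h _.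
Qed.

Let iD i : P.-integrable setT (EFin \o D i).
Proof.
apply/integrableP; split; first exact/measurable_EFinP.
rewrite (eq_integral (fun w => (D i w)%:E)) ?intD ?ltry// => w _.
by rewrite /= ger0_norm.
Qed.

(* Centring at the quenched mean [C] makes the truncated variables orthogonal; the
   truncation error is controlled by the [p]-th moment. *)
Section truncation.
Variable t : R.
Hypothesis t0 : 0 < t.

(** Values above [t] are discarded rather than capped, so that [D - V] is [D] where [D > t] and 0
    elsewhere. *)
Let trunc (x : R) : R := if x <= t then x else 0.

Let measurable_trunc : measurable_fun setT trunc.
Proof.
rewrite (_ : trunc = fun x => x * \1_(`]-oo, t]%classic) x).
  by apply: measurable_funM => //; exact: measurable_indic.
apply/funext => x; rewrite indicE /trunc; case: ifPn => xt.
  by rewrite mem_set ?mulr1//= in_itv.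
by rewrite memNset ?mulr0//= in_itv/=; exact/negP.
Qed.

Let trunc_bounds x : 0 <= x -> 0 <= trunc x <= t.
Proof. by move=> x0; rewrite /trunc; case: ifPn => [->|_]; rewrite ?x0// lexx ltW. Qed.

Let h (q : environment R) (j : nat) : R := trunc (j%:R * expR (- ell q)).

Let h_bounds q j : 0 <= h q j <= t.
Proof. by apply: trunc_bounds; rewrite mulr_ge0// expR_ge0. Qed.

Let mh j : measurable_fun setT (h^~ j).
Proof.
apply: (measurableT_comp measurable_trunc); apply: measurable_funM => //.
by apply: measurableT_comp => //; exact: measurable_funN.
Qed.

Let c (q : environment R) : R := \int[offspring_law q]_j h q j.

Let ih q : (offspring_law q).-integrable setT (EFin \o h q).
Proof.
apply: (@integrable_bounded _ _ _ _ _ t) => // j.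
by have /andP[h0 ht] := h_bounds q j; rewrite ger0_norm.
Qed.

Let cE q : (c q)%:E = (\int[offspring_law q]_j (h q j)%:E)%E.
Proof. by rewrite EFin_Rintegral. Qed.

Let c_bounds q : 0 <= c q <= t.
Proof.
apply/andP; split.
  by apply: Rintegral_ge0 => j _; have /andP[] := h_bounds q j.
rewrite -[leRHS](Rintegral_probability_cst (offspring_law q)).
apply: Rintegral_le => //; last by move=> j; have /andP[] := h_bounds q j.
by apply: (@integrable_bounded _ _ _ _ _ `|t|).
Qed.

Let mc : measurable_fun setT c.
Proof.
apply/measurable_EFinP; rewrite (_ : EFin \o c = fun q => \int[offspring_law q]_j (h q j)%:E)%E.
  apply: measurable_offspring_integral => [j|q j]; first exact/measurable_EFinP.
  by rewrite lee_fin; have /andP[] := h_bounds q j.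
by apply/funext => q; rewrite -cE.
Qed.

Let C w := c (Q 0%N w).
Let V i w := h (Q 0%N w) (N 0%N i w).

Let mC : measurable_fun setT C. Proof. exact: (measurableT_comp mc). Qed.

Let VE i w : V i w = trunc (D i w). Proof. by []. Qed.

Let mV i : measurable_fun setT (V i).
Proof. exact: (measurableT_comp measurable_trunc (mD i)). Qed.

Let V_bounds i w : 0 <= V i w <= t. Proof. exact: h_bounds. Qed.
Let C_bounds w : 0 <= C w <= t. Proof. exact: c_bounds. Qed.

Let mean_V i : \int[P]_w V i w = \int[P]_w C w.
Proof.
congr fine; rewrite (conditional_offspring hNY i (H := fun q j => (h q j)%:E)).
- by apply: eq_integral => w _; rewrite -cE.
- by move=> j; exact/measurable_EFinP.
- by move=> q j; rewrite lee_fin; have /andP[] := h_bounds q j.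
Qed.

Let mean_VC i : \int[P]_w (V i w * C w) = \int[P]_w (C w * C w).
Proof.
congr fine; rewrite (conditional_offspring hNY i (H := fun q j => (h q j * c q)%:E)).
- apply: eq_integral => w _.
  rewrite EFinM -/(C w) cE -ge0_integralZr//.
  - by apply: eq_integral => j _; rewrite -cE.
  - by move=> j _; rewrite lee_fin; have /andP[] := h_bounds (Q 0%N w) j.
  - by rewrite -cE lee_fin; have /andP[] := C_bounds w.
- by move=> j; apply/measurable_EFinP; exact: measurable_funM.
- move=> q j; rewrite lee_fin mulr_ge0//; first by have /andP[] := h_bounds q j.
  by have /andP[] := c_bounds q.
Qed.

Let mean_VV i k : i != k -> \int[P]_w (V i w * V k w) = \int[P]_w (C w * C w).
Proof.
move=> ik; congr fine.
rewrite (conditional_offspring_pair hNY (H := fun q j l => (h q j * h q l)%:E) ik).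
- apply: eq_integral => w _.
  have h0 j : (0 <= (h (Q 0%N w) j)%:E)%E by rewrite lee_fin; have /andP[] := h_bounds (Q 0%N w) j.
  under eq_integral.
    move=> l _; under eq_integral do rewrite EFinM.
    rewrite ge0_integralZr// -cE; over.
  rewrite ge0_integralZl//=; last by rewrite lee_fin; have /andP[] := c_bounds (Q 0%N w).
  by rewrite -cE -EFinM.
- by move=> j l; apply/measurable_EFinP; exact: measurable_funM.
- move=> q j l; rewrite lee_fin mulr_ge0//; first by have /andP[] := h_bounds q j.
  by have /andP[] := h_bounds q l.
Qed.

Let bI (g : T -> R) (K : R) : measurable_fun setT g -> (forall w, `|g w| <= K) ->
  P.-integrable setT (EFin \o g).
Proof. exact: integrable_bounded. Qed.

Let iVC i : P.-integrable setT (EFin \o (fun w => V i w * C w)).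
Proof.
apply: (bI (K := t * t)); first exact: measurable_funM.
move=> w; have /andP[v0 v1] := V_bounds i w; have /andP[c0 c1] := C_bounds w.
by rewrite ger0_norm ?mulr_ge0// ler_pM.
Qed.

Let iVV i k : P.-integrable setT (EFin \o (fun w => V i w * V k w)).
Proof.
apply: (bI (K := t * t)); first exact: measurable_funM.
move=> w; have /andP[v0 v1] := V_bounds i w; have /andP[c0 c1] := V_bounds k w.
by rewrite ger0_norm ?mulr_ge0// ler_pM.
Qed.

Let iCC : P.-integrable setT (EFin \o (fun w => C w * C w)).
Proof.
apply: (bI (K := t * t)); first exact: measurable_funM.
move=> w; have /andP[c0 c1] := C_bounds w.
by rewrite ger0_norm ?mulr_ge0// ler_pM.
Qed.

Let W i w := V i w - C w.

Let mW i : measurable_fun setT (W i). Proof. exact: measurable_funB. Qed.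

Let W_le i w : `|W i w| <= t.
Proof.
have /andP[? ?] := V_bounds i w; have /andP[? ?] := C_bounds w.
by rewrite ler_norml /W; apply/andP; split; lra.
Qed.

(** Given the environment, [V i] and [V k] are independent with mean [C], so the expectations of
    [V i * V k], [V i * C] and [V k * C] all equal that of [C * C]. *)
Let orthogonal i k : i != k -> \int[P]_w (W i w * W k w) = 0.
Proof.
move=> ik.
transitivity (\int[P]_w ((V i w * V k w - V i w * C w) - (V k w * C w - C w * C w))).
  by apply: eq_Rintegral => w _; rewrite /W; ring.
rewrite RintegralB//.
- rewrite RintegralB// RintegralB// mean_VV// !mean_VC; ring.
- exact: (integrableB measurableT (iVV i k) (iVC i)).
- exact: (integrableB measurableT (iVC k) iCC).
Qed.

Let S z w := \sum_(i < z) W i w.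

Let mS z : measurable_fun setT (S z). Proof. by apply: measurable_sum. Qed.

Let S_le z w : `|S z w| <= z%:R * t.
Proof.
rewrite /S (le_trans (ler_norm_sum _ _ _))//.
by rewrite mulr_natl -[z in leRHS]card_ord -sumr_const; apply: ler_sum => i _.
Qed.

Let S_orthogonal z k : (z <= k)%N -> \int[P]_w (S z w * W k w) = 0.
Proof.
elim: z => [|z IH] zk.
  under eq_Rintegral do rewrite /S big_ord0 mul0r.
  by rewrite Rintegral_probability_cst.
have -> : \int[P]_w (S z.+1 w * W k w) =
    \int[P]_w (S z w * W k w + W z w * W k w).
  by apply: eq_Rintegral => w _; rewrite /S big_ord_recr /= mulrDl.
rewrite RintegralD//.
- rewrite IH ?(ltnW zk)// orthogonal ?addr0//.
  by rewrite neq_ltn zk.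
- apply: (bI (K := z%:R * t * t)); first exact: measurable_funM.
  by move=> w; rewrite normrM ler_pM.
- apply: (bI (K := t * t)); first exact: measurable_funM.
  by move=> w; rewrite normrM ler_pM.
Qed.

Let S_square z : \int[P]_w (S z w ^+ 2) <= z%:R * t ^+ 2.
Proof.
elim: z => [|z IH].
  under eq_Rintegral do rewrite /S big_ord0 expr2 mul0r.
  by rewrite Rintegral_probability_cst mul0r.
have iSS y : P.-integrable setT (EFin \o (fun w => S y w ^+ 2)).
  apply: (bI (K := (y%:R * t) ^+ 2)); first exact: measurable_funX.
  by move=> w; rewrite normrX lerXn2r// nnegrE// mulr_ge0// ltW.
have iSW : P.-integrable setT (EFin \o (fun w => S z w * W z w)).
  apply: (bI (K := z%:R * t * t)); first exact: measurable_funM.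
  by move=> w; rewrite normrM ler_pM.
have iWW : P.-integrable setT (EFin \o (fun w => W z w ^+ 2)).
  apply: (bI (K := t ^+ 2)); first exact: measurable_funX.
  by move=> w; rewrite normrX lerXn2r// nnegrE// ltW.
have -> : \int[P]_w (S z.+1 w ^+ 2) =
    \int[P]_w (S z w ^+ 2 + (2 * (S z w * W z w) + W z w ^+ 2)).
  by apply: eq_Rintegral => w _; rewrite /S big_ord_recr /=; ring.
have i2 := integrableZl measurableT 2 iSW.
rewrite RintegralD//; last exact: (integrableD measurableT i2 iWW).
rewrite RintegralD// RintegralZl// S_orthogonal// mulr0 add0r.
rewrite -natr1 mulrDl mul1r; apply: lerD => //.
rewrite -[leRHS](Rintegral_probability_cst P); apply: Rintegral_le => //.
  by apply: (bI (K := `|t ^+ 2|)).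
by move=> w; rewrite -[leLHS]ger0_norm ?sqr_ge0// normrX lerXn2r// nnegrE// ltW.
Qed.

(** The free parameter [lam] keeps the bound linear in the second moment, so that no square root of
    an expectation appears; [lam] is fixed together with the truncation level. *)
Let deviation z : (0 < z)%N -> forall lam, 0 < lam ->
  \int[P]_w `|S z w| <= (z%:R * t ^+ 2 / lam + lam) / 2.
Proof.
move=> z0 lam lam0.
have iSS : P.-integrable setT (EFin \o (fun w => S z w ^+ 2)).
  apply: (bI (K := (z%:R * t) ^+ 2)); first exact: measurable_funX.
  by move=> w; rewrite normrX lerXn2r// nnegrE// mulr_ge0// ltW.
have ilam : P.-integrable setT (EFin \o (fun w => lam / 2)).
  by apply: (bI (K := `|lam / 2|)).
apply: (@le_trans _ _ (\int[P]_w ((2 * lam)^-1 * S z w ^+ 2 + lam / 2))).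
  (* AM-GM: [x <= x ^ 2 / (2 lam) + lam / 2] *)
  apply: Rintegral_le.
  - by apply: (bI (K := z%:R * t)); [exact: measurableT_comp|move=> w; rewrite normr_id].
  - exact: (integrableD measurableT (integrableZl measurableT (2 * lam)^-1 iSS) ilam).
  - move=> w; rewrite -[S z w ^+ 2]ger0_norm ?sqr_ge0// normrX.
    move: (`|S z w|) => x; rewrite -subr_ge0.
    have -> : (2 * lam)^-1 * x ^+ 2 + lam / 2 - x = (x - lam) ^+ 2 / (2 * lam).
      by field; rewrite gt_eqF.
    by rewrite divr_ge0 ?sqr_ge0// mulr_ge0// ltW.
rewrite RintegralD//; last exact: (integrableZl measurableT (2 * lam)^-1 iSS).
rewrite RintegralZl// Rintegral_probability_cst.
have -> : (z%:R * t ^+ 2 / lam + lam) / 2 = (2 * lam)^-1 * (z%:R * t ^+ 2) + lam / 2.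
  by field; rewrite gt_eqF.
by rewrite lerD2r ler_wpM2l ?S_square// invr_ge0 mulr_ge0// ltW.
Qed.

Let iV i : P.-integrable setT (EFin \o V i).
Proof. by apply: (bI (K := t)) => // w; have /andP[? ?] := V_bounds i w; rewrite ger0_norm. Qed.

Let iC : P.-integrable setT (EFin \o C).
Proof. by apply: (bI (K := t)) => // w; have /andP[? ?] := C_bounds w; rewrite ger0_norm. Qed.

Let tail i : \int[P]_w (D i w - V i w) = 1 - \int[P]_w C w.
Proof. by rewrite RintegralB// mean_V /Rintegral intD. Qed.

Let V_le_D i w : V i w <= D i w.
Proof. by rewrite VE /trunc; case: ifP. Qed.

(** Where [D > t], write [D = D ^ p * D ^ (1 - p)]; the last factor is at most [t ^ (1 - p)] because
    [p > 1]. *)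
Let tail_small : 1 - \int[P]_w C w <= t `^ (1 - p) * fine (\int[P]_w (D 0 w `^ p)%:E).
Proof.
have /andP[p1 p2] := p12.
rewrite -(tail 0).
have iDp : P.-integrable setT (EFin \o (fun w => D 0 w `^ p)).
  apply/integrableP; split.
    by apply/measurable_EFinP; apply: (measurableT_comp (measurable_powR p)).
  rewrite (eq_integral (fun w => (D 0 w `^ p)%:E))// => w _.
  by rewrite /= ger0_norm// powR_ge0.
rewrite -[fine _]/(\int[P]_w (D 0 w `^ p)) -RintegralZl//.
apply: Rintegral_le => [||w].
- exact: (integrableB measurableT (iD 0) (iV 0)).
- exact: (integrableZl measurableT (t `^ (1 - p)) iDp).
rewrite VE /trunc; case: ifPn => [_|].
  by rewrite subrr mulr_ge0// powR_ge0.
rewrite subr0 -ltNge => Dt.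
have D0 : 0 < D 0 w by exact: lt_trans Dt.
rewrite -(mulr_powRB1 (ltW D0) (lt_trans ltr01 p1)) mulrCA ler_pMr//.
rewrite -opprB powRN mulrC ler_pdivlMr ?powR_gt0// mul1r.
by rewrite ge0_ler_powR ?subr_ge0 ?nnegrE// ltW.
Qed.

(** The deviation splits into the mass cut off, the centred sum [S z] and the bias [z (1 - C)]. The
    mass cut off and the bias have the same mean, whence the factor 2. *)
Lemma one_step_truncated z lam : (0 < z)%N -> 0 < lam ->
  \int[P]_w `|\sum_(i < z) D i w - z%:R| <=
  2 * z%:R * (t `^ (1 - p) * fine (\int[P]_w (D 0 w `^ p)%:E)) +
  (z%:R * t ^+ 2 / lam + lam) / 2.
Proof.
move=> z0 lam0.
have iDV i : P.-integrable setT (EFin \o (fun w => D i w - V i w)).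
  exact: (integrableB measurableT (iD i) (iV i)).
have i1C : P.-integrable setT (EFin \o (fun w => `|1 - C w|)).
  apply: (bI (K := 1 + t)); first by apply: measurableT_comp => //; exact: measurable_funB.
  move=> w; have /andP[c0 c1] := C_bounds w; rewrite normr_id.
  by rewrite (le_trans (ler_normB _ _))// normr1 lerD2l ger0_norm.
(* [C] is the truncation of a quenched mean equal to 1, so [1 - C] is nonnegative almost surely. *)
have E1C : \int[P]_w `|1 - C w| = 1 - \int[P]_w C w.
  transitivity (\int[P]_w (1 - C w)).
    congr fine; apply: ae_eq_integral => //.
    - by apply/measurable_EFinP; apply: measurableT_comp => //; exact: measurable_funB.
    - by apply/measurable_EFinP; exact: measurable_funB.
    apply: filterS ell_mean => w hw _ /=; rewrite ger0_norm// subr_ge0 -lee_fin.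
    rewrite -hw /C cE; apply: ge0_le_integral => //.
    - by move=> j _; rewrite lee_fin; have /andP[] := h_bounds (Q 0%N w) j.
    - by move=> j _; rewrite lee_fin /h /trunc; case: ifP => // _; rewrite mulr_ge0// expR_ge0.
  rewrite RintegralB//; last by apply: (bI (K := 1)) => // w; rewrite normr1.
  by rewrite Rintegral_probability_cst.
have iS : P.-integrable setT (EFin \o (fun w => `|S z w|)).
  by apply: (bI (K := z%:R * t)); [exact: measurableT_comp|move=> w; rewrite normr_id].
have isum y : P.-integrable setT (EFin \o (fun w => \sum_(i < y) (D i w - V i w))).
  have -> : EFin \o (fun w => \sum_(i < y) (D i w - V i w)) =
      (fun w => \sum_(i < y) (D i w - V i w)%:E)%E.
    by apply/funext => w; rewrite /= sumEFin.
  by apply: (integrable_sum measurableT) => i _; exact: iDV.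
have Esum y : \int[P]_w (\sum_(i < y) (D i w - V i w)) = y%:R * (1 - \int[P]_w C w).
  elim: y => [|y IH].
    by under eq_Rintegral do rewrite big_ord0; rewrite Rintegral_probability_cst mul0r.
  under eq_Rintegral do rewrite big_ord_recr/=.
  rewrite RintegralD//; last exact: isum.
  by rewrite IH tail -natr1 mulrDl mul1r.
have iz : P.-integrable setT (EFin \o (fun w => z%:R * `|1 - C w|)).
  exact: (integrableZl measurableT z%:R i1C).
have isz : P.-integrable setT (EFin \o (fun w => `|\sum_(i < z) D i w - z%:R|)).
  have := integrable_norm; apply.
  have -> : EFin \o (fun w => \sum_(i < z) D i w - z%:R) =
      ((fun w => \sum_(i < z) (D i w)%:E) \- cst z%:R%:E)%E.
    by apply/funext => w; rewrite /= sumEFin.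
  apply: (integrableB measurableT).
    by apply: (integrable_sum measurableT) => i _; exact: iD.
  by apply: (bI (K := `|z%:R|)).
apply: (@le_trans _ _ (\int[P]_w (\sum_(i < z) (D i w - V i w) + (`|S z w| + z%:R * `|1 - C w|)))).
  apply: Rintegral_le => //.
    exact: (integrableD measurableT (isum z) (integrableD measurableT iS iz)).
  move=> w.
  have -> : \sum_(i < z) D i w - z%:R =
      \sum_(i < z) (D i w - V i w) + (S z w - z%:R * (1 - C w)).
    rewrite /S /W !sumrB sumr_const card_ord mulrBr mulr1 mulr_natl; ring.
  rewrite (le_trans (ler_normD _ _))// lerD//.
    by rewrite ger0_norm// sumr_ge0// => i _; rewrite subr_ge0 V_le_D.
  by rewrite (le_trans (ler_normB _ _))// normrM normr_nat.
rewrite RintegralD//; last exact: (integrableD measurableT iS iz).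
rewrite RintegralD// Esum RintegralZl// E1C.
have h1 := deviation z0 lam0.
have h2 : z%:R * (1 - \int[P]_w C w) <=
    z%:R * (t `^ (1 - p) * fine (\int[P]_w (D 0 w `^ p)%:E)).
  by rewrite ler_wpM2l.
by move: h1 h2; lra.
Qed.

End truncation.

Let Mp := fine (\int[P]_w (D 0 w `^ p)%:E).

Let relative z w : R :=
  (\sum_(i < z) N 0%N i w + Y 0%N w)%N%:R * expR (- ell (Q 0%N w)) / z%:R - 1.

Lemma one_step_law_of_large_numbers : exists2 C : R, 0 <= C & forall z, (0 < z)%N ->
  P.-integrable setT (EFin \o (fun w => `|relative z w|)) /\
  \int[P]_w `|relative z w| <= C * expR (- ((p - 1) / 4 * ln z%:R)).
Proof.
have /andP[p1 p2] := p12.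
have iYb : P.-integrable setT (EFin \o (fun w => expR b * Y0 w)).
  exact: (integrableZl measurableT (expR b) iY).
exists (2 * Mp + 1 + expR b * \int[P]_w Y0 w).
  rewrite !addr_ge0// ?mulr_ge0 ?expR_ge0//; last by apply: Rintegral_ge0.
  by rewrite fine_ge0// integral_ge0// => w _; rewrite lee_fin powR_ge0.
move=> z z0; set L := ln z%:R.
have z1 : 1 <= z%:R :> R by rewrite ler1n.
have L0 : 0 <= L by exact: ln_ge0.
have zE : z%:R = expR L by rewrite lnK// posrE (lt_le_trans ltr01).
have relE w : relative z w = (\sum_(i < z) D i w - z%:R) / z%:R +
    Y0 w * expR (- ell (Q 0%N w)) / z%:R.
  rewrite /relative natrD natr_sum /D -mulr_suml /Y0; field.
  by rewrite gt_eqF// ltr0n.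
have isz : P.-integrable setT (EFin \o (fun w => `|\sum_(i < z) D i w - z%:R|)).
  have := integrable_norm; apply.
  have -> : EFin \o (fun w => \sum_(i < z) D i w - z%:R) =
      ((fun w => \sum_(i < z) (D i w)%:E) \- cst z%:R%:E)%E.
    by apply/funext => w; rewrite /= sumEFin.
  apply: (integrableB measurableT).
    by apply: (integrable_sum measurableT) => i _; exact: iD.
  by apply: (@integrable_bounded _ _ _ _ _ `|z%:R|).
have mrel : measurable_fun setT (relative z).
  have -> : relative z = (fun w => (\sum_(i < z) D i w - z%:R) / z%:R +
    Y0 w * expR (- ell (Q 0%N w)) / z%:R) by apply/funext => w; exact: relE.
  apply: measurable_funD.
    by apply: measurable_funM => //; apply: measurable_funB => //; exact: measurable_sum.
  by apply: measurable_funM => //; apply: measurable_funM => //; exact: mnat.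
have bound w : `|relative z w| <=
    z%:R^-1 * `|\sum_(i < z) D i w - z%:R| + z%:R^-1 * (expR b * Y0 w).
  rewrite relE (le_trans (ler_normD _ _))// lerD//.
    by rewrite normrM mulrC (@ger0_norm _ z%:R^-1)// invr_ge0.
  rewrite ger0_norm; last by rewrite divr_ge0// mulr_ge0// expR_ge0.
  rewrite mulrC ler_wpM2l ?invr_ge0// mulrC ler_wpM2r// ler_expR.
  by rewrite lerNl.
have ibound : P.-integrable setT (EFin \o (fun w =>
    z%:R^-1 * `|\sum_(i < z) D i w - z%:R| + z%:R^-1 * (expR b * Y0 w))).
  exact: (integrableD measurableT (integrableZl measurableT z%:R^-1 isz)
    (integrableZl measurableT z%:R^-1 iYb)).
have irel : P.-integrable setT (EFin \o (fun w => `|relative z w|)).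
  apply: le_integrable ibound => //.
    by apply/measurable_EFinP; exact: measurableT_comp.
  by move=> w _; rewrite /= lee_fin normr_id (le_trans (bound w))// ler_norm.
split => //.
apply: (le_trans (Rintegral_le irel ibound bound)).
rewrite RintegralD//; last 2 first.
- exact: (integrableZl measurableT z%:R^-1 isz).
- exact: (integrableZl measurableT z%:R^-1 iYb).
rewrite RintegralZl// RintegralZl// RintegralZl//.
(* truncation at [z ^ (1 / 4)] with [lam = z ^ (3 / 4)] *)
have := @one_step_truncated (expR (L / 4)) (expR_gt0 _) z (expR (3 * L / 4)) z0 (expR_gt0 _).
rewrite -expRM -/Mp => h1.
set I := \int[P]_w `|_| in h1 *; set e := expR (- _).
have E1 : expR (L / 4 * (1 - p)) = e by rewrite /e; congr expR; field.
have E2 : z%:R^-1 * (z%:R * expR (L / 4) ^+ 2 / expR (3 * L / 4)) = expR (- (L / 4)).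
  rewrite mulrA mulKf; last by rewrite gt_eqF// ltr0n.
  by rewrite -expRM_natl -expRN -expRD; congr expR; field.
have E3 : z%:R^-1 * expR (3 * L / 4) = expR (- (L / 4)).
  by rewrite zE -expRN -expRD; congr expR; field.
(* From [p <= 2] the exponent [(p - 1) / 4] is at most [1 / 4], so the variance term, of order
   [z ^ (- 1 / 4)], and the immigration term, of order [1 / z], are dominated by the truncation
   error. *)
have e4 : expR (- (L / 4)) <= e by rewrite ler_expR lerN2; nra.
have e1 : z%:R^-1 <= e by rewrite zE -expRN ler_expR lerN2; nra.
have I0 : z%:R^-1 * I <= 2 * Mp * e + e.
  have zi : 0 <= z%:R^-1 :> R by rewrite invr_ge0.
  apply: le_trans (ler_wpM2l zi h1) _; rewrite E1.
  have -> : z%:R^-1 * (2 * z%:R * (e * Mp) +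
     (z%:R * expR (L / 4) ^+ 2 / expR (3 * L / 4) + expR (3 * L / 4)) / 2) =
     2 * Mp * e + (z%:R^-1 * (z%:R * expR (L / 4) ^+ 2 / expR (3 * L / 4)) + z%:R^-1 * expR (3 * L / 4)) / 2.
    by field; rewrite !gt_eqF ?expR_gt0// ltr0n.
  by rewrite E2 E3; lra.
have J0 : z%:R^-1 * (expR b * \int[P]_w Y0 w) <= (expR b * \int[P]_w Y0 w) * e.
  by rewrite mulrC ler_wpM2l// mulr_ge0 ?expR_ge0//; apply: Rintegral_ge0.
by move: I0 J0; lra.
Qed.

End one_step_law_of_large_numbers.

(** * Lyapunov function *)

Section lyapunov.
Context d (T : measurableType d) (R : realType) (P : probability T R).
Variables (xi : nat -> T -> nat) (X : T -> R) (s C0 b : R).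
Hypothesis mxi : forall z x, measurable (xi z @^-1` [set x]).
Hypotheses (mX : measurable_fun setT X) (Xb : forall w, - b <= X w).
Hypotheses (s0 : 0 < s) (C0_ge0 : 0 <= C0).
Hypothesis rho1 : \int[P]_w expR (- s * X w) < 1.

(** This is [z ^ (- s)], with value 1 at [z = 0] because [ln 0 = 0]: an empty generation carries the
    full weight. *)
Definition log_weight (z : nat) : R := expR (- s * ln z%:R).
Let V := log_weight.

Let rel z w : R := (xi z w)%:R * expR (- X w) / z%:R - 1.
Hypothesis irel : forall z, (0 < z)%N -> P.-integrable setT (EFin \o (fun w => `|rel z w|)).
Hypothesis hrel : forall z, (0 < z)%N -> \int[P]_w `|rel z w| <= C0 * V z ^+ 2.
Hypothesis escape : forall z, (0 < P [set w | (z < xi z w)%N])%E.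

Let op (g : nat -> R) z : R := \int[P]_w g (xi z w).

Lemma ln_nat_ge0 (n : nat) : 0 <= ln (n%:R : R).
Proof. by case: n => [|n]; [rewrite ln0|rewrite ln_ge0// ler1n]. Qed.

Lemma log_weight_gt0 z : 0 < V z. Proof. exact: expR_gt0. Qed.

Lemma log_weight_le1 z : V z <= 1.
Proof. by rewrite expR_le1 mulNr oppr_le0 mulr_ge0 ?ln_nat_ge0// ltW. Qed.

Lemma log_weight_nonincreasing z z' : (z <= z')%N -> V z' <= V z.
Proof.
move=> zz'; rewrite ler_expR !mulNr lerN2 ler_pM2l//.
case: z zz' => [_|z zz']; first by rewrite ln0// ln_nat_ge0.
by rewrite ler_ln ?posrE ?ltr0n// ?ler_nat//; exact: leq_trans zz'.
Qed.

Lemma log_weight_small (e : R) : 0 < e -> exists z : nat, (0 < z)%N /\ V z <= e.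
Proof.
(* [x] solves [x ^ (- s) = e]. *)
move=> e0; pose x := expR (- ln e / s).
exists (Num.truncn x).+1; split => //.
have xz : x <= (Num.truncn x).+1%:R by rewrite ltW// truncnS_gt.
rewrite /V /log_weight -[leRHS]lnK ?posrE// ler_expR mulNr lerNl.
rewrite mulrC -ler_pdivrMr// -[leLHS]expRK ler_ln// posrE ?expR_gt0//.
Qed.

Let mcomp (g : nat -> R) z : measurable_fun setT (fun w => g (xi z w)).
Proof. exact: measurable_nat_comp. Qed.

Let icomp (g : nat -> R) (K : R) z : (forall x, `|g x| <= K) ->
  P.-integrable setT (EFin \o (fun w => g (xi z w))).
Proof. by move=> gK; apply: (@integrable_bounded _ _ _ _ _ K). Qed.

(** If [xi z] is at least [expR (- beta)] times its prediction [z * expR X], the weight is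
    multiplied by at most [expR (s * beta) * expR (- s * X)]. Otherwise [|rel|] exceeds [a], and the
    bound [V <= 1] is paid for by [|rel| / a], whose mean is of order [V z ^ 2]. *)
Lemma log_weight_contraction : exists r C1 : R, [/\ 0 < r < 1, 0 <= C1 &
  forall z, (0 < z)%N -> op V z <= (r + C1 * V z) * V z].
Proof.
have s0' := s0.
have rho1' := rho1; move: rho1'; set rho := \int[P]_w _ => rho1'.
have [r0 r01 rhor] : exists2 r0, 0 < r0 < 1 & rho <= r0.
  exists (Num.max rho 2^-1); last by rewrite le_max lexx.
  by rewrite lt_max gt_max rho1' invr_gt0 ltr0n orbT /= invf_lt1 ?ltr1n.
have /andP[r00 r0lt1] := r01.
(* With this value [expR (s * beta) = r0 ^ (- 1 / 2)], so the loss uses half of the logarithmic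
   margin and leaves the factor [r], the square root of [r0]. *)
pose beta := - ln r0 / (2 * s).
have beta0 : 0 < beta by rewrite divr_gt0 ?mulr_gt0// oppr_gt0 ln_lt0.
pose a := 1 - expR (- beta).
have a0 : 0 < a by rewrite subr_gt0 expR_lt1 oppr_lt0.
pose r := expR (ln r0 / 2).
have rE : expR (s * beta) * rho <= r.
  apply: (@le_trans _ _ (expR (s * beta) * r0)); first by rewrite ler_wpM2l ?expR_ge0.
  rewrite -[X in _ * X]lnK ?posrE// -expRD ler_expR /beta.
  have -> : s * (- ln r0 / (2 * s)) = - ln r0 / 2 by field; rewrite gt_eqF.
  by lra.
exists r, (C0 / a); split.
- rewrite expR_gt0/= expR_lt1.
  have lr : ln r0 < 0 by exact: ln_lt0.
  by lra.
- by rewrite divr_ge0// ltW.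
move=> z z0.
have zpos : 0 < z%:R :> R by rewrite ltr0n.
have bound w : V (xi z w) <= expR (s * beta) * V z * expR (- s * X w) + a^-1 * `|rel z w|.
  have [h|h] := leP (expR (- beta)) (rel z w + 1).
    have xpos : 0 < (xi z w)%:R :> R.
      rewrite lt_neqAle ler0n andbT eq_sym; apply/eqP => x0.
      by move: h; rewrite /rel x0 !mul0r subrK leNgt expR_gt0.
    apply: (@le_trans _ _ (expR (s * beta) * V z * expR (- s * X w))); last first.
      by rewrite lerDl mulr_ge0// invr_ge0 ltW.
    rewrite /V /log_weight -!expRD ler_expR.
    have : ln z%:R + X w - beta <= ln (xi z w)%:R.
      rewrite -ler_expR lnK ?posrE// 2!expRD lnK ?posrE//.
      move: h; rewrite /rel subrK ler_pdivlMr// => h.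
      have := ler_wpM2r (expR_ge0 (X w)) h.
      rewrite -[in X in _ <= X -> _]mulrA -expRD addNr expR0 mulr1; apply: le_trans.
      by rewrite le_eqVlt; apply/orP; left; apply/eqP; ring.
    by move=> h2; nra.
  apply: (@le_trans _ _ 1); first exact: log_weight_le1.
  apply: (@le_trans _ _ (a^-1 * `|rel z w|)); last first.
    by rewrite lerDr !mulr_ge0 ?expR_ge0.
  rewrite mulrC ler_pdivlMr// mul1r -normrN (le_trans _ (ler_norm _))// /a; lra.
have iE : P.-integrable setT (EFin \o (fun w => expR (- s * X w))).
  apply: (@integrable_bounded _ _ _ _ _ (expR (s * b))); first exact: measurable_expRM.
  by move=> w; apply: expRM_bounded => //; exact: ltW.
have i1 := integrableZl measurableT (expR (s * beta) * V z) iE.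
have i2 := integrableZl measurableT a^-1 (irel z0).
apply: (@le_trans _ _ (\int[P]_w (expR (s * beta) * V z * expR (- s * X w) + a^-1 * `|rel z w|))).
  apply: Rintegral_le bound; last exact: (integrableD measurableT i1 i2).
  apply: (icomp (K := 1)) => x; rewrite gtr0_norm ?log_weight_gt0//; exact: log_weight_le1.
rewrite RintegralD// RintegralZl// (RintegralZl _ measurableT (irel z0)) mulrDl.
apply: lerD.
  by rewrite -/rho mulrAC ler_wpM2r// ltW// log_weight_gt0.
have := hrel z0 => /(ler_wpM2l (_ : 0 <= a^-1)); rewrite invr_ge0 (ltW a0) => /(_ isT)/le_trans; apply.
by rewrite le_eqVlt; apply/orP; left; apply/eqP; rewrite expr2; ring.
Qed.

Let escape_min z1 : exists2 q : R, 0 < q <= 1 &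
  forall z, (z < z1)%N -> q <= \int[P]_w \1_[set w | (z < xi z w)%N] w.
Proof.
have mE z : measurable [set w | (z < xi z w)%N].
  rewrite (_ : [set w | _] = \bigcup_(x in [set x | (z < x)%N]) xi z @^-1` [set x]).
    exact: bigcup_measurable.
  by apply/seteqP; split => w /=; [move=> h; exists (xi z w)|move=> [x /= h ->]].
have E z : (\int[P]_w \1_[set w | (z < xi z w)%N] w)%:E = P [set w | (z < xi z w)%N].
  rewrite EFin_Rintegral; first by rewrite integral_indic// setIT.
  apply: (@integrable_bounded _ _ _ _ _ 1); first exact: measurable_indic.
  by move=> w; rewrite indicE; case: (_ \in _); rewrite ?normr1 ?normr0.
elim: z1 => [|z1 [q /andP[q0 q1] hq]]; first by exists 1; rewrite ?ltr01 ?lexx.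
exists (Num.min q (\int[P]_w \1_[set w | (z1 < xi z1 w)%N] w)).
  rewrite lt_min q0 ge_min q1 /= andbT -lte_fin E; exact: escape.
move=> z; rewrite ltnS leq_eqVlt => /predU1P[->|/hq h]; first by rewrite ge_min lexx orbT.
by rewrite ge_min h.
Qed.

(* Beyond some [z1] the weight [V] has a negative drift. Below [z1] the drift comes
   from the correction [B], which decreases when the process moves up, and so
   steeply that the positive escape probability compensates all other moves. *)
Lemma lyapunov_function : exists (v : nat -> R) (c : R), [/\ 0 < c,
  forall z, 0 <= v z <= 2 & forall z, op v z <= v z - c * V z].
Proof.
have [r [C1 [/andP[r0 r1] C10 contr]]] := log_weight_contraction.
pose r' := (1 + r) / 2; have r'1 : r' < 1 by rewrite /r'; lra.
have r'0 : 0 < r' by rewrite /r'; lra.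
have [z1 [z10 hz1]] : exists z : nat, (0 < z)%N /\ V z <= (1 - r) / 2 / (C1 + 1).
  by apply: log_weight_small; rewrite !divr_gt0//; lra.
have contr' z : (z1 <= z)%N -> op V z <= r' * V z.
  move=> z1z; apply: le_trans (contr z (leq_trans z10 z1z)) _.
  rewrite ler_pM2r ?log_weight_gt0//.
  have h1 : V z <= (1 - r) / 2 / (C1 + 1) by exact: le_trans (log_weight_nonincreasing z1z) hz1.
  have : (C1 + 1) * V z <= (1 - r) / 2 by rewrite mulrC -ler_pdivlMr//; lra.
  by have := log_weight_gt0 z; rewrite /r'; lra.
have [q /andP[q0 q1] hq] := escape_min z1.
(* Small enough that a fall from above [z1] to a state [x < z1] raises [B] by at most
   [(1 - r') / 2 * V x], within the margin left by the contraction. *)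
pose kap := V z1 * (1 - r') / 2.
have V10 := log_weight_gt0 z1.
have kap0 : 0 < kap by rewrite /kap !mulr_gt0// ?subr_gt0// invr_gt0.
have kap1 : kap <= 1.
  have := log_weight_le1 z1; rewrite /kap; move: V10 r'0 r'1 => V10 r'0 r'1 V11; nra.
(* The subtraction is truncated, so [D] is 1 and [B] is 0 from [z1] on. Below [z1], the relation
   [q * D z.+1 = 2 * D z] lets an upward move, of probability at least [q], bring the mean of [B]
   down to [kap - 2 * kap * D z = B z - kap * D z], whatever the other moves do. *)
pose D z := (q / 2) ^+ (z1 - z).
have q20 : 0 < q / 2 by rewrite divr_gt0.
have D0 z : 0 < D z by rewrite exprn_gt0.
have D1 z : D z <= 1 by rewrite exprn_ile1// ?ltW//; lra.
have Dle x y : (x <= y)%N -> D x <= D y.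
  move=> xy; rewrite /D; apply: ler_wiXn2l; [exact: ltW|lra|exact: leq_sub2l].
have DS z : (z < z1)%N -> q * D z.+1 = 2 * D z.
  by move=> zz1; rewrite /D -[in RHS](subnSK zz1) exprS; field.
pose B z := kap * (1 - D z).
have Bge0 z : 0 <= B z by rewrite mulr_ge0 ?subr_ge0// ltW.
have Bbig z : (z1 <= z)%N -> B z = 0.
  by move=> z1z; rewrite /B /D (eqP z1z) expr0 subrr mulr0.
have Ble z : B z <= kap by rewrite ler_piMr ?(ltW kap0)// gerBl ltW.
(* Capped at [V z1], the weight is maximal at every state below [z1] and cannot increase from
   there. *)
pose m z := Num.min (V z) (V z1).
exists (fun z => m z + B z), (Num.min ((1 - r') / 2) (kap * D 0)).
have mge0 z : 0 <= m z by rewrite le_min !ltW// log_weight_gt0.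
have mle z : m z <= V z1 by rewrite ge_min lexx orbT.
split.
- rewrite lt_min; apply/andP; split; [by rewrite divr_gt0// subr_gt0|exact: mulr_gt0].
- move=> z; rewrite addr_ge0//=.
  have := Ble z; have := mle z; have := log_weight_le1 z1; lra.
move=> z.
have im : P.-integrable setT (EFin \o (fun w => m (xi z w))).
  apply: (icomp (K := V z1)) => x; rewrite ger0_norm//; exact: mle.
have iB : P.-integrable setT (EFin \o (fun w => B (xi z w))).
  by apply: (icomp (K := kap)) => x; rewrite ger0_norm.
rewrite /op RintegralD//.
have iV : P.-integrable setT (EFin \o (fun w => V (xi z w))).
  apply: (icomp (K := 1)) => x; rewrite gtr0_norm ?log_weight_gt0//; exact: log_weight_le1.
have [z1z|zz1] := leqP z1 z.
  have mz : m z = V z by apply/min_idPl; exact: log_weight_nonincreasing.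
  rewrite Bbig// addr0 mz.
  have h1 : \int[P]_w m (xi z w) <= r' * V z.
    apply: le_trans (contr' z z1z); apply: Rintegral_le => // w.
    by rewrite ge_min lexx.
  have h2 : \int[P]_w B (xi z w) <= (1 - r') / 2 * V z.
    apply: (@le_trans _ _ (\int[P]_w (((1 - r') / 2) * V (xi z w)))).
      apply: Rintegral_le => //.
        exact: (integrableZl measurableT ((1 - r') / 2) iV).
      move=> w; have [xz|xz] := leqP z1 (xi z w).
        by rewrite Bbig// mulr_ge0 ?(ltW (log_weight_gt0 _))// divr_ge0// subr_ge0 ltW.
      apply: le_trans (Ble _) _; rewrite /kap -mulrA mulrC ler_wpM2l//.
        by rewrite divr_ge0// subr_ge0 ltW.
      exact: log_weight_nonincreasing (ltnW xz).
    rewrite RintegralZl// ler_wpM2l//; first by rewrite divr_ge0// subr_ge0 ltW.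
    by apply: le_trans (contr' z z1z) _; rewrite ler_piMl ?(ltW (log_weight_gt0 _))// ltW.
  have h3 : Num.min ((1 - r') / 2) (kap * D 0) * V z <= (1 - r') / 2 * V z.
    by rewrite ler_wpM2r ?ge_min ?lexx// ltW// log_weight_gt0.
  by lra.
have mz : m z = V z1 by apply/min_idPr; exact: log_weight_nonincreasing (ltnW zz1).
have mE : measurable [set w | (z < xi z w)%N].
  rewrite (_ : [set w | _] = \bigcup_(x in [set x | (z < x)%N]) xi z @^-1` [set x]).
    exact: bigcup_measurable.
  by apply/seteqP; split => w /=; [move=> h; exists (xi z w)|move=> [x /= h ->]].
have i1 : P.-integrable setT (EFin \o (\1_[set w | (z < xi z w)%N] : T -> R)).
  apply: (@integrable_bounded _ _ _ _ _ 1); first exact: measurable_indic.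
  by move=> w; rewrite indicE; case: (_ \in _); rewrite ?normr1 ?normr0.
have icst (a : R) : P.-integrable setT (EFin \o (fun w => a)).
  by apply: (@integrable_bounded _ _ _ _ _ `|a|).
have h1 : \int[P]_w m (xi z w) <= V z1.
  by rewrite -[leRHS](Rintegral_probability_cst P); apply: Rintegral_le.
have h2 : \int[P]_w B (xi z w) <= kap - 2 * kap * D z.
  apply: (@le_trans _ _ (\int[P]_w (kap - kap * D z.+1 * \1_[set w | (z < xi z w)%N] w))).
    have i2 := integrableZl measurableT (kap * D z.+1) i1.
    apply: Rintegral_le => //; first exact: (integrableB measurableT (icst kap) i2).
    move=> w; rewrite indicE; have [|_] := boolP (w \in _); last by rewrite mulr0 subr0.
    rewrite inE /= mulr1 => zx; rewrite /B mulrBr mulr1 lerD2l lerN2 ler_pM2l//.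
    exact: Dle.
  rewrite RintegralB//; last exact: (integrableZl measurableT (kap * D z.+1) i1).
  rewrite Rintegral_probability_cst RintegralZl// lerD2l lerN2.
  have -> : 2 * kap * D z = kap * D z.+1 * q by rewrite -mulrA mulrCA -DS//; ring.
  by rewrite ler_wpM2l ?hq// mulr_ge0// ltW.
have h3 : Num.min ((1 - r') / 2) (kap * D 0) * V z <= kap * D z.
  apply: (@le_trans _ _ (kap * D 0)); last by rewrite ler_pM2l// Dle.
  apply: (@le_trans _ _ (Num.min ((1 - r') / 2) (kap * D 0))); last by rewrite ge_min lexx orbT.
  rewrite ler_piMr ?log_weight_le1// le_min; apply/andP; split.
    by rewrite divr_ge0// subr_ge0 ltW.
  by rewrite mulr_ge0// ltW.
by rewrite mz {2}/B; lra.
Qed.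

End lyapunov.

(** * Comparison with the random walk *)

Section smoothed_counts.
Context d (T : measurableType d) (R : realType) (P : probability T R).
Variable Q : nat -> {mfun T >-> environment R}.
Variables (N : nat -> nat -> {mfun T >-> nat}) (Y : nat -> {mfun T >-> nat}).
Hypotheses (hQ : iid P Q) (hNY : quenched_independent P Q N Y).
Variables (X : T -> R) (b s eps C0 : R) (k : nat).
Hypotheses (mX : measurable_fun setT X) (iX : P.-integrable setT (EFin \o X)).
Hypothesis Xb : forall w, - b <= X w.
Let rho := \int[P]_w expR (- s * X w).
Hypotheses (s0 : 0 < s) (rho1 : rho < 1) (eps0 : 0 < eps) (C0_ge0 : 0 <= C0).
Let mean := \int[P]_w X w.
Hypotheses (mean_gt0 : 0 < mean) (hlat : nonlattice P X).

Let xi z w := (\sum_(i < z) N 0%N i w + Y 0%N w)%N.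
Let V := @log_weight R s.
Let rel z w : R := (xi z w)%:R * expR (- X w) / z%:R - 1.
Hypothesis irel : forall z, (0 < z)%N -> P.-integrable setT (EFin \o (fun w => `|rel z w|)).
Hypothesis hrel : forall z, (0 < z)%N -> \int[P]_w `|rel z w| <= C0 * V z ^+ 2.
Hypothesis escape : forall z, (0 < P [set w | (z < xi z w)%N])%E.

Let Z := bpire N Y k.
Let op := step_operator P N Y.
Let M := renewal_function P X eps.
Let K := renewal_lipschitz P X s eps.

Let K0 : 0 < K. Proof. exact: renewal_lipschitz_gt0. Qed.

Let mxi z x : measurable (xi z @^-1` [set x]).
Proof. exact: measurable_step_event. Qed.

Let V0 z : 0 < V z. Proof. exact: log_weight_gt0. Qed.
Let V1 z : V z <= 1. Proof. exact: log_weight_le1. Qed.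

Let iZ (g : nat -> R) (B : R) n : (forall x, `|g x| <= B) ->
  P.-integrable setT (EFin \o (fun w => g (Z n w))).
Proof.
move=> gB; apply: (@integrable_bounded _ _ _ _ _ B) => //.
by apply: measurable_nat_comp => x; exact: measurable_bpire_fiber.
Qed.

Let ixi (g : nat -> R) (B : R) z : (forall x, `|g x| <= B) ->
  P.-integrable setT (EFin \o (fun w => g (xi z w))).
Proof.
by move=> gB; apply: (@integrable_bounded _ _ _ _ _ B) => //; exact: measurable_nat_comp.
Qed.

Let A n := \int[P]_w V (Z n w).

Let A_ge0 n : 0 <= A n.
Proof. by apply: Rintegral_ge0 => w _; exact: ltW. Qed.

(** The Lyapunov function loses at least [c * A n] in mean at step [n] and stays between 0 and 2, so
    the partial sums are at most [2 / c]. *)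
Lemma log_weight_summable : cvgn (series A).
Proof.
have [v [c [c0 v02 vop]]] := lyapunov_function mxi mX Xb s0 C0_ge0 rho1 irel hrel escape.
have vB x : `|v x| <= 2 by have /andP[? ?] := v02 x; rewrite ger0_norm.
have decr n : c * A n <= \int[P]_w v (Z n w) - \int[P]_w v (Z n.+1 w).
  rewrite (bpire_step_operator hQ hNY k n v02) -RintegralB//; [|exact: iZ vB|].
    rewrite /A -RintegralZl//; last first.
      by apply: (iZ (B := 1)) => x; rewrite gtr0_norm.
    apply: Rintegral_le => [||w]; last by rewrite lerBrDr addrC -lerBrDr; exact: vop.
    - by apply: (iZ (g := fun z => c * V z) (B := c)) => x; rewrite gtr0_norm ?mulr_gt0// ler_piMr// ltW.
    - apply: (iZ (g := fun z => v z - step_operator P N Y v z) (B := 4)) => x.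
      have /andP[a1 a2] := v02 x.
      have b1 : 0 <= step_operator P N Y v x by apply: Rintegral_ge0 => w _; have /andP[] := v02 (xi x w).
      have b2 : step_operator P N Y v x <= 2.
        rewrite -[leRHS](Rintegral_probability_cst P); apply: Rintegral_le.
        + exact: ixi vB.
        + by apply: (@integrable_bounded _ _ _ _ _ 2) => // w; rewrite ger0_norm.
        + by move=> w; have /andP[] := v02 (xi x w).
      by rewrite ler_norml; apply/andP; split; lra.
  apply: (iZ (B := 2)) => x; rewrite ger0_norm.
    rewrite -[leRHS](Rintegral_probability_cst P); apply: Rintegral_le.
    + exact: ixi vB.
    + by apply: (@integrable_bounded _ _ _ _ _ 2) => // w; rewrite ger0_norm.
    + by move=> w; have /andP[] := v02 (xi x w).
  by apply: Rintegral_ge0 => w _; have /andP[] := v02 (xi x w).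
have vE n : 0 <= \int[P]_w v (Z n w) <= 2.
  apply/andP; split; first by apply: Rintegral_ge0 => w _; have /andP[] := v02 (Z n w).
  rewrite -[leRHS](Rintegral_probability_cst P); apply: Rintegral_le.
  - exact: iZ vB.
  - by apply: (@integrable_bounded _ _ _ _ _ 2) => // w; rewrite ger0_norm.
  - by move=> w; have /andP[] := v02 (Z n w).
apply: nondecreasing_is_cvgn.
  by apply/nondecreasing_seqP => n; rewrite /series/= big_nat_recr//= lerDl.
exists (2 / c) => _ [n _ <-]; rewrite ler_pdivlMr// mulrC.
have : c * series A n <= \int[P]_w v (Z 0%N w) - \int[P]_w v (Z n w).
  rewrite /series/=; elim: n => [|n IH]; first by rewrite big_geq// mulr0 subrr.
  by rewrite big_nat_recr//= mulrDr; have := decr n; move: IH; lra.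
by have /andP[? ?] := vE 0%N; have /andP[? ?] := vE n; lra.
Qed.

Variable a : R.
Hypothesis a0 : 0 <= a.

(** At [x = y - L], for [eps <= a], this is a trapezoid in [L]: equal to 1 on [[y, y + a - eps]] and
    to 0 outside [[y - eps, y + a]]. *)
Definition ramp_window (x : R) := ramp eps (x + a) - ramp eps x.
Let phi := ramp_window.
Let u x := M (x + a) - M x.

Lemma ramp_window_bounds x : 0 <= phi x <= 1.
Proof.
rewrite subr_ge0 ramp_nondecreasing//; last by rewrite lerDl.
by rewrite /phi /ramp_window; have := ramp_le1 eps (x + a); have := ramp_ge0 eps x; lra.
Qed.

Let Mnd : nondecreasing_fun M.
Proof. exact: (renewal_function_nondecreasing mX Xb s0 rho1 eps0). Qed.

Let u_bounds x : 0 <= u x <= K * a.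
Proof.
rewrite subr_ge0 Mnd ?lerDl//=.
exact: (renewal_increment mX Xb s0 rho1 eps0).
Qed.

Let uL x y : `|u x - u y| <= 2 * K * `|x - y|.
Proof.
have -> : u x - u y = (M (x + a) - M (y + a)) - (M x - M y) by rewrite /u; ring.
rewrite (le_trans (ler_normB _ _))// -mulrA mulr_natl mulr2n.
apply: lerD; last exact: (renewal_function_lipschitz mX Xb s0 rho1 eps0).
apply: le_trans (renewal_function_lipschitz mX Xb s0 rho1 eps0 _ _) _.
by rewrite opprD addrACA subrr addr0.
Qed.

Let mM y : measurable_fun setT (fun w => M (y - X w)).
Proof. exact: measurable_nondecreasing_shift. Qed.

Let mu y : measurable_fun setT (fun w => u (y - X w)).
Proof.
rewrite (_ : (fun w => _) = (fun w => M (y + a - X w) - M (y - X w))).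
  exact: measurable_funB.
by apply/funext => w; rewrite /u addrAC.
Qed.

Let iu y : P.-integrable setT (EFin \o (fun w => u (y - X w))).
Proof.
apply: (@integrable_bounded _ _ _ _ _ (K * a)) => // w.
by have /andP[? ?] := u_bounds (y - X w); rewrite ger0_norm.
Qed.

Let iM y : P.-integrable setT (EFin \o (fun w => M (y - X w))).
Proof.
apply: (@integrable_shift _ _ _ _ _ _ _ mX Xb s0 M y (1 - rho)^-1) => //.
exact: (renewal_function_bounds mX Xb s0 rho1 eps0).
Qed.

Let u_renewal y : u y = phi y + \int[P]_w u (y - X w).
Proof.
rewrite /u /M !(renewal_equation mX Xb s0 rho1 eps0) opprD addrACA -RintegralB//.
by congr (_ + _); apply: eq_Rintegral => w _; rewrite addrAC.
Qed.

(* [W y] solves W = phi(y - ln .) + op W + err, hence along the process the smoothed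
   counts telescope up to errors dominated by the summable sequence [A]. *)
Let W y (z : nat) : R := u (y - ln z%:R).
Let err y z : R := \int[P]_w u (y - ln z%:R - X w) - op (W y) z.

Let W_bounds y z : 0 <= W y z <= K * a. Proof. exact: u_bounds. Qed.

Let W_norm y z : `|W y z| <= K * a.
Proof. by have /andP[? ?] := W_bounds y z; rewrite ger0_norm. Qed.

Let errE y z : err y z = \int[P]_w (u (y - ln z%:R - X w) - W y (xi z w)).
Proof. by rewrite RintegralB//; exact: ixi (W_norm y). Qed.

Let W_decomposition y z : W y z = phi (y - ln z%:R) + op (W y) z + err y z.
Proof. by rewrite {1}/W u_renewal /err; ring. Qed.

Let Ka0 : 0 <= K * a. Proof. by rewrite mulr_ge0// ltW. Qed.

Let c0 : 0 <= 4 * K + 2 * (K * a).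
Proof. by apply: addr_ge0; apply: mulr_ge0 => //; exact: ltW. Qed.

(** [X] and [xi z] come from the same environment, and the two arguments of [u] differ exactly by
    [ln (1 + rel)]. If [1 + rel >= 1 / 2], this is at most [2 |rel|] and [u] is Lipschitz; otherwise
    [|rel| >= 1 / 2] and the bound [K * a] on [u] suffices. *)
Let err_pointwise y z w : (0 < z)%N ->
  `|u (y - ln z%:R - X w) - W y (xi z w)| <= (4 * K + 2 * (K * a)) * `|rel z w|.
Proof.
move=> z0; have Ka0' := Ka0.
have zpos : 0 < z%:R :> R by rewrite ltr0n.
have [h|h] := leP 2^-1 (rel z w + 1).
  have xpos : 0 < (xi z w)%:R :> R.
    rewrite lt_neqAle ler0n andbT eq_sym; apply/eqP => x0.
    by move: h; rewrite /rel x0 !mul0r subrK leNgt invr_gt0 ltr0n.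
  apply: (@le_trans _ _ (4 * K * `|rel z w|)); last first.
    by rewrite ler_wpM2r// lerDl; exact: mulr_ge0.
  apply: le_trans (uL _ _) _.
  have -> : y - ln z%:R - X w - (y - ln (xi z w)%:R) = ln (rel z w + 1).
    rewrite /rel subrK ln_div ?posrE ?mulr_gt0 ?expR_gt0// lnM ?posrE ?expR_gt0// expRK.
    by ring.
  have -> : 4 * K * `|rel z w| = 2 * K * (2 * `|rel z w|) by ring.
  apply: ler_wpM2l; first by apply: mulr_ge0 => //; exact: ltW.
  move: (rel z w) h => r h; have r1 : 0 < r + 1 by lra.
  rewrite ler_norml; apply/andP; split.
    rewrite lerNl -lnV ?posrE//.
    have -> : (r + 1)^-1 = 1 + (- r / (r + 1)) by field; rewrite gt_eqF.
    apply: le_trans (le_ln1Dx _) _.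
      by rewrite ltr_pdivlMr//; lra.
    rewrite ler_pdivrMr//; have := ler_norm (- r); rewrite normrN; have := normr_ge0 r; nra.
  rewrite addrC; apply: le_trans (le_ln1Dx _) _; first by lra.
  by have := ler_norm r; have := normr_ge0 r; lra.
apply: (@le_trans _ _ (K * a)).
  have /andP[? ?] := u_bounds (y - ln z%:R - X w); have /andP[? ?] := W_bounds y (xi z w).
  by rewrite ler_norml; apply/andP; split; lra.
have r2 : 2^-1 <= `|rel z w| by rewrite -normrN (le_trans _ (ler_norm _))//; lra.
by have := K0; nra.
Qed.

(** The first summand serves [z > 0]; the second serves [z = 0], where [V] is 1 and [rel] gives no
    information. *)
Let Ce := (4 * K + 2 * (K * a)) * C0 + 2 * (K * a).

Let Ce_ge0 : 0 <= Ce.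
Proof.
by apply: addr_ge0; apply: mulr_ge0.
Qed.

Let iW y z : P.-integrable setT (EFin \o (fun w => u (y - ln z%:R - X w) - W y (xi z w))).
Proof. exact: (integrableB measurableT (iu _) (ixi z (W_norm y))). Qed.

Let err_le y z : `|err y z| <= Ce * V z.
Proof.
rewrite errE (le_trans (le_normr_Rintegral _ _))//.
have iN : P.-integrable setT (EFin \o (fun w => `|u (y - ln z%:R - X w) - W y (xi z w)|)).
  exact: (integrable_norm (iW y z)).
have [z0|] := ltnP 0 z.
  apply: (@le_trans _ _ (\int[P]_w ((4 * K + 2 * (K * a)) * `|rel z w|))).
    apply: Rintegral_le => //; first exact: (integrableZl measurableT _ (irel z0)).
    by move=> w; exact: err_pointwise.
  rewrite (RintegralZl _ measurableT (irel z0)).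
  apply: le_trans (ler_wpM2l c0 (hrel z0)) _.
  rewrite /Ce [leRHS]mulrDl [leLHS]mulrA; apply: (@le_trans _ _ ((4 * K + 2 * (K * a)) * C0 * V z)).
    apply: ler_wpM2l; first exact: mulr_ge0.
    by rewrite expr2 ler_piMr// ltW.
  rewrite lerDl; apply: mulr_ge0; last exact: ltW.
  exact: mulr_ge0.
rewrite leqn0 => /eqP z0; have -> : V z = 1 by rewrite /V /log_weight z0 ln0// mulr0 expR0.
rewrite mulr1; apply: (@le_trans _ _ (2 * (K * a))); last first.
  by rewrite lerDr; exact: mulr_ge0.
rewrite -[leRHS](Rintegral_probability_cst P); apply: Rintegral_le => //.
  by apply: (@integrable_bounded _ _ _ _ _ `|2 * (K * a)|).
move=> w; have /andP[? ?] := u_bounds (y - ln z%:R - X w); have /andP[? ?] := W_bounds y (xi z w).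
by rewrite ler_norml; apply/andP; split; lra.
Qed.

Let u_limit c : u (y - c) @[y --> +oo] --> a / mean.
Proof.
have h1 : y - c @[y --> +oo] --> +oo := cvg_addrr (- c).
have h2 : u y @[y --> +oo] --> a / mean.
  exact: (renewal_theorem mX iX Xb s0 rho1 eps0 mean_gt0 hlat).
exact: cvg_comp h1 h2.
Qed.

Let W_limit z : W y z @[y --> +oo] --> a / mean.
Proof. exact: u_limit. Qed.

(** For a fixed state both [u (y - ln z - X)] and [W y (xi z)] tend to [a / mean] by Blackwell's
    theorem, so their difference vanishes by dominated convergence. *)
Let err_limit z : err y z @[y --> +oo] --> 0.
Proof.
rewrite (_ : err ^~ z = (fun y => \int[P]_w (u (y - ln z%:R - X w) - W y (xi z w)))); last first.
  by apply/funext => y; rewrite errE.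
rewrite -[X in _ --> X](Rintegral_probability_cst P).
apply: (@Rintegral_dominated_cvg_pinfty _ _ _ _ _ _ (fun=> 2 * (K * a))).
- by move=> y; apply: measurable_funB => //; apply: measurable_nat_comp.
- by apply: (@integrable_bounded _ _ _ _ _ `|2 * (K * a)|).
- move=> y w; have Ka0' := Ka0.
  have /andP[? ?] := u_bounds (y - ln z%:R - X w); have /andP[? ?] := W_bounds y (xi z w).
  by rewrite ler_norml; apply/andP; split; lra.
- move=> w; rewrite -[X in _ --> X](subrr (a / mean)); apply: cvgB; last exact: W_limit.
  rewrite (_ : (fun y => _) = (fun y => u (y - (ln z%:R + X w)))); first exact: u_limit.
  by apply/funext => y; rewrite opprD addrA.
Qed.

Let window y n := \int[P]_w phi (y - ln (Z n w)%:R).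

Let window_telescope y n :
  window y n = \int[P]_w W y (Z n w) - \int[P]_w W y (Z n.+1 w) - \int[P]_w err y (Z n w).
Proof.
rewrite (bpire_step_operator hQ hNY k n (W_bounds y)).
have err_bd x : `|err y x| <= Ce.
  by rewrite (le_trans (err_le y x))// ler_piMr.
have op_bd x : `|op (W y) x| <= K * a.
  rewrite ger0_norm; last by apply: Rintegral_ge0 => w _; have /andP[] := W_bounds y (xi x w).
  rewrite -[leRHS](Rintegral_probability_cst P); apply: Rintegral_le.
  - exact: ixi (W_norm y).
  - by apply: (@integrable_bounded _ _ _ _ _ `|K * a|).
  - by move=> w; have /andP[] := W_bounds y (xi x w).
have i1 := iZ n (W_norm y); have i2 := iZ n op_bd; have i3 := iZ n err_bd.
have i12 := integrableB measurableT i1 i2.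
rewrite -RintegralB// -RintegralB//.
by apply: eq_Rintegral => w _; rewrite (W_decomposition y (Z n w)) -/Z -/op; ring.
Qed.

Let window_ge0 y n : 0 <= window y n.
Proof.
by apply: Rintegral_ge0 => w _; have /andP[] := ramp_window_bounds (y - ln (Z n w)%:R).
Qed.

Let window_sum y m : \sum_(0 <= n < m) window y n =
  W y k - \int[P]_w W y (Z m w) - \sum_(0 <= n < m) \int[P]_w err y (Z n w).
Proof.
elim: m => [|m IH].
  have -> : \int[P]_w W y (Z 0%N w) = W y k by exact: (Rintegral_probability_cst P (W y k)).
  by rewrite !big_geq// subr0 subrr.
rewrite !big_nat_recr//= IH window_telescope.
move: (\int[P]_w W y (Z m.+1 w)) (\int[P]_w W y (Z m w)) (\int[P]_w err y (Z m w))
  (\sum_(0 <= n < m) _) (W y k) => *; ring.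
Qed.

Let err_expectation_le y n : `|\int[P]_w err y (Z n w)| <= Ce * A n.
Proof.
have err_bd x : `|err y x| <= Ce.
  by rewrite (le_trans (err_le y x))// ler_piMr.
rewrite (le_trans (le_normr_Rintegral _ (iZ n err_bd)))//.
have iV : P.-integrable setT (EFin \o (fun w => V (Z n w))).
  by apply: (iZ (B := 1)) => x; rewrite gtr0_norm.
rewrite /A -RintegralZl//; apply: Rintegral_le.
- exact: integrable_norm (iZ n err_bd).
- exact: (integrableZl measurableT Ce iV).
- by move=> w; exact: err_le.
Qed.

Let err_expectation_limit n : \int[P]_w err y (Z n w) @[y --> +oo] --> 0.
Proof.
have err_bd y x : `|err y x| <= Ce.
  by rewrite (le_trans (err_le y x))// ler_piMr.
rewrite -[X in _ --> X](Rintegral_probability_cst P).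
apply: (@Rintegral_dominated_cvg_pinfty _ _ _ _ _ _ (fun=> Ce)) => //.
- by move=> y; apply: measurable_nat_comp => x; exact: measurable_bpire_fiber.
- by apply: (@integrable_bounded _ _ _ _ _ `|Ce|).
Qed.

(** This removes the boundary term of the telescoping sum at fixed [y]: the exponential bound on [M]
    turns [u (y - ln z)] into a multiple of [V z], and [A m] tends to 0. *)
Let W_far y m : \int[P]_w W y (Z m w) <= (1 - rho)^-1 * expR (s * (y + a)) * A m.
Proof.
have iV : P.-integrable setT (EFin \o (fun w => V (Z m w))).
  by apply: (iZ (B := 1)) => x; rewrite gtr0_norm.
rewrite /A -RintegralZl//; apply: Rintegral_le.
- exact: iZ (W_norm y).
- exact: (integrableZl measurableT _ iV).
- move=> w; rewrite /W /u; set L := ln _.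
  have /andP[M0 _] := renewal_function_bounds mX Xb s0 rho1 eps0 (y - L).
  have /andP[_ M1] := renewal_function_bounds mX Xb s0 rho1 eps0 (y - L + a).
  apply: (@le_trans _ _ (M (y - L + a))); first by rewrite gerBl.
  apply: (le_trans M1); rewrite -mulrA -expRD ler_wpM2l//.
    by rewrite invr_ge0 subr_ge0 ltW.
  by rewrite ler_expR le_eqVlt; apply/orP; left; apply/eqP; rewrite /L; ring.
Qed.

Lemma smoothed_count_limit :
  (\sum_(n <oo) (\int[P]_w ramp_window (y - ln (bpire N Y k n w)%:R))%:E)%E @[y --> +oo]
  --> (a / mean)%:E.
Proof.
have cA := log_weight_summable.
have A0 : A n @[n --> \oo] --> 0 by exact: cvg_series_cvg_0.
suff bounds (e : R) : 0 < e -> \forall y \near +oo,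
    ((a / mean - e)%:E <= \sum_(n <oo) (window y n)%:E <= (a / mean + e)%:E)%E.
  apply/fine_cvgP; split.
    have := bounds 1 ltr01; apply: filterS => y /andP[h1 h2].
    by rewrite fin_numElt (lt_le_trans _ h1) ?ltNyr// (le_lt_trans h2) ?ltry.
  apply/cvgrPdist_le => e e0; have := bounds e e0; apply: filterS => y /andP[h1 h2] /=.
  move: h1 h2; rewrite /window; case: (\sum_(n <oo) _)%E => [r| |]; rewrite ?leye_eq ?leeNy_eq//.
  rewrite !lee_fin /= => h1 h2; rewrite ler_norml; apply/andP; split; lra.
move=> e0.
have e4 : 0 < e / 4 by rewrite divr_gt0.
have Ce1 : 0 < Ce + 1 by rewrite ltr_wpDl.
(* Order of choices: [n0] by summability, uniformly in [y]; then [y], which settles [W y k] and the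
   finitely many errors before [n0]; then [m], depending on [y], for the boundary term. Each of the
   four parts costs [e / 4]. *)
have [n0 hn0] : exists n0, forall m, (n0 <= m)%N ->
    Ce * \sum_(n0 <= n < m) A n <= e / 4.
  have /cvgrPdist_le/(_ (e / 4 / (Ce + 1))) := cA.
  have ee : 0 < e / 4 / (Ce + 1) by rewrite divr_gt0.
  move=> /(_ ee)[n0 _ hn]; exists n0 => m n0m.
  have tail : \sum_(n0 <= n < m) A n <= e / 4 / (Ce + 1).
    have := hn n0 (leqnn n0).
    have sm : series A m <= limn (series A).
      apply: nondecreasing_cvgn_le => //.
      by apply/nondecreasing_seqP => n; rewrite /series/= big_nat_recr//= lerDl.
    rewrite /= ler_norml => /andP[_]; move: sm; rewrite /series/=.
    by rewrite (big_cat_nat (n := n0))//=; lra.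
  have s0' : 0 <= \sum_(n0 <= n < m) A n by apply: sumr_ge0.
  rewrite ler_pdivlMr// in tail; move: tail Ce_ge0; nra.
have cW := W_limit k.
have cF : \sum_(0 <= n < n0) \int[P]_w err y (Z n w) @[y --> +oo] --> 0.
  elim: (n0) => [|m IH].
    by apply: cvg_near_cst; apply: nearW => y; rewrite big_geq.
  have -> : (fun y => \sum_(0 <= n < m.+1) \int[P]_w err y (Z n w)) =
      (fun y => \sum_(0 <= n < m) \int[P]_w err y (Z n w) + \int[P]_w err y (Z m w)).
    by apply/funext => y; rewrite big_nat_recr.
  by rewrite -[X in _ --> X](addr0 0); apply: cvgD.
have /cvgrPdist_le/(_ _ e4) {}cW := cW.
have /cvgr0Pnorm_le/(_ _ e4) {}cF := cF.
near=> y.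
have hW : `|a / mean - W y k| <= e / 4 by near: y.
have hF : `|\sum_(0 <= n < n0) \int[P]_w err y (Z n w)| <= e / 4 by near: y.
have hm : \forall m \near \oo, `|\sum_(0 <= n < m) window y n - a / mean| <= e.
  pose Cy := (1 - rho)^-1 * expR (s * (y + a)).
  have cy : Cy * A m @[m --> \oo] --> 0.
    by rewrite -[X in _ --> X](mulr0 Cy); apply: cvgM => //; exact: cvg_cst.
  have /cvgr0Pnorm_le/(_ _ e4) {}cy := cy.
  near=> m.
  have n0m : (n0 <= m)%N by near: m; exact: nbhs_infty_ge.
  have hCy : `|Cy * A m| <= e / 4 by near: m.
  have far0 : 0 <= \int[P]_w W y (Z m w).
    by apply: Rintegral_ge0 => w _; have /andP[] := W_bounds y (Z m w).
  have far1 : \int[P]_w W y (Z m w) <= e / 4.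
    by apply: le_trans (W_far y m) _; exact: le_trans (ler_norm _) hCy.
  have tail : `|\sum_(n0 <= n < m) \int[P]_w err y (Z n w)| <= e / 4.
    apply: le_trans (ler_norm_sum _ _ _) _; apply: le_trans (hn0 m n0m).
    by rewrite mulr_sumr; apply: ler_sum.
  rewrite window_sum (big_cat_nat (n := n0))//=.
  move: hW hF tail; rewrite !ler_norml => /andP[? ?] /andP[? ?] /andP[? ?].
  by apply/andP; split; lra.
have w0 n : (0%R <= (window y n)%:E)%E by rewrite lee_fin.
apply/andP; split.
  apply: lime_ge; first exact: is_cvg_nneseries.
  apply: filterS hm => m; rewrite sumEFin lee_fin ler_norml => /andP[? ?]; lra.
apply: lime_le; first exact: is_cvg_nneseries.
apply: filterS hm => m; rewrite sumEFin lee_fin ler_norml => /andP[? ?]; lra.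
Unshelve. all: by end_near. Qed.

End smoothed_counts.

(** * From ramps to windows *)

Section window_counts.
Context d (T : measurableType d) (R : realType) (P : probability T R).
Variables (Z : nat -> T -> nat) (c : R).
Hypothesis mZ : forall n x, measurable (Z n @^-1` [set x]).
Hypothesis smoothed : forall eps a : R, 0 < eps -> 0 <= a ->
  (\sum_(n <oo) (\int[P]_w ramp_window eps a (y - ln (Z n w)%:R))%:E)%E @[y --> +oo]
  --> (a * c)%:E.
Hypothesis c_ge0 : 0 <= c.

Let window_event B C y n : set T :=
  [set w | y + B <= ln ((Z n w)%:R : R) <= y + C].

Let measurable_nat_event (A : set nat) n : measurable [set w | A (Z n w)].
Proof.
rewrite (_ : [set w | _] = \bigcup_(x in A) Z n @^-1` [set x]).
  exact: bigcup_measurable.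
by apply/seteqP; split => w /=; [move=> h; exists (Z n w)|move=> [x /= h ->]].
Qed.

Lemma integral_counting (A : nat -> set nat) :
  (\int[P]_w counting [set n : nat | A n (Z n w)] =
   \sum_(n <oo) P [set w | A n (Z n w)])%E.
Proof.
pose F n : set T := [set w | A n (Z n w)].
have mF n : measurable (F n) by exact: measurable_nat_event.
have E w : (counting [set n : nat | A n (Z n w)] = \sum_(n <oo) (\1_(F n) w : R)%:E)%E.
  rewrite counting_dirac; apply: eq_eseriesr => n _; rewrite diracE indicE.
  by congr (_%:R%:E); apply/idP/idP; rewrite !inE.
under eq_integral do rewrite E.
rewrite integral_nneseries//; last first.
  by move=> n; apply/measurable_EFinP; exact: measurable_indic.
by apply: eq_eseriesr => n _; rewrite integral_indic// setIT.
Qed.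

Let mean_window_le (f g : nat -> R) n : (forall x, 0 <= f x <= 1) -> (forall x, 0 <= g x <= 1) ->
  (forall x, f x <= g x) -> \int[P]_w f (Z n w) <= \int[P]_w g (Z n w).
Proof.
move=> f01 g01 fg.
have i (h : nat -> R) : (forall x, 0 <= h x <= 1) ->
    P.-integrable setT (EFin \o (fun w => h (Z n w))).
  move=> h01; apply: (@integrable_bounded _ _ _ _ _ 1); first exact: measurable_nat_comp.
  by move=> w; have /andP[? ?] := h01 (Z n w); rewrite ger0_norm.
by apply: Rintegral_le => //; exact: i.
Qed.

Let event_mean B C y n : P (window_event B C y n) =
  (\int[P]_w (\1_[set x : nat | y + B <= ln (x%:R : R) <= y + C] (Z n w)))%:E.
Proof.
rewrite EFin_Rintegral; last first.
  apply: (@integrable_bounded _ _ _ _ _ 1).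
    exact: (measurable_nat_comp (\1_[set x : nat | y + B <= ln (x%:R : R) <= y + C]) (mZ n)).
  by move=> w; rewrite indicE; case: (_ \in _); rewrite ?normr1 ?normr0.
rewrite (eq_integral (fun w => (\1_(window_event B C y n) w)%:E)).
  by rewrite integral_indic// ?setIT//; exact: (measurable_nat_event [set x : nat | y + B <= ln (x%:R : R) <= y + C]).
by move=> w _; rewrite !indicE; congr (_%:R%:E); apply/idP/idP; rewrite !inE.
Qed.

Lemma window_count_limit (B C : R) : B < C ->
  (\sum_(n <oo) P (window_event B C y n))%E @[y --> +oo] --> ((C - B) * c)%:E.
Proof.
move=> BC.
have w01 (eps a x : R) : 0 < eps -> 0 <= a -> 0 <= ramp_window eps a x <= 1.
  by move=> ? ?; exact: ramp_window_bounds.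
pose ind y (x : nat) : R := \1_[set x : nat | y + B <= ln (x%:R : R) <= y + C] x.
have ind01 y x : 0 <= ind y x <= 1 by rewrite /ind indicE; case: (_ \in _); rewrite ?lexx ?ler01.
(* Shifted by [B + eps] and with width [C - B - eps], the trapezoid vanishes outside
   [[y + B, y + C]]. *)
have lower (eps y : R) : 0 < eps -> eps <= C - B ->
    (\sum_(n <oo) (\int[P]_w ramp_window eps (C - B - eps) (y + (B + eps) - ln (Z n w)%:R))%:E <=
     \sum_(n <oo) P (window_event B C y n))%E.
  move=> e0 eCB; have a0 : 0 <= C - B - eps by rewrite subr_ge0.
  apply: lee_nneseries => n _.
    by move=> _; rewrite lee_fin; apply: Rintegral_ge0 => w _; case/andP: (w01 eps (C - B - eps) (y + (B + eps) - ln (Z n w)%:R) e0 a0).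
  rewrite event_mean lee_fin.
  apply: (mean_window_le (f := fun x => ramp_window eps (C - B - eps) (y + (B + eps) - ln x%:R)) (g := ind y)) => //.
    by move=> x; exact: w01.
  move=> x; rewrite /ind indicE; have [_|] := boolP (x \in _).
    by case/andP: (w01 eps _ (y + (B + eps) - ln x%:R) e0 a0).
  rewrite notin_setE /= => /negP; rewrite negb_and -!ltNge => /orP[] h; rewrite /ramp_window.
    by rewrite !ramp_eq1 ?subrr//; lra.
  by rewrite !ramp_eq0 ?subrr//; lra.
(* Shifted by [B] and with width [C - B + eps], the trapezoid equals 1 on the whole of
   [[y + B, y + C]]. *)
have upper (eps y : R) : 0 < eps ->
    (\sum_(n <oo) P (window_event B C y n) <=
     \sum_(n <oo) (\int[P]_w ramp_window eps (C - B + eps) (y + B - ln (Z n w)%:R))%:E)%E.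
  move=> e0; have a0 : 0 <= C - B + eps by rewrite addr_ge0 ?subr_ge0 ?ltW.
  apply: lee_nneseries => n _; first by [].
  rewrite event_mean lee_fin.
  apply: (mean_window_le (f := ind y) (g := fun x => ramp_window eps (C - B + eps) (y + B - ln x%:R))) => //.
    by move=> x; exact: w01.
  move=> x; rewrite /ind indicE; have [|_] := boolP (x \in _); last first.
    by case/andP: (w01 eps _ (y + B - ln x%:R) e0 a0).
  rewrite inE /= => /andP[h1 h2]; rewrite /ramp_window ramp_eq1//; last by lra.
  by rewrite ramp_eq0 ?subr0//; lra.
have near_shift (F : R -> \bar R) (l z e : R) : F y @[y --> +oo] --> l%:E -> 0 < e ->
    \forall y \near +oo, ((l - e)%:E <= F (y + z)%R <= (l + e)%:E)%E.
  move=> Fl e0; have {}Fl : F (y + z) @[y --> +oo] --> l%:E.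
    by apply: (cvg_comp (fun y : R => y + z) F _ Fl); exact: cvg_addrr.
  move/fine_cvgP : Fl => [fin1 /cvgrPdist_le/(_ _ e0)].
  apply: filterS2 fin1 => y /fineK <- /=.
  by rewrite !lee_fin ler_norml => /andP[? ?]; apply/andP; split; lra.
have near_bounds (e : R) : 0 < e -> \forall y \near +oo,
    (((C - B) * c - e)%:E <= \sum_(n <oo) P (window_event B C y n) <= ((C - B) * c + e)%:E)%E.
  move=> e0.
  (* The first entry keeps the inner width nonnegative; the second bounds by [e / 2] the change
     [eps * c] of the limit. *)
  pose eps := Num.min (C - B) (e / 2 / (c + 1)).
  have c1 : 0 < c + 1 by rewrite ltr_wpDl.
  have eps0 : 0 < eps by rewrite lt_min subr_gt0 BC !divr_gt0.
  have epsBC : eps <= C - B by rewrite ge_min lexx.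
  have epsc : eps * c <= e / 2.
    have h : eps * (c + 1) <= e / 2 by rewrite -ler_pdivlMr// ge_min lexx orbT.
    by move: h; rewrite mulrDr mulr1; lra.
  have a1 : 0 <= C - B - eps by rewrite subr_ge0.
  have a2 : 0 <= C - B + eps by rewrite addr_ge0 ?subr_ge0 ?ltW.
  have e2 : 0 < e / 2 by rewrite divr_gt0.
  have := near_shift _ _ (B + eps) _ (smoothed eps0 a1) e2.
  have := near_shift _ _ B _ (smoothed eps0 a2) e2.
  apply: filterS2 => y /andP[_ h2] /andP[h1 _]; apply/andP; split.
    apply: le_trans (lower eps y eps0 epsBC); apply: le_trans h1.
    by rewrite lee_fin !mulrBl; lra.
  apply: le_trans (upper eps y eps0) _; apply: le_trans h2 _.
  by rewrite lee_fin mulrDl mulrBl; lra.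
apply/fine_cvgP; split.
  have := near_bounds 1 ltr01; apply: filterS => y /andP[h1 h2].
  by rewrite fin_numElt (lt_le_trans _ h1) ?ltNyr// (le_lt_trans h2) ?ltry.
apply/cvgrPdist_le => e e0; have := near_bounds e e0; apply: filterS => y /andP[] /=.
case: (\sum_(n <oo) _)%E => [r| |]; rewrite ?leye_eq ?leeNy_eq//.
by rewrite !lee_fin /= => h1 h2; rewrite ler_norml; apply/andP; split; lra.
Qed.

Lemma window_count_limits (B C : R) : 0 <= B < C ->
  ((\int[P]_w counting [set n : nat |
       (y + B)%:E <= lne (Z n w)%:R%:E <= (y + C)%:E])%E
     @[y --> +oo] --> ((C - B) * c)%:E) /\
  ((\int[P]_w counting [set n : nat |
       (expR B * y <= (Z n w)%:R <= expR C * y)%R])%E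
     @[y --> +oo] --> ((C - B) * c)%:E).
Proof.
move=> /andP[B0 BC]; have cv := window_count_limit BC; split.
- apply: cvg_trans cv; apply: near_eq_cvg; near=> y.
  have y0 : 0 < y by near: y; exact: nbhs_pinfty_gt (num_real _).
  (* [lne] and [ln] disagree only at 0, with values [-oo] and 0; for [y > 0] and [B >= 0] neither
     lies in the window. *)
  have E (x : nat) : ((y + B)%:E <= lne (x%:R : R)%:E <= (y + C)%:E)%E =
      (y + B <= ln (x%:R : R) <= y + C).
    case: x => [|x]; last by rewrite lne_EFin ?ltr0n.
    by rewrite le0_lneNy// leeNy_eq ln0// [y + B <= 0]leNgt ltr_wpDr.
  rewrite (integral_counting (fun=> [set x : nat | ((y + B)%:E <= lne (x%:R : R)%:E <= (y + C)%:E)%E])).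
  by apply: eq_eseriesr => n _; congr (P _); apply/funext => w; rewrite /window_event [in RHS]/mkset E.
(* The second count is the first one evaluated at [ln y]. *)
- have lnoo : ln y @[y --> +oo] --> (+oo : set_system R).
    apply/cvgryPge => A; apply: filterS (nbhs_pinfty_ge (num_real (expR A))) => y Ay.
    by rewrite -[A]expRK ler_ln ?posrE ?expR_gt0// (lt_le_trans _ Ay) ?expR_gt0.
  apply: cvg_trans (cvg_comp _ _ lnoo cv); apply: near_eq_cvg; near=> y.
  have y0 : 1 < y by near: y; exact: nbhs_pinfty_gt (num_real _).
  have y1 : 0 < y by exact: lt_trans y0.
  have E (x : nat) : (expR B * y <= x%:R <= expR C * y) = (ln y + B <= ln (x%:R : R) <= ln y + C).
    case: x => [|x].
      by rewrite (@ln0 _ 0)// [ln y + B <= 0]leNgt ltr_wpDr ?ln_gt0// leNgt mulr_gt0 ?expR_gt0.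
    rewrite -[ln y + B]expRK -[ln y + C]expRK !expRD !lnK ?posrE//.
    by rewrite !ler_ln ?posrE ?mulr_gt0 ?expR_gt0 ?ltr0n// ![y * _]mulrC.
  rewrite /= (integral_counting (fun=> [set x : nat | expR B * y <= x%:R <= expR C * y])).
  by apply: eq_eseriesr => n _; congr (P _); apply/funext => w; rewrite /window_event [in RHS]/mkset E.
Unshelve. all: by end_near. Qed.

End window_counts.

(** * The logarithm of the offspring mean *)

Section log_offspring_mean.
Variable R : realType.

Lemma offspring_mean_integral (q : environment R) :
  (offspring_mean q = \int[offspring_law q]_j j%:R%:E)%E.
Proof.
rewrite (offspring_integral_series q (g := fun j => j%:R%:E))//.
by apply: eq_eseriesr => j _; rewrite fineK ?offspring_law_fin.
Qed.

Lemma offspring_mean_ge0 (q : environment R) : (0 <= offspring_mean q)%E.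
Proof. by apply: nneseries_ge0 => j _ _; rewrite mule_ge0. Qed.

Let offspring_indic (q : environment R) (A : set nat) :
  (\int[offspring_law q]_j (\1_A j)%:E = offspring_law q A)%E.
Proof. by rewrite integral_indic// setIT. Qed.

Lemma offspring_mean_ge (q : environment R) : (1 - offspring_law q [set 0%N] <= offspring_mean q)%E.
Proof.
rewrite -probability_setC// -offspring_indic offspring_mean_integral.
apply: ge0_le_integral => // j _; rewrite lee_fin indicE.
by rewrite ler_nat; case: j => [|j]; [rewrite memNset//= => h; exact: h|case: (_ \in _)].
Qed.

Lemma offspring_mean_le1 (q : environment R) :
  offspring_law q [set j | (1 < j)%N] = 0%E -> (offspring_mean q <= 1)%E.
Proof.
move=> q0; rewrite offspring_mean_integral.
have <- : (\int[offspring_law q]_j 1 = 1 :> \bar R)%E.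
  by rewrite integral_cst// mul1e; exact: probability_setT.
apply: ae_ge0_le_integral => //.
exists [set j | (1 < j)%N]; split => // j /=.
by move=> h; rewrite ltnNge; apply/negP => j1; apply: h => _; rewrite lee_fin lern1.
Qed.

Lemma measurable_fine_offspring_mean :
  measurable_fun setT (fun q : environment R => fine (offspring_mean q)).
Proof.
by apply: (measurableT_comp (fine_measurable measurableT)); exact: measurable_offspring_mean.
Qed.

(* A version of [ln m] bounded below everywhere: [m >= 1 - f{0} > 1 - delta]. *)
Definition log_mean (delta : R) (q : environment R) : R :=
  ln (Num.max (fine (offspring_mean q)) (1 - delta)).

Lemma measurable_log_mean delta : measurable_fun setT (log_mean delta).
Proof.
apply: (measurableT_comp (@measurable_ln R)); apply: measurable_maxr => //.
exact: measurable_fine_offspring_mean.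
Qed.

Lemma log_mean_ge delta q : delta < 1 -> ln (1 - delta) <= log_mean delta q.
Proof.
move=> d1; rewrite /log_mean ler_ln ?posrE ?lt_max ?subr_gt0 ?d1 ?orbT//.
by rewrite le_max lexx orbT.
Qed.

Lemma log_meanE delta (q : environment R) : (offspring_law q [set 0%N] < delta%:E)%E ->
  (offspring_mean q < +oo)%E -> log_mean delta q = ln (fine (offspring_mean q)).
Proof.
move=> qd qoo; congr ln; apply/max_idPl; rewrite -lee_fin fineK; last first.
  by rewrite ge0_fin_numE// offspring_mean_ge0.
apply: le_trans (offspring_mean_ge q); rewrite EFinB leeB//.
exact: ltW.
Qed.

End log_offspring_mean.

(** * Consequences of the hypotheses on the environment *)

Section supercritical_environment.
Context d (T : measurableType d) (R : realType) (P : probability T R).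
Variable Q : nat -> {mfun T >-> environment R}.
Variables (N : nat -> nat -> {mfun T >-> nat}) (Y : nat -> {mfun T >-> nat}).
Hypothesis hNY : quenched_independent P Q N Y.
Let f w := offspring_law (Q 0%N w).
Let m1 w := fine (offspring_mean (Q 0%N w)).
Hypothesis hm : {ae P, forall w, (0 < offspring_mean (Q 0%N w) < +oo)%E}.
Variables delta mu : R.
Hypothesis delta01 : 0 < delta < 1.
Hypothesis hB : {ae P, forall w, (f w [set 0%N] < delta%:E)%E}.
Hypothesis hmu : ('E_P[fun w => ln (m1 w)] = mu%:E)%E.
Let X w := log_mean delta (Q 0%N w).

Let mm1 : measurable_fun setT m1.
Proof. exact: (measurableT_comp (@measurable_fine_offspring_mean R)). Qed.

Lemma measurable_log_mean_env : measurable_fun setT X.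
Proof. exact: (measurableT_comp (@measurable_log_mean R delta)). Qed.
Let mX := measurable_log_mean_env.

Lemma ae_log_mean : {ae P, forall w, X w = ln (m1 w)}.
Proof. by apply: filterS2 hm hB => w /andP[_ h1] h2; exact: log_meanE. Qed.

Let ae_m1 : {ae P, forall w, 0 < m1 w /\ (m1 w)%:E = offspring_mean (Q 0%N w)}.
Proof.
by apply: filterS hm => w /andP[h1 h2]; rewrite /m1 fine_gt0 ?h1// fineK// ge0_fin_numE// ltW.
Qed.

Lemma ae_exp_log_mean : {ae P, forall w, expR (- X w) = (m1 w)^-1}.
Proof.
by apply: filterS2 ae_log_mean ae_m1 => w -> [m0 _]; rewrite expRN lnK.
Qed.

Lemma ae_normalized_mean : {ae P, forall w,
  (\int[f w]_j (j%:R * expR (- X w))%:E = 1)%E}.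
Proof.
apply: filterS2 ae_exp_log_mean ae_m1 => w -> [m0 mE].
under eq_integral do rewrite EFinM.
rewrite ge0_integralZr// ?lee_fin ?invr_ge0 ?ltW//.
by rewrite -offspring_mean_integral -mE -EFinM divff// gt_eqF.
Qed.

Lemma integral_log_mean : (\int[P]_w (X w)%:E = mu%:E)%E.
Proof.
rewrite -hmu unlock; apply: ae_eq_integral => //.
- exact/measurable_EFinP.
- by apply/measurable_EFinP; exact: (measurableT_comp (@measurable_ln R)).
- by apply: filterS ae_log_mean => w /= ->.
Qed.

(** A finite expectation only asserts a finite difference of the integrals of the positive and
    negative parts. Here the negative part is bounded, so the positive part has a finite integral
    too. *)
Lemma integrable_log_mean : P.-integrable setT (EFin \o X).
Proof.
have Xb w : ln (1 - delta) <= X w by apply: log_mean_ge; case/andP: delta01.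
have mXE : measurable_fun setT (EFin \o X) by exact/measurable_EFinP.
pose b := Num.max 0 (- ln (1 - delta)).
have neg_le w : ((EFin \o X)^\- w <= b%:E)%E.
  by rewrite funenegE /= -EFin_max lee_fin /b ge_max !le_max lexx /= andbT lerN2 Xb orbT.
have negoo : (\int[P]_w (EFin \o X)^\- w <= b%:E)%E.
  have <- : (\int[P]_w b%:E = b%:E)%E.
    by rewrite integral_cst// -[RHS]mule1; congr (_ * _)%E; exact: probability_setT.
  apply: ge0_le_integral => //; first exact: measurable_funeneg.
have negge0 : (0 <= \int[P]_w (EFin \o X)^\- w)%E by exact: integral_ge0.
have negfin : (\int[P]_w (EFin \o X)^\- w)%E \is a fin_num.
  by rewrite ge0_fin_numE// (le_lt_trans negoo) ?ltry.
apply/integrableP; split => //.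
have -> : (\int[P]_w `|(EFin \o X) w| =
    \int[P]_w (EFin \o X)^\+ w + \int[P]_w (EFin \o X)^\- w)%E.
  rewrite -ge0_integralD//; [|exact: measurable_funepos|exact: measurable_funeneg].
  by apply: eq_integral => w _; rewrite -[LHS]/((abse \o (EFin \o X)) w) fune_abse.
have := integral_log_mean; rewrite integralE -/(EFin \o X).
move: negfin; case: (\int[P]_w (EFin \o X)^\- w)%E => [r| |]// _.
by case: (\int[P]_w _)%E => [r'| |]//= _; rewrite -EFinD ltry.
Qed.

Lemma nonlattice_log_mean : nonlattice P (fun w => ln (m1 w)) -> nonlattice P X.
Proof.
move=> hlat [a [h [h0 PX]]]; apply: hlat; exists a, h; split => //; rewrite -PX.
have mL (V : T -> R) : measurable_fun setT V ->
    measurable [set w | exists z : int, V w = a + h * z%:~R].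
  move=> mV; rewrite (_ : [set w | _] = \bigcup_(z : int) V @^-1` [set a + h * z%:~R]).
    by apply: countable_bigcupT_measurable => [|z]; [exact: countableP|]; rewrite -[X in measurable X]setTI; exact: mV.
  by apply/seteqP; split => w /=; [move=> [z Vz]; exists z|move=> [z _ Vz]; exists z].
have ind A : measurable A -> P A = (\int[P]_w (\1_A w)%:E)%E.
  by move=> mA; rewrite integral_indic// setIT.
have mA := mL _ (measurableT_comp (@measurable_ln R) mm1).
have mB := mL _ mX.
rewrite !ind//; apply: ae_eq_integral => //.
- by apply/measurable_EFinP; exact: measurable_indic.
- by apply/measurable_EFinP; exact: measurable_indic.
- apply: filterS ae_log_mean => w Xw _; congr (_%:E); rewrite !indicE; congr (nat_of_bool _)%:R.
  by apply/idP/idP; rewrite !inE /= Xw.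
Qed.

Lemma offspring_moment (p q : R) :
  ('E_P[fun w => ((1 + `|ln (m1 w)| `^ q) * (((N 0%N 0%N w)%:R / m1 w) `^ p + 1))%R] < +oo)%E ->
  (\int[P]_w (((N 0%N 0%N w)%:R * expR (- X w)) `^ p)%:E < +oo)%E.
Proof.
rewrite unlock; apply: le_lt_trans.
have mN : measurable_fun setT (fun w => (N 0%N 0%N w)%:R : R).
  by apply: (@measurable_nat_comp _ _ _ (N 0%N 0%N) (fun n => n%:R)) => x; exact: measurable_nat_fiber.
have mpow (V : T -> R) r : measurable_fun setT V -> measurable_fun setT (fun w => V w `^ r).
  by move=> mV; exact: (measurableT_comp (@measurable_powR R r)).
apply: ae_ge0_le_integral => //.
- apply/measurable_EFinP; apply: (mpow); apply: measurable_funM => //.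
  by apply: measurableT_comp => //; exact: measurable_funN.
- by move=> w _; rewrite lee_fin mulr_ge0// addr_ge0 ?powR_ge0.
- apply/measurable_EFinP; apply: measurable_funM.
    apply: measurable_funD => //; apply: (mpow).
    by apply: measurableT_comp => //; exact: (measurableT_comp (@measurable_ln R)).
  apply: measurable_funD => //; apply: (mpow); apply: measurable_funM => //.
  rewrite (_ : (fun w => _) = (fun w => m1 w `^ (-1))); first exact: mpow.
  by apply/funext => w; rewrite powR_inv1// fine_ge0 ?offspring_mean_ge0.
- apply: filterS ae_exp_log_mean => w -> _; rewrite lee_fin.
  have h : 0 <= ((N 0%N 0%N w)%:R / m1 w) `^ p by exact: powR_ge0.
  rewrite mulrDl mul1r; apply: ler_wpDr; first by rewrite mulr_ge0 ?powR_ge0// addr_ge0.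
  by rewrite lerDl.
Qed.

Lemma immigrants_integrable (p : R) : 1 <= p ->
  ('E_P[fun w => ((Y 0%N w)%:R `^ p)%R] < +oo)%E ->
  P.-integrable setT (EFin \o fun w => (Y 0%N w)%:R : R).
Proof.
move=> p1; rewrite unlock => h.
have mY : measurable_fun setT (fun w => (Y 0%N w)%:R : R).
  by apply: (@measurable_nat_comp _ _ _ (Y 0%N) (fun n => n%:R)) => x; exact: measurable_nat_fiber.
apply/integrableP; split; first exact/measurable_EFinP.
apply: le_lt_trans h; apply: ge0_le_integral => //.
- by apply/measurable_EFinP; exact: measurableT_comp.
- by apply/measurable_EFinP; exact: (measurableT_comp (@measurable_powR R p)).
- move=> w _; rewrite /= lee_fin ger0_norm//; case: (Y 0%N w) => [|n]; first by rewrite powR_ge0.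
  by rewrite -[leLHS]powRr1// ler_powR// ler1n.
Qed.

(** The probability is the integral of a nonnegative product; if it were 0, the product would vanish
    almost surely, and with it one of its factors. *)
Lemma quenched_event_gt0 (s : seq (nat * option nat)) (B : nat * option nat -> set nat) :
  uniq s -> ~ {ae P, forall w, exists2 j, j \in s & reproduction_law Q j w (B j) = 0%E} ->
  (0 < P (\bigcap_(j in [set` s]) reproduction_var N Y j @^-1` B j))%E.
Proof.
move=> us nae; have envT : environment_events Q setT.
  by have := @measurableT _ (g_sigma_algebraType _); exact.
have := hNY B us envT; rewrite setTI => ->.
pose F w := \prod_(j <- s) fine (reproduction_law Q j w (B j)).
have fin j w : reproduction_law Q j w (B j) \is a fin_num by exact: fin_num_measure.
have F0 w : 0 <= F w by apply: prodr_ge0 => j _; rewrite fine_ge0.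
have mF : measurable_fun setT F.
  apply: measurable_prod => -[n [i|]] _.
    exact: (measurableT_comp (measurable_offspring_law (B (n, Some i)))).
  exact: (measurableT_comp (measurable_immigration_law (B (n, None)))).
have -> : (\int[P]_w \big[*%E/1]_(j <- s) reproduction_law Q j w (B j) =
    \int[P]_w (F w)%:E)%E.
  by apply: eq_integral => w _; rewrite -prodEFin; apply: eq_bigr => j _; rewrite fineK.
rewrite lt_def integral_ge0 ?andbT; last by move=> w _; rewrite lee_fin.
apply/eqP => I0; apply: nae.
have mFE : measurable_fun setT (EFin \o F) by exact/measurable_EFinP.
have [/(_ _)h _] := ae_eq_integral_abs P measurableT mFE.
have {}h : ae_eq P setT (EFin \o F) (cst 0%E).
  by apply: h; rewrite -[RHS]I0; apply: eq_integral => w _; rewrite /= ger0_norm.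
apply: filterS h => w /(_ I) [] /eqP; rewrite prodf_seq_eq0 => /hasP[j js /eqP j0].
by exists j => //; rewrite -[LHS]fineK// j0.
Qed.

(* Otherwise [f] almost surely has no mass above 1, so [m <= 1] and [mu <= 0]. *)
Lemma upward_step_gt0 (mu0 : 0 < mu)
  (himm : (0 < P [set w | (immigration_law (Q 0%N w) [set 0%N] < 1)%E])%E) z :
  (0 < P [set w | (z < \sum_(i < z) N 0%N i w + Y 0%N w)%N])%E.
Proof.
case: z => [|z].
  (* Without parents the population grows exactly when an immigrant arrives. *)
  rewrite (_ : [set w | _] = \bigcap_(j in [set` [:: (0%N, None)]])
      reproduction_var N Y j @^-1` (~` [set 0%N])); last first.
    apply/seteqP; split => w /=.
      by rewrite big_ord0 => h j /=; rewrite inE => /eqP ->; case: (Y 0%N w) h.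
    move=> /(_ (0%N, None)) /=; rewrite mem_head => /(_ isT).
    by rewrite big_ord0; case: (Y 0%N w).
  apply: quenched_event_gt0 => // nae; move: himm; rewrite lt0e => /andP[/eqP + _]; apply.
  apply/negligibleP.
    rewrite (_ : [set w | _] = (fun w => fine (immigration_law (Q 0%N w) [set 0%N])) @^-1` `]-oo, 1[).
      by rewrite -[X in measurable X]setTI; exact: (measurableT_comp (measurable_immigration_law [set 0%N])).
    apply/seteqP; split => w; rewrite /= in_itv /= -lte_fin fineK//; exact: immigration_law_fin.
  apply: negligibleS nae => w h1 [j]; rewrite inE => /eqP -> /=.
  rewrite probability_setC// => h0; move: h1; rewrite /= -[ltRHS]/(1%:E) -(fineK (immigration_law_fin _ _)).
  move: h0; rewrite -(fineK (immigration_law_fin _ _)) -EFinB => -[] /eqP.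
  by rewrite subr_eq0 => /eqP <-; rewrite ltxx.
have us : uniq [seq (0%N, Some i) | i <- iota 0 z.+1] by rewrite map_inj_uniq ?iota_uniq// => i j [].
(* At least two children for the first of the [z.+1] parents and one for each of the others give
   more than [z.+1] individuals. *)
pose B (j : nat * option nat) : set nat := if j.2 == Some 0%N then [set n | (1 < n)%N] else [set n | (0 < n)%N].
apply: lt_le_trans (quenched_event_gt0 (s := [seq (0%N, Some i) | i <- iota 0 z.+1]) (B := B) us _) _; last first.
  apply: le_measure; rewrite ?inE.
  - apply: fin_bigcap_measurable => // j _; exact: measurable_nat_fiber.
  - rewrite (_ : [set w | _] = \bigcup_(x in [set x | (z.+1 < x)%N]) step_event N Y 0 z.+1 x).
      by apply: bigcup_measurable => x _; exact: measurable_step_event.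
    by rewrite /step_event; apply/seteqP; split => w /= => [h|[x /= h ->]//]; exists (\sum_(i < z.+1) N 0%N i w + Y 0%N w)%N.
  move=> w /= h; rewrite big_ord_recl /=.
  have h0 : (1 < N 0%N 0%N w)%N by exact: (h (0%N, Some 0%N) (mem_head _ _)).
  have hS (i : 'I_z) : (0 < N 0%N (bump 0 i) w)%N.
    by apply: (h (0%N, Some i.+1)); apply: (map_f (fun i => (0%N, Some i)) (x := i.+1)); rewrite mem_iota; exact: (ltn_ord i).
  have : (\sum_(i < z) 1 <= \sum_(i < z) N 0%N (bump 0 i) w)%N by apply: leq_sum => i _; exact: hS.
  rewrite sum1_card card_ord => h1; apply: leq_trans (leq_addr _ _); exact: (leq_add h0 h1).
move=> nae; suff : mu <= 0 by rewrite leNgt mu0.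
(* Whichever factor vanishes, the mass of [f] above 1 is zero. *)
have f0 : {ae P, forall w, offspring_law (Q 0%N w) [set j | (1 < j)%N] = 0%E}.
  apply: filterS nae => w [j /mapP[i _ ->]]; rewrite /B /=; case: ifP => // _ h.
  by apply: (subset_measure0 (B := [set n | (0 < n)%N])) => // n /=; exact: ltnW.
have X0 : {ae P, forall w, X w <= 0}.
  apply: filterS3 ae_log_mean ae_m1 f0 => w -> [m0 mE] /offspring_mean_le1.
  by rewrite -mE lee_fin => m1le; exact: ln_le0.
(* [X] is nonpositive only almost surely; replacing it by [- max(- X, 0)] fixes the sign
   everywhere. *)
rewrite -lee_fin -integral_log_mean (ae_eq_integral (fun w => - (Num.max (- X w) 0)%:E)%E)//.
- rewrite integral_ge0N => [|w _]; last by rewrite lee_fin le_max lexx orbT.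
  by rewrite oppe_le0; apply: integral_ge0 => w _; rewrite lee_fin le_max lexx orbT.
- exact/measurable_EFinP.
- apply/measurable_EFinP; apply: measurable_funN; apply: measurable_maxr => //.
  exact: measurable_funN.
- apply: filterS X0 => w X0 _ /=; rewrite max_l ?opprK//.
  by rewrite oppr_ge0.
Qed.

End supercritical_environment.

Theorem theorem4p3 (R : realType) (d : measure_display) (T : measurableType d)
  (P : probability T R) (Q : nat -> {mfun T >-> environment R})
  (N : nat -> nat -> {mfun T >-> nat}) (Y : nat -> {mfun T >-> nat})
  (hQ : iid P Q) (hNY : quenched_independent P Q N Y)
  (f := fun w : T => offspring_law (Q 0%N w))
  (h := fun w : T => immigration_law (Q 0%N w))
  (m1 := fun w : T => fine (offspring_mean (Q 0%N w)))
  (hm : {ae P, forall w, (0 < offspring_mean (Q 0%N w) < +oo)%E})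
  (mu : R) (hmu : ('E_P[fun w => ln (m1 w)] = mu%:E)%E) (hmu0 : 0 < mu)
  (himm : (0 < P [set w | (h w [set 0%N] < 1)%E])%E)
  (hlat : nonlattice P (fun w => ln (m1 w)))
  (hA : (0 < P [set w | [/\ (0 < h w [set 0%N])%E, (0 < f w [set 0%N])%E
                          & (0 < f w [set 1%N])%E]])%E)
  (hB : exists delta : R, 0 < delta < 1 /\
          {ae P, forall w, (f w [set 0%N] < delta%:E)%E})
  (hC : exists q p : R, [/\ 1 < q, 1 < p <= 2,
          ('E_P[fun w => ((1 + `|ln (m1 w)| `^ q) *
                 (((N 0%N 0%N w)%:R / m1 w) `^ p + 1))%R] < +oo)%E
        & ('E_P[fun w => ((Y 0%N w)%:R `^ p)%R] < +oo)%E])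
  (k : nat) (hk : (1 <= k)%N) (B C : R) (hBC : 0 <= B < C) :
  ((\int[P]_w counting [set n : nat |
       (y + B)%:E <= lne (bpire N Y k n w)%:R%:E <= (y + C)%:E])%E
     @[y --> +oo] --> ((C - B) / mu)%:E) /\
  ((\int[P]_w counting [set n : nat |
       (expR B * y <= (bpire N Y k n w)%:R <= expR C * y)%R])%E
     @[y --> +oo] --> ((C - B) / mu)%:E).
Proof.
have [delta [delta01 hd]] := hB; have [q [p [_ p12 momN momY]]] := hC.
have [delta_gt0 delta_lt1] := andP delta01; have [p1 _] := andP p12.
pose X w := log_mean delta (Q 0%N w).
have mX : measurable_fun setT X by exact: measurable_log_mean_env.
have iX : P.-integrable setT (EFin \o X) := integrable_log_mean hm delta01 hd hmu.
have ellb q' : - - ln (1 - delta) <= log_mean delta q' by rewrite opprK log_mean_ge.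
have Xb w : - - ln (1 - delta) <= X w by exact: ellb.
have b0 : 0 <= - ln (1 - delta) by rewrite oppr_ge0 ln_le0// gerBl ltW.
have meanX : \int[P]_w X w = mu by rewrite /Rintegral (integral_log_mean hm hd hmu).
have mean_gt0 : 0 < \int[P]_w X w by rewrite meanX.
have [s0 s0_gt0 laplace] := negative_exponential_moment_lt1 mX iX b0 Xb mean_gt0.
(* Below [s0] the Laplace transform is less than 1; below [(p - 1) / 8] the rate
   [z ^ (- (p - 1) / 4)] of the law of large numbers is at most [z ^ (- 2 s)], the square of the
   weight. *)
pose s := Num.min s0 ((p - 1) / 8).
have s_gt0 : 0 < s by rewrite lt_min s0_gt0 divr_gt0 ?subr_gt0.
have rho1 : \int[P]_w expR (- s * X w) < 1 by apply: laplace; rewrite s_gt0 ge_min lexx.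
have [K K0 LLN] := one_step_law_of_large_numbers hNY (@measurable_log_mean R delta)
  ellb (ae_normalized_mean hm hd) p12
  (offspring_moment hm hd momN) (immigrants_integrable (ltW p1) momY).
apply: (window_count_limits (c := mu^-1)) => //.
- by move=> n x; exact: measurable_bpire_fiber.
- move=> eps a eps0 a0; rewrite -meanX.
  apply: (smoothed_count_limit hQ hNY k mX iX Xb s_gt0 rho1 eps0 K0) => //.
  + exact: nonlattice_log_mean.
  + by move=> z /LLN[].
  + move=> z z0; have [_ /le_trans] := LLN z z0; apply.
    rewrite ler_wpM2l// /log_weight expr2 -expRD ler_expR.
    have lz : 0 <= ln (z%:R : R) by rewrite ln_ge0// ler1n.
    have sp : s <= (p - 1) / 8 by rewrite ge_min lexx orbT.
    by move: (ler_wpM2r lz sp); rewrite mulNr; lra.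
  + exact: (upward_step_gt0 hNY hm hd hmu).
- by rewrite invr_ge0 ltW.
Qed.
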